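(* Let $u\in C^\infty(\mathbb{R}^2;\mathbb{C})$ be a solution of $$-\Delta u=u\left(1-|u|^2\right)\quad\text{in }\mathbb{R}^2$$ such that $|u(x)|\to 1$ as $|x|\to\infty$. Then $$\int_{\mathbb{R}^2}\left[1-|u(x)|^2\right]^2\,dx<\infty.$$
   Context: Here $\Delta=\partial_1^2+\partial_2^2$ acts on complex-valued functions on $\mathbb{R}^2$ and $|u|$ is the complex modulus. The limit $|u(x)|\to1$ as $|x|\to\infty$ means that for every $\varepsilon>0$ there is $R>0$ with $\big||u(x)|-1\big|<\varepsilon$ whenever $|x|>R$. *)

(* Defs.v *)
From HB Require Import structures.
From mathcomp Require Import all_boot all_order all_algebra.
From mathcomp Require Import complex.
From mathcomp Require Import all_classical all_reals all_analysis.

Set Implicit Arguments.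
Unset Strict Implicit.
Unset Printing Implicit Defensive.

Import Order.TTheory GRing.Theory Num.Theory.
Import numFieldNormedType.Exports.

Local Open Scope classical_set_scope.
Local Open Scope ring_scope.

(* [Rcomplex R] already carries the field, the real vector space and the
   real-valued modulus `|z| = sqrt (Re z ^+ 2 + Im z ^+ 2); the instances below
   add the topology of the modulus, so that functions R^2 -> C have limits,
   continuity and real directional derivatives. *)
Section Rcomplex_normedModType.
Variable R : realType.

HB.instance Definition _ :=
  PseudoMetric.copy (Rcomplex R) (pseudoMetric_normed (Rcomplex R)).

HB.instance Definition _ := isPointed.Build (Rcomplex R) 0.

HB.instance Definition _ :=
  NormedZmod_PseudoMetric_eq.Build R (Rcomplex R) erefl.

Lemma Rcomplex_normrZ (l : R) (z : Rcomplex R) : `|l *: z| = `|l| * `|z|.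
Proof.
case: z => a b; rewrite /Num.norm /= /Normc.normc /=.
by rewrite !exprMn -mulrDr sqrtrM ?sqr_ge0// sqrtr_sqr.
Qed.

HB.instance Definition _ :=
  PseudoMetricNormedZmod_Lmodule_isNormedModule.Build R (Rcomplex R)
    Rcomplex_normrZ.

End Rcomplex_normedModType.

Section calculus_on_the_plane.
Variables (R : realType) (V : normedModType R).
Implicit Type f : R * R -> V.

Definition e1 : R * R := (1, 0).
Definition e2 : R * R := (0, 1).

Fixpoint class_C (k : nat) f : Prop :=
  continuous f /\
  if k is k'.+1 then
    [/\ forall x, derivable f x e1, forall x, derivable f x e2,
        class_C k' ('D_e1 f) & class_C k' ('D_e2 f)]
  else True.

Definition smooth f : Prop := forall k, class_C k f.

Definition laplacian f : R * R -> V :=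
  fun x => 'D_e1 ('D_e1 f) x + 'D_e2 ('D_e2 f) x.

End calculus_on_the_plane.

(* The library's norm on R * R is the max norm. *)
Definition euclidean_norm (R : realType) (x : R * R) : R :=
  Num.sqrt (x.1 ^+ 2 + x.2 ^+ 2).

(* Main.v *)
(** Let f = 1 - |u|^2, j = Im (conj u * grad u) and J = det (grad u), so that div j = 0 and curl j = 2 J.
    The equation gives f (1 - f)^2 - |j|^2 = (1 - f) (Delta f) / 2 + |grad f|^2 / 4, hence f^2 is
    controlled at infinity by (Delta f)^2, |grad f|^2 and |j|^4. A maximum principle for the gradient
    (Bernstein) shows that j and grad f tend to 0.

    Testing the identity with cut-offs times Delta f bounds Delta f and grad f in L^2 by a small multiple
    of grad j, and J is of order |j| |grad f|. Conversely grad j is controlled by J up to the integral of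
    det (grad j), which is a boundary term: over the square of half-side r it is at most
    (5/6) r times the boundary integral of the squared tangential derivative. Since the factor in this loop
    bound is small enough, all these estimates survive the weight (1 + |x|^2)^(11/20).

    The inverse of this weight is integrable on lines, so the Cauchy-Schwarz inequality along horizontal and
    vertical lines bounds |j(x,y)|^2 by an integrable function of y alone and by one of x alone. The product
    of the two bounds shows that |j|^4 is integrable. *)

Require Import Defs.
From mathcomp Require Import all_boot all_order all_algebra.
From mathcomp Require Import complex ring lra.
From mathcomp Require Import all_classical all_reals all_analysis measurable_realfun.
Import Order.TTheory GRing.Theory Num.Theory.
Import numFieldNormedType.Exports.
Local Open Scope classical_set_scope.
Local Open Scope ring_scope.

(** * Integrals over intervals and squares *)

(** Square integrability of grad j alone controls no L^p norm of j in the plane, and j is only known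
    to tend to 0 without a rate; this is what forces a weight. Its exponent 11/10, as a power of
    |x|, is squeezed from two sides: it has to exceed 1 for the inverse to be integrable on lines,
    and when the weighted boundary term is differentiated in r, the derivative of the weight costs
    this exponent times the loop constant 5/6, a product that has to stay below 1. Cut-offs cannot
    carry the weight for j: the squared gradient of its root, of order |x|^(-9/10), times |j|^2 is
    not known to be integrable. They do carry it for grad f, which is square integrable beforehand,
    the root of the weight having bounded gradient. Without weight they suffice for j too: squared
    gradients of order r^-2 on an area of order r^2 cost a constant once j is bounded. The
    unweighted bound also makes the boundary term small at suitable r, because 1/r has a divergent
    integral. Absorption presupposes finite quantities, so the weight is truncated, with constants
    independent of the truncation. *)

Lemma continuous_pair {X Y Z : topologicalType} (f : X -> Y) (g : X -> Z) :
  continuous f -> continuous g -> continuous (fun x => (f x, g x)).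
Proof.
by move=> cf cg x; apply: (@cvg_pair _ _ _ (nbhs x) (nbhs (f x)) (nbhs (g x)));
  [exact: cf|exact: cg].
Qed.

Lemma continuous_pairl {X Y : topologicalType} (x : X) : continuous (fun y : Y => (x, y)).
Proof. by apply: continuous_pair => y; [exact: cvg_cst|exact: cvg_id]. Qed.

Lemma continuous_pairr {X Y : topologicalType} (y : Y) : continuous (fun x : X => (x, y)).
Proof. by apply: continuous_pair => x; [exact: cvg_id|exact: cvg_cst]. Qed.

Section Integral1.
Context {R : realType}.
Implicit Types (a b r x : R) (f g F : R -> R).

Definition int1 a b g : R := \int[lebesgue_measure]_(x in `[a, b]) g x.

Lemma integrable_itvcc a b g : {within `[a, b], continuous g} ->
  lebesgue_measure.-integrable `[a, b] (EFin \o g).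
Proof. by move=> cg; apply: continuous_compact_integrable => //; exact: segment_compact. Qed.

Lemma continuous_itvcc a b g : continuous g -> {within `[a, b], continuous g}.
Proof. by move=> cg; exact: continuous_subspaceT. Qed.
#[local] Hint Resolve continuous_itvcc integrable_itvcc : core.

Lemma EFin_int1 a b g : {within `[a, b], continuous g} ->
  (\int[lebesgue_measure]_(x in `[a, b]) (g x)%:E = (int1 a b g)%:E)%E.
Proof.
move=> cg; rewrite /int1 /Rintegral fineK//.
exact/integrable_fin_num/integrable_itvcc.
Qed.

Lemma int1_le_within a b f g : {within `[a, b], continuous f} ->
  {within `[a, b], continuous g} ->
  (forall x, a <= x <= b -> f x <= g x) -> int1 a b f <= int1 a b g.
Proof.
move=> cf cg fg; apply: le_Rintegral => //; try exact: integrable_itvcc.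
Qed.

Lemma int1_le a b f g : continuous f -> continuous g ->
  (forall x, a <= x <= b -> f x <= g x) -> int1 a b f <= int1 a b g.
Proof. by move=> cf cg; apply: int1_le_within; exact: continuous_itvcc. Qed.

Lemma int1D a b f g : continuous f -> continuous g ->
  int1 a b (fun x => f x + g x) = int1 a b f + int1 a b g.
Proof. by move=> cf cg; apply: RintegralD => //; exact/integrable_itvcc/continuous_itvcc. Qed.

Lemma int1B a b f g : continuous f -> continuous g ->
  int1 a b (fun x => f x - g x) = int1 a b f - int1 a b g.
Proof. by move=> cf cg; apply: RintegralB => //; exact/integrable_itvcc/continuous_itvcc. Qed.

Lemma int1Zl a b (k : R) f : continuous f -> int1 a b (fun x => k * f x) = k * int1 a b f.
Proof. by move=> cf; apply: RintegralZl => //; exact/integrable_itvcc/continuous_itvcc. Qed.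

Lemma int1_cst a b (k : R) : a <= b -> int1 a b (fun=> k) = k * (b - a).
Proof.
move=> ab; rewrite /int1 Rintegral_cst//= lebesgue_measure_itv/= lte_fin.
by case: ltgtP ab => [ab _|//|-> _]; rewrite -?EFinB//= subrr.
Qed.

Lemma eq_int1 a b f g : (forall x, a <= x <= b -> f x = g x) -> int1 a b f = int1 a b g.
Proof. by move=> fg; apply: eq_Rintegral => x; rewrite inE/= in_itv/= => /fg. Qed.

Lemma int1_FTC a b g F : a <= b -> {within `[a, b], continuous g} ->
  (forall x, a <= x <= b -> is_derive x 1 F (g x)) -> int1 a b g = F b - F a.
Proof.
rewrite le_eqVlt => /predU1P[<- _ _|ab cg dF].
  by rewrite /int1 set_itv1 Rintegral_set1 subrr.
have cF x : a <= x <= b -> {for x, continuous F}.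
  move=> /dF xab; apply: differentiable_continuous.
  exact/derivable1_diffP.
rewrite /int1 /Rintegral (@continuous_FTC2 _ g F)//.
- split.
  + by move=> x /[!in_itv]/= /andP[ax xb]; have := dF x; rewrite !ltW// => /(_ isT)[].
  + by apply: cvg_at_right_filter; apply: cF; rewrite lexx ltW.
  + by apply: cvg_at_left_filter; apply: cF; rewrite lexx ltW.
- move=> x /[!in_itv]/= /andP[ax xb]; rewrite derive1E.
  by have := dF x; rewrite !ltW// => /(_ isT) h; rewrite derive_val.
Qed.

Lemma is_derive_int1 a x g : a < x -> continuous g ->
  is_derive x 1 (fun x => int1 a x g) (g x).
Proof.
move=> ax cg.
have x1 : x < x + 1 by rewrite ltrDl.
have [|] := @continuous_FTC1_closed R g a x (x + 1) x1 _ ax (cg x).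
  exact/integrable_itvcc/continuous_itvcc.
by rewrite derive1E => d <-; exact: DeriveDef.
Qed.

Lemma is_derive_int1_sym r g : 0 < r -> continuous g ->
  is_derive r 1 (fun r => int1 (- r) r g) (g r + g (- r)).
Proof.
move=> r0 cg; pose G x := int1 (- (r + 1)) x g.
have dG x : - (r + 1) < x -> is_derive x 1 G (g x).
  by move=> ?; exact: is_derive_int1.
have E : \forall s \near r, int1 (- s) s g = G s - G (- s).
  near=> s; have ? : 0 < s by near: s; exact: lt_nbhsr.
  have ? : s < r + 1 by near: s; apply: lt_nbhsl; rewrite ltrDl.
  apply: int1_FTC; [lra|exact: continuous_itvcc|move=> x ?; apply: dG; lra].
have dd : is_derive r 1 (fun s => G s - G (- s)) (g r + g (- r)).
  have d1 := dG r ltac:(lra).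
  have d2 : is_derive (- r) 1 G (g (- r)) by apply: dG; lra.
  have d3 := @is_derive1_comp R G -%R r (g (- r)) (-1) d2 _.
  by apply: is_derive_eq; rewrite mulrN1 opprK.
apply: (near_eq_is_derive _ dd).
by near do apply/esym.
Unshelve. all: by end_near. Qed.

(** Compactness of the interval makes the continuity of [psi] in [t] uniform in [y]. The parameter
    ranges over any topological space, so that pairs can serve as parameters. *)
Lemma continuous_int1_param {T : topologicalType} a b (psi : T * R -> R) :
  a <= b -> continuous psi -> continuous (fun t => int1 a b (fun y => psi (t, y))).
Proof.
move=> ab cpsi t0.
have cs t : continuous (fun y => psi (t, y)).
  by move=> y; exact: (continuous_comp (continuous_pairl t y) (cpsi (t, y))).
apply/cvgrPdist_le => /= e e0.
(* The added 1 keeps the denominator positive when [a = b]. *)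
have e1 : 0 < e / (b - a + 1) by rewrite divr_gt0//; lra.
have : \forall t \near t0, `[a, b] `<=` [set y | `|psi (t0, y) - psi (t, y)| <= e / (b - a + 1)].
  have /compact_near_coveringP cpt := @segment_compact R a b.
  apply: (cpt T (nbhs t0) (fun t y => `|psi (t0, y) - psi (t, y)| <= e / (b - a + 1)) _) => y _. have e2 : 0 < e / (b - a + 1) / 2 by rewrite divr_gt0.
  have H := cpsi (t0, y); move/cvgrPdist_le : H => /(_ _ e2) H.
  have H2 : \forall y' \near y, `|psi (t0, y) - psi (t0, y')| <= e / (b - a + 1) / 2.
    by have := cs t0 y => /cvgrPdist_le /(_ _ e2).
  have [[U V] /= [Ut0 Vy] UV] := H.
  exists (V `&` [set y' | `|psi (t0, y) - psi (t0, y')| <= e / (b - a + 1) / 2], U).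
    by split => //=; exact: filterI.
  move=> [y' t'] /= [[Vy' hy'] Ut'].
  have /= := UV (t', y') (conj Ut' Vy') => h.
  have -> : psi (t0, y') - psi (t', y') = (psi (t0, y) - psi (t', y')) - (psi (t0, y) - psi (t0, y')).
    by ring.
  by rewrite (le_trans (ler_normB _ _))// [leRHS]splitr lerD.
apply: filterS => t ht; rewrite -int1B//.
have le1 : `|int1 a b (fun x => psi (t0, x) - psi (t, x))| <= int1 a b (fun x => `|psi (t0, x) - psi (t, x)|).
  apply: le_normr_Rintegral => //; apply: integrable_itvcc; apply: continuous_itvcc.
  by move=> x; apply: cvgB; exact: cs.
apply: (le_trans le1).
apply: (@le_trans _ _ (int1 a b (fun=> e / (b - a + 1)))).
  apply: int1_le.
  - by move=> x; apply: cvg_norm; apply: cvgB; exact: cs.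
  - by move=> x; exact: cvg_cst.
  - by move=> x xab; apply: ht; rewrite /= in_itv.
by rewrite int1_cst// mulrAC ler_pdivrMr; [nra|lra].
Qed.

End Integral1.

(** * Rectangles: product measure and iterated integrals *)

Section Plane.
Context {R : realType}.
Implicit Types (F G : R * R -> R) (p q r x y : R).
Notation mu := (@lebesgue_measure R).

(** The product sigma-algebra is generated by measurable rectangles, so an open set has to be
    exhibited as a countable union of them: the boxes with rational centre and half-side that it
    contains. *)
Lemma open_measurable_plane (A : set (R * R)) : open A ->
  measurable (A : set (measurableTypeR R * measurableTypeR R)).
Proof.
move=> oA.
pose box (q : rat * rat * rat) : set (R * R) :=
  `](ratr q.1.1 - ratr q.2), (ratr q.1.1 + ratr q.2)[ `*` `](ratr q.1.2 - ratr q.2), (ratr q.1.2 + ratr q.2)[.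
have -> : A = \bigcup_(q in [set q | box q `<=` A]) box q.
  apply/seteqP; split=> [[x y] Axy|z [q /= qA]]; last exact: qA.
  have [[U V] /= [/nbhs_ballP[e1 /= e10 U1] /nbhs_ballP[e2 /= e20 V2]] UVA] := oA _ Axy.
  pose e := Num.min e1 e2.
  have e0 : 0 < e by rewrite lt_min e10.
  have [r /itvP rI] := rat_in_itvoo (ltac:(lra) : 0 < e / 4).
  have r0 : 0 < ratr r :> R by rewrite rI.
  have r1 : ratr r < e / 4 by rewrite rI.
  have [a /itvP aI] := rat_in_itvoo (ltac:(lra) : x - ratr r < x + ratr r).
  have [b /itvP bI] := rat_in_itvoo (ltac:(lra) : y - ratr r < y + ratr r).
  have a1 : x - ratr r < ratr a by rewrite aI.
  have a2 : ratr a < x + ratr r by rewrite aI.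
  have b1 : y - ratr r < ratr b by rewrite bI.
  have b2 : ratr b < y + ratr r by rewrite bI.
  have ee1 : e <= e1 by rewrite ge_min lexx.
  have ee2 : e <= e2 by rewrite ge_min lexx orbT.
  exists (a, b, r); last by split; rewrite /= in_itv/=; apply/andP; split; lra.
  move=> [x' y'] [/=]; rewrite !in_itv/= => /andP[h1 h2] /andP[h3 h4].
  by apply: UVA; split; [apply: U1|apply: V2]; rewrite /ball/= ltr_norml; apply/andP; split; lra.
rewrite bigcup_mkcond; apply: countable_bigcupT_measurable => [|q]; first exact: countableP.
case: ifPn => // _; apply: measurableX; exact: measurable_itv.
Qed.

Lemma continuous_measurable_plane F : continuous F ->
  measurable_fun [set: measurableTypeR R * measurableTypeR R] F.
Proof.
move=> /continuousP cF; apply: (measurability _ (RGenOpens.measurableE R)).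
move=> _ [_ [a [b ->] <-]]; rewrite setTI; apply: open_measurable_plane.
exact/cF/interval_open.
Qed.

Lemma continuous_slice1 F x : continuous F -> continuous (fun y => F (x, y)).
Proof.
by move=> cF y; exact: (continuous_comp (continuous_pairl x y) (cF (x, y))).
Qed.

Lemma continuous_slice2 F y : continuous F -> continuous (fun x => F (x, y)).
Proof.
by move=> cF x; exact: (continuous_comp (continuous_pairr y x) (cF (x, y))).
Qed.

(** An iterated integral, so that continuity, differentiation and the fundamental theorem act in one
    variable at a time; [tonelli_box] links it to the product measure. *)
Definition int2 p q F : R := int1 (- p) p (fun x => int1 (- q) q (fun y => F (x, y))).

Definition box p q : set (R * R) := `[- p, p] `*` `[- q, q].

Lemma measurable_box p q :
  measurable (box p q : set (measurableTypeR R * measurableTypeR R)).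
Proof. by apply: measurableX; exact: measurable_itv. Qed.

Lemma continuous_int1_slice1 q F : 0 <= q -> continuous F ->
  continuous (fun x => int1 (- q) q (fun y => F (x, y))).
Proof. by move=> q0; apply: (@continuous_int1_param R R); lra. Qed.

Lemma continuous_int1_slice2 q F : 0 <= q -> continuous F ->
  continuous (fun y => int1 (- q) q (fun x => F (x, y))).
Proof.
move=> q0 cF; apply: (@continuous_int1_param R R _ _ (fun z => F (z.2, z.1))); first lra.
move=> z; apply: (@continuous_comp _ _ _ (fun z => (z.2, z.1)) F); last exact: cF.
apply: continuous_pair => w; [exact: cvg_snd|exact: cvg_fst].
Qed.

Lemma tonelli_box p q F : continuous F -> 0 <= p -> 0 <= q -> (forall z, 0 <= F z) ->
  (\int[mu \x mu]_(z in box p q) (F z)%:E = (int2 p q F)%:E)%E /\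
  int2 p q F = int1 (- q) q (fun y => int1 (- p) p (fun x => F (x, y))).
Proof.
move=> cF p0 q0 F0.
have mQ := measurable_box p q.
pose f : R * R -> \bar R := (EFin \o F) \_ (box p q).
have mf : measurable_fun [set: measurableTypeR R * measurableTypeR R] f.
  apply/(measurable_restrictT _ mQ)/measurable_funTS/measurable_EFinP.
  exact: continuous_measurable_plane.
have f0 z : (0 <= f z)%E by rewrite /f patchE; case: ifPn => // _; rewrite lee_fin.
have fE x y : f (x, y) = if (x \in `[(- p), p]) && (y \in `[(- q), q]) then (F (x, y))%:E else 0%E.
  rewrite /f patchE; congr (if _ then _ else _).
  by apply/idP/idP => [/set_mem[/= -> ->]//|/andP[? ?]]; exact/mem_set.
have E1 : (\int[mu]_x \int[mu]_y f (x, y) = (int2 p q F)%:E)%E.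
  rewrite /int2 -EFin_int1; last exact/continuous_itvcc/continuous_int1_slice1.
  rewrite [RHS]integral_mkcond; apply: eq_integral => x _; rewrite patchE mem_setE.
  case: ifPn => xp; last first.
    by apply: integral0_eq => y _; rewrite fE (negbTE xp).
  rewrite -EFin_int1; last exact/continuous_itvcc/continuous_slice1.
  rewrite [RHS]integral_mkcond; apply: eq_integral => y _.
  by rewrite fE xp patchE mem_setE.
have E2 : (\int[mu]_y \int[mu]_x f (x, y) =
    (int1 (- q) q (fun y => int1 (- p) p (fun x => F (x, y))))%:E)%E.
  rewrite -EFin_int1; last exact/continuous_itvcc/continuous_int1_slice2.
  rewrite [RHS]integral_mkcond; apply: eq_integral => y _; rewrite patchE mem_setE.
  case: ifPn => yp; last first.
    by apply: integral0_eq => x _; rewrite fE (negbTE yp) andbF.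
  rewrite -EFin_int1; last exact/continuous_itvcc/continuous_slice2.
  rewrite [RHS]integral_mkcond; apply: eq_integral => x _.
  by rewrite fE yp andbT patchE mem_setE.
split; first by rewrite integral_mkcond fubini_tonelli1.
apply: EFin_inj; rewrite -E1 -E2; exact: fubini_tonelli.
Qed.

Lemma box_bounded p q F : continuous F ->
  exists M, forall x y, - p <= x <= p -> - q <= y <= q -> `|F (x, y)| <= M.
Proof.
move=> cF.
have cb : compact (box p q) by apply: compact_setX; exact: segment_compact.
have /compact_bounded[M [_ Mb]] : compact (F @` box p q).
  by apply: continuous_compact => //; exact: continuous_subspaceT.
exists (M + 1) => x y xp yq; apply: (Mb (M + 1)); first by rewrite ltrDl.
by exists (x, y) => //; split; rewrite /= in_itv.
Qed.

Lemma int2D p q F G : 0 <= q -> continuous F -> continuous G ->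
  int2 p q (fun z => F z + G z) = int2 p q F + int2 p q G.
Proof.
move=> q0 cF cG; rewrite /int2 -int1D; [|exact: continuous_int1_slice1..].
apply: eq_int1 => x _; rewrite -int1D//; exact: continuous_slice1.
Qed.

Lemma int2Zl p q k F : 0 <= q -> continuous F ->
  int2 p q (fun z => k * F z) = k * int2 p q F.
Proof.
move=> q0 cF; rewrite /int2 -int1Zl; last exact: continuous_int1_slice1.
apply: eq_int1 => x _; rewrite -int1Zl//; exact: continuous_slice1.
Qed.

Lemma int2_cst p q k : 0 <= p -> 0 <= q -> int2 p q (fun=> k) = k * (4 * p * q).
Proof.
move=> p0 q0; rewrite /int2 (@eq_int1 _ _ _ _ (fun=> k * (q + q))); last first.
  by move=> x _; rewrite int1_cst ?opprK//; lra.
by rewrite int1_cst; [ring|lra].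
Qed.

Lemma int2_le p q F G : 0 <= q -> continuous F -> continuous G ->
  (forall x y, - p <= x <= p -> - q <= y <= q -> F (x, y) <= G (x, y)) ->
  int2 p q F <= int2 p q G.
Proof.
move=> q0 cF cG FG; apply: int1_le; [exact: continuous_int1_slice1..|].
move=> x xp; apply: int1_le; [exact: continuous_slice1..|].
by move=> y yq; exact: FG.
Qed.

(** The sign condition of Tonelli is removed by adding a bound of [F] on the box; the constant
    contributes equally to both orders. *)
Lemma int2_swap p q F : continuous F -> 0 <= p -> 0 <= q ->
  int2 p q F = int1 (- q) q (fun y => int1 (- p) p (fun x => F (x, y))).
Proof.
move=> cF p0 q0; have [M FM] := box_bounded p q F cF.
(* The absolute value makes [G] nonnegative on the whole plane and leaves [F z + M] unchanged on the
   box. *)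
pose G z := `|F z + M|.
have cG : continuous G by move=> z; apply: cvg_norm; apply: cvgD; [exact: cF|exact: cvg_cst].
have GE x y : - p <= x <= p -> - q <= y <= q -> G (x, y) = F (x, y) + M.
  by move=> xp yq; have := FM _ _ xp yq; rewrite ler_norml /G => ?; rewrite ger0_norm//; lra.
have [_] := tonelli_box p q G cG p0 q0 (fun z => normr_ge0 _).
have cM (b : R) : continuous (fun _ : R => b) by move=> ?; exact: cvg_cst.
have pp : - p <= p by rewrite (le_trans _ p0)// oppr_le0.
have qq : - q <= q by rewrite (le_trans _ q0)// oppr_le0.
rewrite /int2 (@eq_int1 _ _ _ _ (fun x => int1 (- q) q (fun y => F (x, y)) + M * (q + q))); last first.
  move=> x xp; rewrite (@eq_int1 _ _ _ _ (fun y => F (x, y) + M)); last by move=> y; exact: GE.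
  rewrite (int1D _ _ _ _ (continuous_slice1 _ x cF) (cM M)).
  by rewrite (int1_cst _ _ _ qq) opprK.
rewrite (int1D _ _ _ _ (continuous_int1_slice1 _ _ q0 cF) (cM _)).
rewrite [X in _ = X -> _](@eq_int1 _ _ _ _ (fun y => int1 (- p) p (fun x => F (x, y)) + M * (p + p))); last first.
  move=> y yq; rewrite (@eq_int1 _ _ _ _ (fun x => F (x, y) + M)); last by move=> x xp; exact: GE.
  rewrite (int1D _ _ _ _ (continuous_slice2 _ y cF) (cM M)).
  by rewrite (int1_cst _ _ _ pp) opprK.
rewrite (int1D _ _ _ _ (continuous_int1_slice2 _ _ p0 cF) (cM _)).
by rewrite (int1_cst _ _ _ pp) (int1_cst _ _ _ qq) !opprK [_ * _ * (p + p)]mulrAC => /addIr.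
Qed.

End Plane.

(** * Partial derivatives and integrals over growing squares *)

Section Calculus.
Context {R : realType}.
Implicit Types (F G : R * R -> R) (p q r x y : R) (f g : R -> R).

Lemma is_derive_continuous f df : (forall x, is_derive x 1 f (df x)) -> continuous f.
Proof.
move=> d x; apply: differentiable_continuous; have dx := d x.
exact/derivable1_diffP.
Qed.

Lemma MVT_global f df a b : a < b -> (forall x, is_derive x 1 f (df x)) ->
  exists2 c, a < c < b & f b - f a = df c * (b - a).
Proof.
move=> ab d; have [|c] := @MVT R f df a b ab (fun x _ => d x).
  exact/continuous_subspaceT/(is_derive_continuous _ _ d).
by rewrite in_itv /= => ? ?; exists c.
Qed.

(** A relation between a function and a named derivative, along one-variable slices: one-variable
    rules apply directly, and derivatives can be given by explicit formulas. *)
Definition pd1 F G := forall x y, is_derive x 1 (fun s => F (s, y)) (G (x, y)).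
Definition pd2 F G := forall x y, is_derive y 1 (fun s => F (x, s)) (G (x, y)).

Lemma int2_pd1 p q F G : 0 <= p -> 0 <= q -> continuous G -> pd1 F G ->
  int2 p q G = int1 (- q) q (fun y => F (p, y) - F (- p, y)).
Proof.
move=> p0 q0 cG dF; rewrite int2_swap//; apply: eq_int1 => y _.
apply: (@int1_FTC _ _ _ _ (fun s => F (s, y))); first lra.
  exact/continuous_itvcc/continuous_slice2.
by move=> x _; exact: dF.
Qed.

Lemma int2_pd2 p q F G : 0 <= p -> 0 <= q -> continuous G -> pd2 F G ->
  int2 p q G = int1 (- p) p (fun x => F (x, q) - F (x, - q)).
Proof.
move=> p0 q0 cG dF; apply: eq_int1 => x _.
apply: (@int1_FTC _ _ _ _ (fun s => F (x, s))); first lra.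
  exact/continuous_itvcc/continuous_slice1.
by move=> y _; exact: dF.
Qed.

(** Schwarz's theorem: by two mean value steps in either order, the second difference over a small
    square is [h * h] times a value of [F12] and also [h * h] times a value of [F21], both taken
    near the corner. *)
Lemma pd_swap F F1 F2 F12 F21 : pd1 F F1 -> pd2 F F2 -> pd2 F1 F12 -> pd1 F2 F21 ->
  continuous F12 -> continuous F21 -> F12 = F21.
Proof.
move=> d1 d2 d12 d21 c12 c21; apply/funext => -[x0 y0].
apply: contrapT => /eqP ne; pose e := `|F12 (x0, y0) - F21 (x0, y0)| / 2.
have e0 : 0 < e by rewrite divr_gt0// normr_gt0 subr_eq0.
have near_eq (H : R * R -> R) : continuous H -> exists2 h, 0 < h &
    forall x y, x0 < x < x0 + h -> y0 < y < y0 + h -> `|H (x0, y0) - H (x, y)| < e.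
  move=> cH; have /cvgrPdist_lt /(_ _ e0) := cH (x0, y0).
  move=> [[U V] /= [/nbhs_ballP[a /= a0 aU] /nbhs_ballP[b /= b0 bV]] UV].
  exists (Num.min a b); first by rewrite lt_min a0.
  have ha : Num.min a b <= a by rewrite ge_min lexx.
  have hb : Num.min a b <= b by rewrite ge_min lexx orbT.
  move=> x y xh yh; apply: (UV (x, y)); split.
    by apply: aU; rewrite /ball/= ltr_norml; lra.
  by apply: bV; rewrite /ball/= ltr_norml; lra.
have [h1 h10 H1] := near_eq _ c12; have [h2 h20 H2] := near_eq _ c21.
pose h := Num.min h1 h2.
have h0 : 0 < h by rewrite lt_min h10.
have hh1 : h <= h1 by rewrite ge_min lexx.
have hh2 : h <= h2 by rewrite ge_min lexx orbT.
have [xi xih E1] : exists2 xi, x0 < xi < x0 + h &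
    (F (x0 + h, y0 + h) - F (x0 + h, y0)) - (F (x0, y0 + h) - F (x0, y0)) =
    (F1 (xi, y0 + h) - F1 (xi, y0)) * (x0 + h - x0).
  apply: (@MVT_global (fun x => F (x, y0 + h) - F (x, y0)) (fun x => F1 (x, y0 + h) - F1 (x, y0))).
    by rewrite ltrDl.
  by move=> x; have := d1 x (y0 + h); have := d1 x y0 => *; exact: is_deriveB.
have [et eth E2] : exists2 et, y0 < et < y0 + h &
    (F1 (xi, y0 + h) - F1 (xi, y0)) = F12 (xi, et) * (y0 + h - y0).
  by apply: (@MVT_global (fun y => F1 (xi, y)) (fun y => F12 (xi, y))); rewrite ?ltrDl.
have [ze zeh E3] : exists2 ze, y0 < ze < y0 + h &
    (F (x0 + h, y0 + h) - F (x0, y0 + h)) - (F (x0 + h, y0) - F (x0, y0)) =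
    (F2 (x0 + h, ze) - F2 (x0, ze)) * (y0 + h - y0).
  apply: (@MVT_global (fun y => F (x0 + h, y) - F (x0, y)) (fun y => F2 (x0 + h, y) - F2 (x0, y))).
    by rewrite ltrDl.
  by move=> y; have := d2 (x0 + h) y; have := d2 x0 y => *; exact: is_deriveB.
have [th thh E4] : exists2 th, x0 < th < x0 + h &
    (F2 (x0 + h, ze) - F2 (x0, ze)) = F21 (th, ze) * (x0 + h - x0).
  by apply: (@MVT_global (fun x => F2 (x, ze)) (fun x => F21 (x, ze))); rewrite ?ltrDl.
have E : F12 (xi, et) = F21 (th, ze).
  have hh : h * h != 0 by rewrite mulf_neq0// gt_eqF.
  apply: (mulIf hh); rewrite E2 in E1; rewrite E4 in E3; nra.
have A1 := H1 xi et ltac:(lra) ltac:(lra).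
have A2 := H2 th ze ltac:(lra) ltac:(lra).
have : `|F12 (x0, y0) - F21 (x0, y0)| < e + e.
  rewrite (_ : F12 (x0, y0) - F21 (x0, y0) =
    (F12 (x0, y0) - F12 (xi, et)) - (F21 (x0, y0) - F21 (th, ze))); last by rewrite E; ring.
  by rewrite (le_lt_trans (ler_normB _ _))// ltrD.
by rewrite -splitr ltxx.
Qed.

(** Moves the dependence on [q] from the endpoints into the integrand, where continuity in a
    parameter is available. *)
Lemma int1_scale q g : 0 <= q -> continuous g ->
  int1 (- q) q g = int1 (- 1) 1 (fun t => q * g (q * t)).
Proof.
move=> q0 cg; pose G x := int1 (- (q + 1)) x g.
have dG x : - (q + 1) < x -> is_derive x 1 G (g x) by move=> ?; exact: is_derive_int1.
have -> : int1 (- q) q g = G q - G (- q).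
  by apply: int1_FTC; [lra|exact: continuous_itvcc|move=> x ?; apply: dG; lra].
have -> : G q - G (- q) = G (q * 1) - G (q * (- 1)) by rewrite mulr1 mulrN1.
apply/esym/(@int1_FTC _ _ _ _ (fun t => G (q * t))); first lra.
  apply: continuous_itvcc => t; apply: cvgM; first exact: cvg_cst.
  by apply: continuous_comp; [exact: mulrl_continuous|exact: cg].
move=> t t1; have dGt : is_derive (q * t) 1 G (g (q * t)) by apply: dG; nra.
have dq : is_derive t (1 : R) (fun t : R => q * t) q.
  by apply: is_derive_eq; rewrite /GRing.scale/= mulr1.
by apply: is_derive_eq (is_derive1_comp dGt dq) _; rewrite mulrC.
Qed.

(** Integral over the boundary of the square of half-side [r], all four sides sharing one
    parameter. *)
Definition bd r F := int1 (- r) r (fun s => (F (r, s) + F (- r, s)) + (F (s, r) + F (s, - r))).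

(** The increment from [(r, r)] to [(s, s)] splits at [(r, s)]: the move in the first variable is
    handled by the mean value theorem and continuity of [kp] at [(r, r)], the move in the second by
    the derivative at the single point [r]. *)
Lemma is_derive_diag (K kp kq : R * R -> R) r : 0 < r ->
  (forall x y, 0 < x -> 0 < y -> is_derive x 1 (fun s => K (s, y)) (kp (x, y))) ->
  is_derive r 1 (fun s => K (r, s)) (kq (r, r)) ->
  {for (r, r), continuous kp} ->
  is_derive r 1 (fun s => K (s, s)) (kp (r, r) + kq (r, r)).
Proof.
move=> r0 dp dq /cvgrPdist_le ck.
have H : (fun h : R => h^-1 *: (K (h *: 1 + r, h *: 1 + r) - K (r, r))) @ 0^' -->
    kp (r, r) + kq (r, r).
  have dq' : (fun h : R => h^-1 *: (K (r, h *: 1 + r) - K (r, r))) @ 0^' --> kq (r, r).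
    by have [dv <-] := dq; exact: dv.
  have dp' : (fun h : R => h^-1 *: (K (h *: 1 + r, h *: 1 + r) - K (r, h *: 1 + r))) @ 0^' --> kp (r, r).
    apply/cvgrPdist_le => e e0.
    have [[U V] /= [/nbhs_ballP[a /= a0 aU] /nbhs_ballP[b /= b0 bV]] UV] := ck e e0.
    near=> h.
    have h0 : h != 0 by near: h; exact: nbhs_dnbhs_neq.
    have hr : `|h| < r by near: h; apply: dnbhs0_lt.
    have ha : `|h| < a by near: h; apply: dnbhs0_lt.
    have hb : `|h| < b by near: h; apply: dnbhs0_lt.
    rewrite /GRing.scale/= mulr1.
    have bk xi : `|xi - r| <= `|h| -> `|kp (r, r) - kp (xi, h + r)| <= e.
      move=> xih; apply: (UV (xi, h + r)); split.
        by apply: aU; rewrite /ball/= distrC (le_lt_trans xih).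
      by apply: bV; rewrite /ball/= opprD addrA addrAC subrr add0r normrN.
    have hr' : 0 < h + r by move: hr; rewrite ltr_norml; lra.
    have mvt s t : 0 < s -> s < t -> exists2 c, s < c < t &
        K (t, h + r) - K (s, h + r) = kp (c, h + r) * (t - s).
      move=> s0 st; have [||c] := @MVT R (fun x => K (x, h + r)) (fun x => kp (x, h + r)) s t st.
      - by move=> x; rewrite in_itv/= => /andP[sx _]; apply: dp => //; exact: lt_trans sx.
      - apply: continuous_in_subspaceT => x; rewrite inE/= in_itv/= => /andP[sx _].
        apply: differentiable_continuous; have := dp x (h + r) (lt_le_trans s0 sx) hr'.
        by move=> ?; exact/derivable1_diffP.
      - by rewrite in_itv/= => ? ->; exists c.
    have [hpos|hneg] := ltrP 0 h.
      have [|c ch ->] := mvt r (h + r) r0; first lra.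
      rewrite addrK mulrC -mulrA divff// mulr1; apply: bk.
      by rewrite (gtr0_norm hpos) ler_norml; lra.
    have hn : h < 0 by rewrite lt_neqAle h0.
    have [|c ch E] := mvt (h + r) r hr'; first lra.
    have -> : K (h + r, h + r) - K (r, h + r) = kp (c, h + r) * h by rewrite -opprB E; ring.
    rewrite mulrC -mulrA divff// mulr1.
    by apply: bk; rewrite (ltr0_norm hn) ler_norml; lra.
  apply: (cvg_trans _ (cvgD dp' dq')); apply: near_eq_cvg; near=> h.
  by rewrite fctE /GRing.scale /=; ring.
by apply: DeriveDef; [exact: cvgP H|exact: cvg_lim H].
Unshelve. all: by end_near. Qed.

Lemma is_derive_int2_diag r F : 0 < r -> continuous F ->
  is_derive r 1 (fun r => int2 r r F) (bd r F).
Proof.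
move=> r0 cF.
(* Rescaled to [[-1, 1]], so that continuity in the length of the side involves no varying domain of
   integration. *)
pose kp (z : R * R) := int1 (- 1) 1 (fun t => z.2 * (F (z.1, z.2 * t) + F (- z.1, z.2 * t))).
pose kq (z : R * R) := int1 (- z.1) z.1 (fun s => F (s, z.2) + F (s, - z.2)).
have cs x : continuous (fun y => F (x, y) + F (- x, y)).
  by move=> y; apply: cvgD; exact: continuous_slice1.
have kpE x y : 0 <= y -> kp (x, y) = int1 (- y) y (fun t => F (x, t) + F (- x, t)).
  by move=> y0; rewrite int1_scale.
have -> : bd r F = kp (r, r) + kq (r, r).
  rewrite kpE ?ltW// /bd /kq/= int1D//.
  by move=> s; apply: cvgD; exact: continuous_slice2.
apply: (@is_derive_diag (fun z => int2 z.1 z.2 F) kp kq) => //.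
- move=> x y x0 y0 /=.
  rewrite kpE ?ltW// int1D; [|exact: continuous_slice1..].
  exact: (is_derive_int1_sym _ _ x0 (continuous_int1_slice1 _ _ (ltW y0) cF)).
- rewrite /kq /= int1D; [|exact: continuous_slice2..].
  apply: near_eq_is_derive (is_derive_int1_sym _ _ r0 (continuous_int1_slice2 _ _ (ltW r0) cF)).
  near=> s; rewrite int2_swap// ?ltW//.
  by near: s; exact: lt_nbhsr.
- apply: (@continuous_int1_param R (R * R)%type _ _
    (fun w => w.1.2 * (F (w.1.1, w.1.2 * w.2) + F (- w.1.1, w.1.2 * w.2)))); first lra.
  have c1 : continuous (fun w : (R * R) * R => w.1.1).
    by move=> w; apply: (continuous_comp (@cvg_fst _ _ _ _ _)); exact: cvg_fst.
  have c2 : continuous (fun w : (R * R) * R => w.1.2).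
    by move=> w; apply: (continuous_comp (@cvg_fst _ _ _ _ _)); exact: cvg_snd.
  have c3 : continuous (fun w : (R * R) * R => w.1.2 * w.2).
    by move=> w; apply: cvgM; [exact: c2|exact: cvg_snd].
  move=> w; apply: cvgM; first exact: c2.
  apply: cvgD.
    exact: (continuous_comp (continuous_pair _ _ c1 c3 w) (cF _)).
  have c4 : continuous (fun w : (R * R) * R => - w.1.1) by move=> z; apply: cvgN; exact: c1.
  exact: (continuous_comp (continuous_pair _ _ c4 c3 w) (cF _)).
Unshelve. all: by end_near. Qed.

End Calculus.

(** * From the complex equation to a real system *)

Section RealParts.
Context {R : realType}.
Implicit Types (u : R * R -> Rcomplex R) (g : R * R -> R).

Lemma smooth_continuous g : smooth g -> continuous g.
Proof. by move=> /(_ 0%N)[]. Qed.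

Lemma smooth_D1 g : smooth g -> smooth ('D_(@e1 R) g).
Proof. by move=> sg k; have [_ []] := sg k.+1. Qed.

Lemma smooth_D2 g : smooth g -> smooth ('D_(@e2 R) g).
Proof. by move=> sg k; have [_ []] := sg k.+1. Qed.

Lemma smooth_pd1 g : smooth g -> pd1 g ('D_(@e1 R) g).
Proof.
move=> sg x y; have [_ [d _ _ _]] := sg 1%N.
have E : (fun h : R => h^-1 *: ((fun s => g (s, y)) (h *: 1 + x) - g (x, y))) =
    (fun h : R => h^-1 *: (g (h *: @e1 R + (x, y)) - g (x, y))).
  apply/funext => h; congr (_ *: (g _ - _)).
  by have -> : h *: @e1 R + (x, y) = (h * 1 + x, h * 0 + y) by []; rewrite mulr0 add0r.
have c : (fun h : R => h^-1 *: ((fun s => g (s, y)) (h *: 1 + x) - g (x, y))) @ 0^' -->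
    'D_(@e1 R) g (x, y) by rewrite E; exact: d.
by apply: DeriveDef; [exact: cvgP c|exact: cvg_lim c].
Qed.

Lemma smooth_pd2 g : smooth g -> pd2 g ('D_(@e2 R) g).
Proof.
move=> sg x y; have [_ [_ d _ _]] := sg 1%N.
have E : (fun h : R => h^-1 *: ((fun s => g (x, s)) (h *: 1 + y) - g (x, y))) =
    (fun h : R => h^-1 *: (g (h *: @e2 R + (x, y)) - g (x, y))).
  apply/funext => h; congr (_ *: (g _ - _)).
  by have -> : h *: @e2 R + (x, y) = (h * 0 + x, h * 1 + y) by []; rewrite mulr0 add0r.
have c : (fun h : R => h^-1 *: ((fun s => g (x, s)) (h *: 1 + y) - g (x, y))) @ 0^' -->
    'D_(@e2 R) g (x, y) by rewrite E; exact: d.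
by apply: DeriveDef; [exact: cvgP c|exact: cvg_lim c].
Qed.

Definition cRe (z : Rcomplex R) : R := complex.Re z.
Definition cIm (z : Rcomplex R) : R := complex.Im z.

Lemma sqr_norm_Rcomplex (z : Rcomplex R) : `|z| ^+ 2 = cRe z ^+ 2 + cIm z ^+ 2.
Proof.
by case: z => x y; rewrite /Num.norm/= /Normc.normc /= sqr_sqrtr// addr_ge0// sqr_ge0.
Qed.

Lemma cRe_le_norm (z : Rcomplex R) : `|cRe z| <= `|z|.
Proof.
rewrite -(@ler_pXn2r _ 2)// ?nnegrE// sqr_norm_Rcomplex real_normK ?num_real//.
by rewrite lerDl sqr_ge0.
Qed.

Lemma cIm_le_norm (z : Rcomplex R) : `|cIm z| <= `|z|.
Proof.
rewrite -(@ler_pXn2r _ 2)// ?nnegrE// sqr_norm_Rcomplex real_normK ?num_real//.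
by rewrite lerDr sqr_ge0.
Qed.

Section linear_part.
Variable P : Rcomplex R -> R.
Hypothesis PB : forall z w, P (z - w) = P z - P w.
Hypothesis PZ : forall (k : R) z, P (k *: z) = k * P z.
Hypothesis P_le : forall z, `|P z| <= `|z|.

Lemma continuous_part : continuous P.
Proof.
move=> z U /nbhs_ballP[e /= e0 eU]; apply/nbhs_ballP; exists e => //= w zw.
by apply: eU; rewrite /ball/= -PB (le_lt_trans (P_le _)).
Qed.

(** A real-linear map that does not increase the modulus is continuous, hence passes through the
    limit of difference quotients. [P] stands for both the real and the imaginary part. *)
Lemma derive_part u x v : derivable u x v ->
  derivable (P \o u) x v /\ 'D_v (P \o u) x = P ('D_v u x).
Proof.
move=> d.
have c : (fun h : R => h^-1 *: ((P \o u) (h *: v + x) - (P \o u) x)) @ 0^' --> P ('D_v u x).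
  rewrite (_ : (fun h : R => _) = P \o (fun h : R => h^-1 *: (u (h *: v + x) - u x))); last first.
    by apply/funext => h /=; rewrite PZ PB.
  have d' : (fun h : R => h^-1 *: (u (h *: v + x) - u x)) @ 0^' --> 'D_v u x by exact: d.
  exact: (cvg_comp _ _ d' (continuous_part _)).
by split; [exact: cvgP c|exact: cvg_lim c].
Qed.

Lemma class_C_part k u : class_C k u -> class_C k (P \o u).
Proof.
elim: k u => [|k IH] u /= [cu H].
  by split=> // x; apply: continuous_comp; [exact: cu|exact: continuous_part].
have [d1 d2 s1 s2] := H; split.
  by move=> x; apply: continuous_comp; [exact: cu|exact: continuous_part].
split.
- by move=> x; exact: (derive_part _ _ _ (d1 x)).1.
- by move=> x; exact: (derive_part _ _ _ (d2 x)).1.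
- rewrite (_ : 'D_ _ (P \o u) = P \o 'D_(@e1 R) u); first exact: IH.
  by apply/funext => x; exact: (derive_part _ _ _ (d1 x)).2.
- rewrite (_ : 'D_ _ (P \o u) = P \o 'D_(@e2 R) u); first exact: IH.
  by apply/funext => x; exact: (derive_part _ _ _ (d2 x)).2.
Qed.

Lemma smooth_part u : smooth u -> smooth (P \o u).
Proof. by move=> su k; exact/class_C_part. Qed.

Lemma laplacian_part u x : smooth u -> laplacian (P \o u) x = P ('D_(@e1 R) ('D_(@e1 R) u) x) + P ('D_(@e2 R) ('D_(@e2 R) u) x).
Proof.
move=> su; have [_ [d1 d2 [_ [d11 _ _ _]] [_ [_ d22 _ _]]]] := su 2%N.
rewrite /laplacian.
rewrite (_ : 'D_(@e1 R) (P \o u) = P \o 'D_(@e1 R) u); last first.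
  by apply/funext => z; exact: (derive_part _ _ _ (d1 z)).2.
rewrite (_ : 'D_(@e2 R) (P \o u) = P \o 'D_(@e2 R) u); last first.
  by apply/funext => z; exact: (derive_part _ _ _ (d2 z)).2.
by rewrite (derive_part _ _ _ (d11 x)).2 (derive_part _ _ _ (d22 x)).2.
Qed.

End linear_part.

Lemma cReB z w : cRe (z - w) = cRe z - cRe w. Proof. by case: z => ? ?; case: w. Qed.
Lemma cImB z w : cIm (z - w) = cIm z - cIm w. Proof. by case: z => ? ?; case: w. Qed.
Lemma cReZ (k : R) z : cRe (k *: z) = k * cRe z. Proof. by case: z. Qed.
Lemma cImZ (k : R) z : cIm (k *: z) = k * cIm z. Proof. by case: z. Qed.

(** The factor 1 - |u|^2 is real, so the two parts satisfy the same scalar equation and are coupled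
    through this factor alone. *)
Lemma real_system u (a := cRe \o u) (b := cIm \o u) : smooth u ->
  (forall x, - laplacian u x = u x * (1 - `|u x| ^+ 2)%:C%C) ->
  [/\ smooth a, smooth b,
    forall x, laplacian a x = - a x * (1 - a x ^+ 2 - b x ^+ 2) &
    forall x, laplacian b x = - b x * (1 - a x ^+ 2 - b x ^+ 2)].
Proof.
move=> su eq; split.
- exact: (smooth_part _ cReB cReZ cRe_le_norm).
- exact: (smooth_part _ cImB cImZ cIm_le_norm).
- move=> x; rewrite (laplacian_part _ cReB cReZ cRe_le_norm)//.
  have := eq x; rewrite /laplacian sqr_norm_Rcomplex /a /b /=.
  case: ('D_ _ _ x) => p1 p2; case: ('D_ _ _ x) => q1 q2; case: (u x) => r s [] /=; lra.
- move=> x; rewrite (laplacian_part _ cImB cImZ cIm_le_norm)//.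
  have := eq x; rewrite /laplacian sqr_norm_Rcomplex /a /b /=.
  case: ('D_ _ _ x) => p1 p2; case: ('D_ _ _ x) => q1 q2; case: (u x) => r s [] /=; lra.
Qed.

End RealParts.

(** * Differentiation and continuity rules *)

Section DerivativeRules.
Context {R : realType}.
Implicit Types (f g : R -> R) (x : R).

Lemma der_eq f x d d' : is_derive x 1 f d -> d = d' -> is_derive x 1 f d'.
Proof. by move=> ? <-. Qed.

Lemma der_add f g x df dg : is_derive x 1 f df -> is_derive x 1 g dg ->
  is_derive x 1 (fun s => f s + g s) (df + dg).
Proof. by move=> ? ?; exact: is_deriveD. Qed.

Lemma der_opp f x df : is_derive x 1 f df -> is_derive x 1 (fun s => - f s) (- df).
Proof. by move=> ?; exact: is_deriveN. Qed.

Lemma der_mul f g x df dg : is_derive x 1 f df -> is_derive x 1 g dg ->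
  is_derive x 1 (fun s => f s * g s) (df * g x + f x * dg).
Proof. by move=> ? ?; apply: is_derive_eq; rewrite /GRing.scale/=; ring. Qed.

Lemma der_exp2 f x df : is_derive x 1 f df ->
  is_derive x 1 (fun s => f s ^+ 2) (2 * f x * df).
Proof. by move=> d; apply: der_eq (der_mul _ _ _ _ _ d d) _; ring. Qed.

Lemma der_cst (c x : R) : is_derive x 1 (fun=> c) 0.
Proof. exact: is_derive_cst. Qed.

Lemma der_id x : is_derive x 1 (fun s => s) 1.
Proof. exact: is_derive_id. Qed.

Lemma is_derive_unique f x d d' : is_derive x 1 f d -> is_derive x 1 f d' -> d = d'.
Proof. by move=> [_ <-] [_ <-]. Qed.

Context {T : topologicalType}.
Implicit Types (F G : T -> R).

Lemma cont_add F G : continuous F -> continuous G -> continuous (fun z => F z + G z).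
Proof. by move=> cF cG z; apply: cvgD; [exact: cF|exact: cG]. Qed.

Lemma cont_opp F : continuous F -> continuous (fun z => - F z).
Proof. by move=> cF z; apply: cvgN; exact: cF. Qed.

Lemma cont_mul F G : continuous F -> continuous G -> continuous (fun z => F z * G z).
Proof. by move=> cF cG z; apply: cvgM; [exact: cF|exact: cG]. Qed.

Lemma cont_exp2 F : continuous F -> continuous (fun z => F z ^+ 2).
Proof. by move=> cF; exact: cont_mul. Qed.

Lemma cont_cst (c : R) : continuous (fun _ : T => c).
Proof. by move=> z; exact: cvg_cst. Qed.

End DerivativeRules.

Lemma cont_fst {R : realType} : continuous (fun z : R * R => z.1).
Proof. by move=> z; exact: cvg_fst. Qed.
Lemma cont_snd {R : realType} : continuous (fun z : R * R => z.2).
Proof. by move=> z; exact: cvg_snd. Qed.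
Lemma cont_id {R : realType} : continuous (fun x : R => x).
Proof. by move=> x; exact: cvg_id. Qed.

Ltac der_step := lazymatch goal with
  | |- is_derive _ _ (fun s => s) _ => apply der_id
  | |- is_derive _ _ (fun _ => ?c) _ => apply der_cst
  | |- is_derive _ _ (fun s => ?F (s, ?y)) _ =>
    match goal with H : pd1 F _ |- _ => apply (H _ y) end
  | |- is_derive _ _ (fun s => ?F (?x, s)) _ =>
    match goal with H : pd2 F _ |- _ => apply (H x) end
  | |- is_derive _ _ (fun s => _ ^+ 2) _ => eapply der_exp2
  | |- is_derive _ _ (fun s => _ * _) _ => eapply der_mul
  | |- is_derive _ _ (fun s => _ + _) _ => eapply der_add
  | |- is_derive _ _ (fun s => - _) _ => eapply der_opp
  | |- is_derive _ _ ?g _ =>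
    match goal with
    | H : forall x, is_derive x _ g _ |- _ => apply H
    | H : is_derive _ _ g _ |- _ => exact H
    end
  end.
Ltac derive_rules := cbn [fst snd]; eapply der_eq; [repeat der_step | cbn [fst snd]].
Ltac cont_step := lazymatch goal with |- continuous ?f =>
  lazymatch f with
  | (fun z => z) => exact cont_id
  | (fun z => fst z) => exact cont_fst
  | @fst _ _ => exact cont_fst
  | @snd _ _ => exact cont_snd
  | (fun z => snd z) => exact cont_snd
  | (fun _ => ?c) => exact (cont_cst c)
  | (fun z => _ ^+ 2) => apply: cont_exp2
  | (fun z => _ * _) => apply: cont_mul
  | (fun z => _ + _) => apply: cont_add
  | (fun z => - _) => apply: cont_opp
  | (fun z => ?F z) => match goal with H : continuous F |- _ => exact H end
  | ?F => match goal with H : continuous F |- _ => exact H end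
  end end.
Ltac cont_rules := repeat cont_step.

(** * Partial derivatives up to third order *)

Section Jets.
Context {R : realType}.

(** One name serves each mixed derivative whatever the order of differentiation, so the symmetry is
    built in. Third derivatives enter when the equation is differentiated once, and in the second
    derivatives of the current. *)
Record jet3 (g g1 g2 g11 g12 g22 g111 g112 g122 g222 : R * R -> R) : Prop := Jet3 {
  jet_c : [/\ continuous g, continuous g1 & continuous g2];
  jet_c2 : [/\ continuous g11, continuous g12 & continuous g22];
  jet_c3 : [/\ continuous g111, continuous g112, continuous g122 & continuous g222];
  jet_d : pd1 g g1 /\ pd2 g g2;
  jet_d1 : pd1 g1 g11 /\ pd2 g1 g12;
  jet_d2 : pd1 g2 g12 /\ pd2 g2 g22;
  jet_d11 : pd1 g11 g111 /\ pd2 g11 g112;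
  jet_d12 : pd1 g12 g112 /\ pd2 g12 g122;
  jet_d22 : pd1 g22 g122 /\ pd2 g22 g222 }.

(* Abstracting over the operators keeps unification from unfolding the limits behind ['D_e1] and ['D_e2]. *)
Lemma jet3_of_class (sm : (R * R -> R) -> Prop) (D1 D2 : (R * R -> R) -> (R * R -> R)) :
  (forall g, sm g -> continuous g) ->
  (forall g, sm g -> sm (D1 g)) -> (forall g, sm g -> sm (D2 g)) ->
  (forall g, sm g -> pd1 g (D1 g)) -> (forall g, sm g -> pd2 g (D2 g)) ->
  forall g, sm g -> exists g1 g2 g12 g111 g112 g122 g222,
  jet3 g g1 g2 (D1 (D1 g)) g12 (D2 (D2 g)) g111 g112 g122 g222.
Proof.
move=> cs s1 s2 p1 p2.
have swap g : sm g -> D2 (D1 g) = D1 (D2 g).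
  move=> sg; apply: (@pd_swap R g (D1 g) (D2 g)); auto.
move=> g sg.
have e12 := swap _ sg; have e112 := swap _ (s1 _ sg); have e122 := swap _ (s2 _ sg).
exists (D1 g), (D2 g), (D2 (D1 g)), (D1 (D1 (D1 g))), (D2 (D1 (D1 g))),
  (D2 (D2 (D1 g))), (D2 (D2 (D2 g))).
split; try by split; auto.
- by split; [rewrite e12; auto|auto].
- by split; [rewrite e112; auto|auto].
- by split; [rewrite e12 e122; auto|auto].
Qed.

Lemma smooth_jet3 (g : R * R -> R) : smooth g -> exists g1 g2 g11 g12 g22 g111 g112 g122 g222,
  jet3 g g1 g2 g11 g12 g22 g111 g112 g122 g222 /\
  forall z, laplacian g z = g11 z + g22 z.
Proof.
move=> sg.
have [g1 [g2 [g12 [g111 [g112 [g122 [g222 j]]]]]]] := jet3_of_class _ _ _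
  (@smooth_continuous R) (@smooth_D1 R) (@smooth_D2 R) (@smooth_pd1 R) (@smooth_pd2 R) _ sg.
by exists g1, g2, ('D_(@e1 R) ('D_(@e1 R) g)), g12, ('D_(@e2 R) ('D_(@e2 R) g)), g111, g112, g122, g222.
Qed.

End Jets.

(** * Decay of the gradient *)

(** Otherwise [g1], which vanishes at [x], is positive just to the right of [x], and [g] rises above
    its maximum. *)
Lemma second_derivative_at_max {R : realType} (g g1 : R -> R) (d x e : R) : 0 < e ->
  (forall s : R, is_derive s (1 : R) g (g1 s)) -> is_derive x (1 : R) g1 d ->
  (forall s, `|s - x| < e -> g s <= g x) -> d <= 0.
Proof.
move=> e0 dg dg1 gmax.
have g1x : g1 x = 0.
  apply: (is_derive_unique g x _ _ (dg x)).
  apply: (@derive1_at_max _ g (x - e) (x + e)); first lra.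
  - by move=> t _; case: (dg t).
  - by rewrite in_itv/=; lra.
  - by move=> t; rewrite in_itv/= => ?; apply: gmax; rewrite ltr_norml; lra.
rewrite leNgt; apply/negP => d0.
have c : (fun h : R => h^-1 *: (g1 (h *: 1 + x) - g1 x)) @ 0^' --> d.
  by case: dg1 => dv <-; exact: dv.
have d2 : 0 < d / 2 by rewrite divr_gt0.
have /= [a a0 Ha] := (@cvgrPdist_lt _ _ _ _ _ _ _).1 c (d / 2) d2.
pose h := Num.min (a / 2) (e / 2).
have h0 : 0 < h by rewrite lt_min !divr_gt0.
have ha : h <= a / 2 by rewrite ge_min lexx.
have he : h <= e / 2 by rewrite ge_min lexx orbT.
have pos t : 0 < t -> t < a -> 0 < g1 (t + x).
  move=> t0 ta; have := Ha t; rewrite /= sub0r normrN (gtr0_norm t0) => /(_ ta (lt0r_neq0 t0)).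
  rewrite g1x subr0 /GRing.scale/= mulr1 ltr_norml => /andP[_ H].
  have : 0 < t^-1 * g1 (t + x) by lra.
  by rewrite pmulr_rgt0// invr_gt0.
have [|c' c'h E] := @MVT_global R g g1 x (x + h) _ dg; first lra.
have : g (x + h) <= g x by apply: gmax; rewrite addrAC subrr add0r (gtr0_norm h0); lra.
have := pos (c' - x); rewrite subrK => /(_ ltac:(lra) ltac:(lra)) P; nra.
Qed.

Lemma norm_le1_of_sqr {R : realType} (m : R) : m ^+ 2 <= 1 -> `|m| <= 1.
Proof. by rewrite -real_normK ?num_real// expr_le1. Qed.

(** Expanding gives T - 2 m d - d^2 with T = 1 - m^2 - Z <= 1, |m| <= 1 and |d| < T / 4, a loss of
    at most three quarters of T. This keeps an interior point of a disc inside under small moves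
    along one axis. *)
Lemma disc_perturbation {R : realType} (m d Z : R) : 0 <= Z -> 0 < 1 - m ^+ 2 - Z ->
  `|d| < (1 - m ^+ 2 - Z) / 4 -> 0 <= 1 - (m + d) ^+ 2 - Z.
Proof.
set T := 1 - _ - _ => Z0 T0 dT.
have m1 : `|m| <= 1 by apply: norm_le1_of_sqr; rewrite /T in T0; lra.
have T1 : T <= 1 by rewrite /T; have := sqr_ge0 m; lra.
have h1 : m * d <= T / 4.
  by rewrite (le_trans (ler_norm _))// normrM (le_trans _ (ltW dT))// ler_piMl.
have h2 : d ^+ 2 <= T / 4.
  rewrite -real_normK ?num_real// expr2 (le_trans _ (ltW dT))// ler_piMl//; lra.
rewrite (_ : 1 - (m + d) ^+ 2 - Z = T - 2 * (m * d) - d ^+ 2); last by rewrite /T; ring.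
lra.
Qed.

Section Bernstein.
Context {R : realType}.
Variables a a1 a2 a11 a12 a22 a111 a112 a122 a222 : R * R -> R.
Variables b b1 b2 b11 b12 b22 b111 b112 b122 b222 : R * R -> R.
Hypothesis ja : jet3 a a1 a2 a11 a12 a22 a111 a112 a122 a222.
Hypothesis jb : jet3 b b1 b2 b11 b12 b22 b111 b112 b122 b222.
Let f z := 1 - a z ^+ 2 - b z ^+ 2.
Hypothesis eqa : forall z, a11 z + a22 z = - a z * f z.
Hypothesis eqb : forall z, b11 z + b22 z = - b z * f z.
Let e z := a1 z ^+ 2 + a2 z ^+ 2 + b1 z ^+ 2 + b2 z ^+ 2.
Let f1 z := - 2 * (a z * a1 z + b z * b1 z).
Let f2 z := - 2 * (a z * a2 z + b z * b2 z).

Lemma third_order_equations z :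
  [/\ a111 z + a122 z = - a1 z * f z - a z * f1 z,
      a112 z + a222 z = - a2 z * f z - a z * f2 z,
      b111 z + b122 z = - b1 z * f z - b z * f1 z &
      b112 z + b222 z = - b2 z * f z - b z * f2 z].
Proof.
case: ja => _ _ _ [? ?] _ _ [? ?] [? ?] [? ?].
case: jb => _ _ _ [? ?] _ _ [? ?] [? ?] [? ?].
case: z => x y.
have E1 y' : (fun s => a11 (s, y') + a22 (s, y')) = (fun s => - a (s, y') * f (s, y')).
  by apply/funext => s; exact: eqa.
have E2 x' : (fun s => a11 (x', s) + a22 (x', s)) = (fun s => - a (x', s) * f (x', s)).
  by apply/funext => s; exact: eqa.
have E3 y' : (fun s => b11 (s, y') + b22 (s, y')) = (fun s => - b (s, y') * f (s, y')).
  by apply/funext => s; exact: eqb.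
have E4 x' : (fun s => b11 (x', s) + b22 (x', s)) = (fun s => - b (x', s) * f (x', s)).
  by apply/funext => s; exact: eqb.
split.
- apply: (is_derive_unique (fun s => a11 (s, y) + a22 (s, y)) x); first by derive_rules.
  by rewrite E1 /f /f1; derive_rules; ring.
- apply: (is_derive_unique (fun s => a11 (x, s) + a22 (x, s)) y); first by derive_rules.
  by rewrite E2 /f /f2; derive_rules; ring.
- apply: (is_derive_unique (fun s => b11 (s, y) + b22 (s, y)) x); first by derive_rules.
  by rewrite E3 /f /f1; derive_rules; ring.
- apply: (is_derive_unique (fun s => b11 (x, s) + b22 (x, s)) y); first by derive_rules.
  by rewrite E4 /f /f2; derive_rules; ring.
Qed.


(** Bernstein's method: the maximum principle is applied to [t ^+ 2 * e] plus a multiple of |u|^2.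
    The Laplacian of |u|^2 is 2 e - 2 (1 - f) f, so this multiple supplies the positive term in [e]
    that pays for the cut-off [t]. *)
Lemma gradient_bound X Y dl : 0 <= dl <= 1 ->
  (forall x y, (x - X) ^+ 2 + (y - Y) ^+ 2 <= 1 -> `|f (x, y)| <= dl) ->
  e (X, Y) <= 53 * dl.
Proof.
move=> dl01 fdl.
case: (ja) => [[ca ca1 ca2] [ca11 ca12 ca22] _ [? ?] [? ?] [? ?] [? ?] [? ?] [? ?]].
case: (jb) => [[cb cb1 cb2] [cb11 cb12 cb22] _ [? ?] [? ?] [? ?] [? ?] [? ?] [? ?]].
pose t (z : R * R) := 1 - (z.1 - X) ^+ 2 - (z.2 - Y) ^+ 2.
pose ex z := 2 * (a1 z * a11 z + a2 z * a12 z + b1 z * b11 z + b2 z * b12 z).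
pose ey z := 2 * (a1 z * a12 z + a2 z * a22 z + b1 z * b12 z + b2 z * b22 z).
pose exx z := 2 * (a11 z ^+ 2 + a12 z ^+ 2 + b11 z ^+ 2 + b12 z ^+ 2 +
  (a1 z * a111 z + a2 z * a112 z + b1 z * b111 z + b2 z * b112 z)).
pose eyy z := 2 * (a12 z ^+ 2 + a22 z ^+ 2 + b12 z ^+ 2 + b22 z ^+ 2 +
  (a1 z * a122 z + a2 z * a222 z + b1 z * b122 z + b2 z * b222 z)).
pose Phi z := t z ^+ 2 * e z + 22 * (a z ^+ 2 + b z ^+ 2).
pose Phi1 (z : R * R) := - 4 * t z * (z.1 - X) * e z + t z ^+ 2 * ex z + 44 * (a z * a1 z + b z * b1 z).
pose Phi2 (z : R * R) := - 4 * t z * (z.2 - Y) * e z + t z ^+ 2 * ey z + 44 * (a z * a2 z + b z * b2 z).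
pose Phi11 (z : R * R) := (8 * (z.1 - X) ^+ 2 - 4 * t z) * e z - 8 * t z * (z.1 - X) * ex z +
  t z ^+ 2 * exx z + 44 * (a1 z ^+ 2 + b1 z ^+ 2 + a z * a11 z + b z * b11 z).
pose Phi22 (z : R * R) := (8 * (z.2 - Y) ^+ 2 - 4 * t z) * e z - 8 * t z * (z.2 - Y) * ey z +
  t z ^+ 2 * eyy z + 44 * (a2 z ^+ 2 + b2 z ^+ 2 + a z * a22 z + b z * b22 z).
have dPhi1 : pd1 Phi Phi1.
  by move=> x y; rewrite /Phi /Phi1 /t /e /ex; derive_rules; ring.
have dPhi2 : pd2 Phi Phi2.
  by move=> x y; rewrite /Phi /Phi2 /t /e /ey; derive_rules; ring.
have dPhi11 : pd1 Phi1 Phi11.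
  by move=> x y; rewrite /Phi1 /Phi11 /t /e /ex /exx; derive_rules; ring.
have dPhi22 : pd2 Phi2 Phi22.
  by move=> x y; rewrite /Phi2 /Phi22 /t /e /ey /eyy; derive_rules; ring.
have e0 z : 0 <= e z by rewrite /e; nra.
have Lap z : 0 <= t z -> t z <= 1 -> `|f z| <= dl -> 10 * e z - 88 * dl <= Phi11 z + Phi22 z.
  move=> t0 t1 fz.
  have [T1 T2 T3 T4] := third_order_equations z.
  (* The cross terms from the cut-off complete the second derivatives of u to squares, at the price
     of - 24 (1 - t) e - 8 t e; the term 44 e comes from 22 |u|^2 and dominates this price. *)
  have -> : Phi11 z + Phi22 z =
      2 * ((t z * a11 z - 4 * (z.1 - X) * a1 z) ^+ 2 + (t z * a12 z - 4 * (z.2 - Y) * a1 z) ^+ 2 +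
           (t z * a12 z - 4 * (z.1 - X) * a2 z) ^+ 2 + (t z * a22 z - 4 * (z.2 - Y) * a2 z) ^+ 2 +
           (t z * b11 z - 4 * (z.1 - X) * b1 z) ^+ 2 + (t z * b12 z - 4 * (z.2 - Y) * b1 z) ^+ 2 +
           (t z * b12 z - 4 * (z.1 - X) * b2 z) ^+ 2 + (t z * b22 z - 4 * (z.2 - Y) * b2 z) ^+ 2)
      + t z ^+ 2 * (f1 z ^+ 2 + f2 z ^+ 2) - 2 * t z ^+ 2 * e z * f z
      - 24 * (1 - t z) * e z - 8 * t z * e z + 44 * e z - 44 * (1 - f z) * f z.
    rewrite (_ : Phi11 z + Phi22 z = (8 * ((z.1 - X) ^+ 2 + (z.2 - Y) ^+ 2) - 8 * t z) * e z
      - 8 * t z * ((z.1 - X) * ex z + (z.2 - Y) * ey z)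
      + 2 * t z ^+ 2 * (a11 z ^+ 2 + 2 * a12 z ^+ 2 + a22 z ^+ 2 + b11 z ^+ 2 + 2 * b12 z ^+ 2 + b22 z ^+ 2
         + (a1 z * (a111 z + a122 z) + a2 z * (a112 z + a222 z) + b1 z * (b111 z + b122 z) + b2 z * (b112 z + b222 z)))
      + 44 * (e z + a z * (a11 z + a22 z) + b z * (b11 z + b22 z))); last first.
      by rewrite /Phi11 /Phi22 /exx /eyy /e; ring.
    by rewrite T1 T2 T3 T4 eqa eqb /ex /ey /e /f1 /f2 /t /f; ring.
  have := fz; rewrite ler_norml => /andP[fz1 fz2].
  have /andP[dl0 dl1] := dl01.
  have q1 : t z ^+ 2 * e z * f z <= e z * dl.
    apply: (@le_trans _ _ (t z ^+ 2 * (e z * dl))).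
      by rewrite -mulrA ler_wpM2l ?sqr_ge0// ler_wpM2l.
    by rewrite ler_piMl ?mulr_ge0// exprn_ile1.
  have q2 : (1 - f z) * f z <= 2 * dl.
    apply: (@le_trans _ _ (`|1 - f z| * `|f z|)); first by rewrite -normrM ler_norm.
    by rewrite ler_pM// ler_norml; lra.
  have q3 := mulr_ge0 (sqr_ge0 (t z)) (addr_ge0 (sqr_ge0 (f1 z)) (sqr_ge0 (f2 z))).
  have q4 : t z * e z <= e z by rewrite ler_piMl.
  have q5 : 0 <= t z * e z by rewrite mulr_ge0.
  have q6 : e z * dl <= e z by rewrite ler_piMr.
  set S := (_ + _ ^+ 2 in X in _ <= 2 * X + _ - _ - _ - _ + _ - _).
  have S0 : 0 <= S by rewrite /S !addr_ge0// sqr_ge0.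
  lra.
have ct : continuous t by rewrite /t; cont_rules.
have cPhi : continuous Phi by rewrite /Phi /e; cont_rules.
pose K := box (`|X| + 1) (`|Y| + 1) `&` [set z | 0 <= t z].
have cK : compact K.
  apply: compact_closedI; first by apply: compact_setX; exact: segment_compact.
  rewrite (_ : [set z | 0 <= t z] = t @^-1` [set x | 0 <= x])//.
  by apply: closed_comp => [z _|]; [exact: ct|exact: closed_ge].
have tK w : 0 <= t w -> K w.
  case: w => x y tw; split=> //; move: tw; rewrite /t/= => tw.
  have x1 : `|x - X| <= 1 by apply: norm_le1_of_sqr; have := sqr_ge0 (y - Y); lra.
  have y1 : `|y - Y| <= 1 by apply: norm_le1_of_sqr; have := sqr_ge0 (x - X); lra.
  move: x1 y1; rewrite !ler_norml => x1 y1.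
  by split; rewrite /= in_itv/=; have := ler_norm X; have := ler_norm (- X);
    have := ler_norm Y; have := ler_norm (- Y); rewrite !normrN; lra.
have K0 : K (X, Y) by apply: tK; rewrite /t /= !subrr; lra.
have [z /set_mem[_ tz] zmax] := @compact_EVT_max _ R Phi K (ex_intro _ _ K0) cK (continuous_subspaceT cPhi).
have fz : `|f z| <= dl by case: (z) tz => x y; rewrite /t/= => ?; apply: fdl; lra.
have fXY : `|f (X, Y)| <= dl by apply: fdl; rewrite !subrr; lra.
have PhiXY : Phi (X, Y) <= Phi z by apply: zmax; exact: mem_set.
have PhiE w : Phi w = t w ^+ 2 * e w + 22 * (1 - f w) by rewrite /Phi /f; ring.
move: PhiXY; rewrite !PhiE (_ : t (X, Y) = 1); last by rewrite /t /= !subrr; ring.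
move: (fz) fXY; rewrite !ler_norml expr1n mul1r => fz' fXY PhiXY.
have t1 : t z <= 1 by rewrite /t; have := sqr_ge0 (z.1 - X); have := sqr_ge0 (z.2 - Y); lra.
(* If the maximum lies on the circle, [Phi] reduces there to 22 |u|^2, and comparison with the
   centre gives at most 44 dl. *)
have [t0|tpos] := leP (t z) 0.
  have tz0 : t z = 0 by apply/eqP; rewrite eq_le t0.
  by move: PhiXY; rewrite tz0 expr0n/= mul0r; lra.
have Phi11z : Phi11 z <= 0.
  case: (z) tz fz zmax tpos t1 {PhiXY fz'} => x y tz fz zmax tpos t1.
  have t4 : 0 < t (x, y) / 4 by rewrite divr_gt0.
  have loc s : `|s - x| < t (x, y) / 4 -> Phi (s, y) <= Phi (x, y).
    move=> hs; apply: zmax; apply/mem_set/tK.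
    rewrite /t /= in tpos hs *.
    rewrite (_ : s - X = (x - X) + (s - x)); last by ring.
    exact: (disc_perturbation _ _ _ (sqr_ge0 _) tpos hs).
  exact: (@second_derivative_at_max R _ _ _ x _ t4 (fun s => dPhi1 s y) (dPhi11 x y) loc).
have Phi22z : Phi22 z <= 0.
  case: (z) tz fz zmax tpos t1 {PhiXY fz'} => x y tz fz zmax tpos t1.
  have t4 : 0 < t (x, y) / 4 by rewrite divr_gt0.
  have loc s : `|s - y| < t (x, y) / 4 -> Phi (x, s) <= Phi (x, y).
    move=> hs; apply: zmax; apply/mem_set/tK.
    rewrite /t /= in tpos hs *.
    rewrite (_ : s - Y = (y - Y) + (s - y)); last by ring.
    rewrite [leRHS]addrAC; rewrite addrAC in tpos; rewrite [X in _ < X / 4]addrAC in hs.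
    exact: (disc_perturbation _ _ _ (sqr_ge0 _) tpos hs).
  exact: (@second_derivative_at_max R _ _ _ y _ t4 (fun s => dPhi2 x s) (dPhi22 x y) loc).
(* At an interior maximum 10 e <= 88 dl, so at the centre e <= 8.8 dl + 44 dl. *)
have L := Lap z tz t1 fz.
have te : t z ^+ 2 * e z <= e z by rewrite ler_piMl// exprn_ile1.
have := e0 z; lra.
Qed.

End Bernstein.

(** * The density and the current *)

Definition outside {R : realType} (r x y : R) := (r <= `|x|) || (r <= `|y|).

(* For u = a + i b: f = 1 - |u|^2, (j1, j2) = Im (conj u * grad u), J = det (grad u),
   p = d_2 j1 and q = d_2 j2; then d_1 j1 = - q (div j = 0) and d_1 j2 = p + 2 J (curl j = 2 J). *)
Record current_system {R : realType} (f f1 f2 f11 f22 j1 j2 p q q1 J : R * R -> R) : Prop :=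
  CurrentSystem {
  cs_cf : [/\ continuous f, continuous f1, continuous f2, continuous f11 & continuous f22];
  cs_cj : [/\ continuous j1, continuous j2, continuous p, continuous q & continuous q1];
  cs_cJ : continuous J;
  cs_df : pd1 f f1 /\ pd2 f f2;
  cs_df1 : pd1 f1 f11 /\ pd2 f2 f22;
  cs_dj1 : pd1 j1 (fun z => - q z) /\ pd2 j1 p;
  cs_dj2 : pd1 j2 (fun z => p z + 2 * J z) /\ pd2 j2 q;
  cs_dq : pd1 q q1 /\ pd2 (fun z => p z + 2 * J z) q1;
  cs_H : forall z, f z * (1 - f z) ^+ 2 - (j1 z ^+ 2 + j2 z ^+ 2) =
    2^-1 * (1 - f z) * (f11 z + f22 z) + (f1 z ^+ 2 + f2 z ^+ 2) / 4;
  cs_J : forall z, 2 * (1 - f z) * J z = f2 z * j1 z - f1 z * j2 z;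
  cs_small : forall dl, 0 < dl -> exists2 r, 0 < r & forall x y, outside r x y ->
    [/\ `|f (x, y)| <= dl, j1 (x, y) ^+ 2 + j2 (x, y) ^+ 2 <= dl ^+ 2 &
        f1 (x, y) ^+ 2 + f2 (x, y) ^+ 2 <= dl ^+ 2] }.

Section ToCurrents.
Context {R : realType}.
Variables a a1 a2 a11 a12 a22 a111 a112 a122 a222 : R * R -> R.
Variables b b1 b2 b11 b12 b22 b111 b112 b122 b222 : R * R -> R.
Hypothesis ja : jet3 a a1 a2 a11 a12 a22 a111 a112 a122 a222.
Hypothesis jb : jet3 b b1 b2 b11 b12 b22 b111 b112 b122 b222.
Let f z := 1 - a z ^+ 2 - b z ^+ 2.
Hypothesis eqa : forall z, a11 z + a22 z = - a z * f z.
Hypothesis eqb : forall z, b11 z + b22 z = - b z * f z.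
Hypothesis f_lim : forall dl, 0 < dl -> exists2 r, 0 < r &
  forall x y, outside r x y -> `|f (x, y)| <= dl.

(** div j = 0 because a Delta b - b Delta a = 0. The equation enters through the elimination of
    [a11] and [b11], after which the relations are polynomial identities. The smallness clause is
    the Bernstein bound on unit discs. *)
Lemma current_system_of_jets : current_system f
  (fun z => - 2 * (a z * a1 z + b z * b1 z)) (fun z => - 2 * (a z * a2 z + b z * b2 z))
  (fun z => - 2 * (a1 z ^+ 2 + b1 z ^+ 2 + a z * a11 z + b z * b11 z))
  (fun z => - 2 * (a2 z ^+ 2 + b2 z ^+ 2 + a z * a22 z + b z * b22 z))
  (fun z => a z * b1 z - b z * a1 z) (fun z => a z * b2 z - b z * a2 z)
  (fun z => a2 z * b1 z - b2 z * a1 z + a z * b12 z - b z * a12 z)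
  (fun z => a z * b22 z - b z * a22 z)
  (fun z => a1 z * b22 z - b1 z * a22 z + a z * b122 z - b z * a122 z)
  (fun z => a1 z * b2 z - b1 z * a2 z).
Proof.
case: (ja) => [[ca ca1 ca2] [ca11 ca12 ca22] [_ _ ca122 _] [? ?] [? ?] [? ?] [? ?] [? ?] [? ?]].
case: (jb) => [[cb cb1 cb2] [cb11 cb12 cb22] [_ _ cb122 _] [? ?] [? ?] [? ?] [? ?] [? ?] [? ?]].
have ea z : a11 z = - a z * f z - a22 z by rewrite -eqa; ring.
have eb z : b11 z = - b z * f z - b22 z by rewrite -eqb; ring.
split.
- by split; rewrite /f; cont_rules.
- by split; cont_rules.
- by cont_rules.
- by split=> x y; rewrite /f; derive_rules; ring.
- by split=> x y; derive_rules; ring.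
- by split=> x y; derive_rules; rewrite ?ea ?eb; ring.
- by split=> x y; derive_rules; ring.
- by split=> x y; derive_rules; ring.
- by move=> z; rewrite ea eb /f; field.
- by move=> z; rewrite /f; ring.
move=> dl dl0.
(* 424 = 8 * 53: with |u|^2 <= 2 and e <= 53 c this gives |u|^2 e <= dl^2 / 4, which bounds |j|^2
   and, after a factor 4, |grad f|^2. *)
pose c := Num.min (Num.min 1 dl) (dl ^+ 2 / 424).
have c424 : 0 < 424 :> R by rewrite ltr0n.
have c0 : 0 < c by rewrite !lt_min ltr01 dl0 (divr_gt0 (exprn_gt0 2 dl0) c424).
have c1 : c <= 1 by rewrite !ge_min lexx.
have c2 : c <= dl by rewrite !ge_min lexx orbT.
have c3 : c <= dl ^+ 2 / 424 by rewrite !ge_min lexx orbT.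
have [r r0 Hr] := f_lim _ c0.
(* The margin 1 keeps the unit disc around the point in the region where f is small. *)
exists (r + 1); first lra.
move=> X Y oXY.
have near_small x y : (x - X) ^+ 2 + (y - Y) ^+ 2 <= 1 -> `|f (x, y)| <= c.
  move=> d1; apply: Hr.
  have x1 : `|x - X| <= 1 by apply: norm_le1_of_sqr; have := sqr_ge0 (y - Y); lra.
  have y1 : `|y - Y| <= 1 by apply: norm_le1_of_sqr; have := sqr_ge0 (x - X); lra.
  case/orP: oXY => h; apply/orP; [left|right].
    have := ler_normB x (x - X); rewrite subKr; lra.
  have := ler_normB y (y - Y); rewrite subKr; lra.
have fXY : `|f (X, Y)| <= c by apply: near_small; rewrite !subrr; lra.
have := gradient_bound _ _ _ _ _ _ _ _ _ _ _ _ _ _ _ _ _ _ _ _ ja jb eqa eqb X Y c _ near_small.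
move=> /(_ ltac:(lra)).
set z := (X, Y); set e := (a1 z ^+ 2 + _ + _ + _) => e_le.
have fz := fXY; rewrite ler_norml -/z in fz.
have e0 : 0 <= e by rewrite /e !addr_ge0// sqr_ge0.
have uE : a z ^+ 2 + b z ^+ 2 = 1 - f z by rewrite /f; ring.
have ue : (a z ^+ 2 + b z ^+ 2) * e <= dl ^+ 2 / 4.
  apply: (@le_trans _ _ (2 * e)); last lra.
  by rewrite ler_wpM2r// uE; lra.
have s0 : 0 <= (a z * b1 z - b z * a1 z) ^+ 2 + (a z * b2 z - b z * a2 z) ^+ 2.
  by rewrite addr_ge0// sqr_ge0.
have s1 : 0 <= (a z * a1 z + b z * b1 z) ^+ 2 + (a z * a2 z + b z * b2 z) ^+ 2.
  by rewrite addr_ge0// sqr_ge0.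
have E : (a z ^+ 2 + b z ^+ 2) * e =
  (a z * b1 z - b z * a1 z) ^+ 2 + (a z * b2 z - b z * a2 z) ^+ 2 +
  ((a z * a1 z + b z * b1 z) ^+ 2 + (a z * a2 z + b z * b2 z) ^+ 2) by rewrite /e; ring.
have d0 := sqr_ge0 dl.
split; first exact: le_trans c2.
- lra.
- by rewrite !exprMn -mulrDr; lra.
Qed.

End ToCurrents.

Section RealSystem.
Context {R : realType}.

Lemma current_system_of_smooth (a b : R * R -> R) (f := fun z => 1 - a z ^+ 2 - b z ^+ 2) :
  smooth a -> smooth b ->
  (forall z, laplacian a z = - a z * f z) -> (forall z, laplacian b z = - b z * f z) ->
  (forall dl, 0 < dl -> exists2 r, 0 < r & forall x y, outside r x y -> `|f (x, y)| <= dl) ->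
  exists f1 f2 f11 f22 j1 j2 p q q1 J, current_system f f1 f2 f11 f22 j1 j2 p q q1 J.
Proof.
move=> sa sb ea eb fl.
have [a1 [a2 [a11 [a12 [a22 [a111 [a112 [a122 [a222 [ja la]]]]]]]]]] := smooth_jet3 _ sa.
have [b1 [b2 [b11 [b12 [b22 [b111 [b112 [b122 [b222 [jb lb]]]]]]]]]] := smooth_jet3 _ sb.
do 10 eexists; apply: (current_system_of_jets _ _ _ _ _ _ _ _ _ _ _ _ _ _ _ _ _ _ _ _ ja jb) => //.
- by move=> z; rewrite -la.
- by move=> z; rewrite -lb.
Qed.

End RealSystem.

(** Cauchy-Schwarz bounds (2 (1 - f) J)^2 by |grad f|^2 |j|^2, and 2 (1 - f) >= 1. *)
Lemma sqr_J_le {R : realType} (f f1 f2 j1 j2 J : R)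
  (X2 := f1 ^+ 2 + f2 ^+ 2) :
  `|f| <= 1 / 100 -> j1 ^+ 2 + j2 ^+ 2 <= 10000^-1 -> X2 <= 10000^-1 ->
  2 * (1 - f) * J = f2 * j1 - f1 * j2 ->
  J ^+ 2 <= 10000^-1 * X2.
Proof.
move=> f_le j_le X_le J_eq; have fl := f_le; rewrite ler_norml in fl.
have h : (2 * (1 - f) * J) ^+ 2 <= X2 * (j1 ^+ 2 + j2 ^+ 2).
  rewrite J_eq -subr_ge0 (_ : _ - _ = (f1 * j1 + f2 * j2) ^+ 2) ?sqr_ge0//.
  by rewrite /X2; ring.
have X0 : 0 <= X2 by rewrite addr_ge0// sqr_ge0.
have h2 : X2 * (j1 ^+ 2 + j2 ^+ 2) <= X2 * 10000^-1 by rewrite ler_wpM2l.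
have c : 1 <= (2 * (1 - f)) ^+ 2 by rewrite exprn_ege1//; clear -fl; lra.
rewrite mulrC; apply: le_trans h2; apply: le_trans h.
by rewrite exprMn ler_peMl// sqr_ge0.
Qed.

Lemma young {R : realType} (c x y : R) : 0 < c -> 2 * (x * y) <= c * x ^+ 2 + c^-1 * y ^+ 2.
Proof.
move=> c0; rewrite -subr_ge0 (_ : _ - _ = c^-1 * (c * x - y) ^+ 2).
  by rewrite mulr_ge0 ?invr_ge0 ?sqr_ge0// ltW.
by field; rewrite gt_eqF.
Qed.

(** In the divergence of t^2 H grad f, where H = f (1 - f)^2 - |j|^2 is rewritten by the basic
    identity, D^2 and |grad f|^2 appear with coefficients near 1/2 and 1 as f is small. The product
    of grad f with grad |j|^2 costs |j|^2 S, whence the small factor of S, and the derivatives of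
    the cut-off cost |grad t|^2 |grad f|^2. *)
Lemma density_inequality {R : realType} (f f1 f2 D j1 j2 p q J t t1 t2 : R)
  (X2 := f1 ^+ 2 + f2 ^+ 2) (N2 := t1 ^+ 2 + t2 ^+ 2) (S := p ^+ 2 + q ^+ 2) :
  `|f| <= 1 / 100 -> j1 ^+ 2 + j2 ^+ 2 <= 10000^-1 -> X2 <= 10000^-1 ->
  2 * (1 - f) * J = f2 * j1 - f1 * j2 ->
    8^-1 * (t ^+ 2 * (D ^+ 2 + X2)) <=
  t ^+ 2 * ((2^-1 * (1 - f) * D + X2 / 4) * D + (1 - f) * (1 - 3 * f) * X2
    - 2 * (f1 * (j2 * (p + 2 * J) - j1 * q) + f2 * (j1 * p + j2 * q)))
  + 2 * t * (t1 * f1 + t2 * f2) * (2^-1 * (1 - f) * D + X2 / 4)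
  + 24 / 10000 * (t ^+ 2 * S) + 4 * (N2 * X2).
Proof.
move=> f_le j_le X_le J_eq; have fl := f_le; rewrite ler_norml in fl.
have JX : J ^+ 2 <= 10000^-1 * X2 by exact: (sqr_J_le f f1 f2 j1 j2 J).
have X0 : 0 <= X2 by rewrite addr_ge0// sqr_ge0.
have S0 : 0 <= S by rewrite addr_ge0// sqr_ge0.
have D0 : 0 <= D ^+ 2 by exact: sqr_ge0.
have T0 : 0 <= t ^+ 2 by exact: sqr_ge0.
have XX : X2 ^+ 2 <= 10000^-1 * X2 by rewrite expr2 ler_wpM2r.
have j2_le : j2 ^+ 2 <= 10000^-1 by rewrite (le_trans _ j_le)// lerDr sqr_ge0.
have c4 : 0 < 1 / 4 :> R by clear; lra.
have y4 (x y : R) : 2 * (x * y) <= 4^-1 * x ^+ 2 + 4 * y ^+ 2.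
  by have := young (1 / 4) x y c4; rewrite div1r invrK.
set w := t1 * f1 + t2 * f2.
have w_le : w ^+ 2 <= N2 * X2.
  rewrite -subr_ge0 (_ : _ - _ = (t1 * f2 - t2 * f1) ^+ 2) ?sqr_ge0//.
  by rewrite /w /N2 /X2; ring.
have K1 : 43 / 100 * D ^+ 2 + 7 / 10 * X2 - 24 / 10000 * S <=
    (2^-1 * (1 - f) * D + X2 / 4) * D + (1 - f) * (1 - 3 * f) * X2
    - 2 * (f1 * (j2 * (p + 2 * J) - j1 * q) + f2 * (j1 * p + j2 * q)).
  have a1 : 495 / 1000 * D ^+ 2 <= 2^-1 * (1 - f) * D ^+ 2 by rewrite ler_wpM2r//; clear -fl; lra.
  have a2 : - (16^-1 * D ^+ 2 + 4^-1 * X2 ^+ 2) <= X2 / 4 * D.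
    have := y4 (- D / 2) X2; rewrite (_ : (- D / 2) ^+ 2 = D ^+ 2 / 4); last by clear; field.
    have := y4 (- D / 2) (X2 / 4); rewrite (_ : (- D / 2) ^+ 2 = D ^+ 2 / 4); last by clear; field.
    rewrite (_ : (X2 / 4) ^+ 2 = X2 ^+ 2 / 16); last by clear; field.
    by move: (X2 ^+ 2) (D ^+ 2) => x d; clear; lra.
  have a3 : 96 / 100 * X2 <= (1 - f) * (1 - 3 * f) * X2.
    rewrite ler_wpM2r// (_ : (1 - f) * (1 - 3 * f) = 1 - 4 * f + 3 * f ^+ 2); last by clear; ring.
    by have := sqr_ge0 f; clear -fl; lra.
  set A := j2 * (p + 2 * J) - j1 * q; set B := j1 * p + j2 * q.
  have a4 : 2 * (f1 * A + f2 * B) <= 4^-1 * X2 + 4 * (A ^+ 2 + B ^+ 2).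
    by rewrite /X2; have := y4 f1 A; have := y4 f2 B; clear; lra.
  have a5 : A ^+ 2 + B ^+ 2 <= 2 * ((j1 ^+ 2 + j2 ^+ 2) * S) + 8 * (j2 ^+ 2 * J ^+ 2).
    rewrite -subr_ge0 (_ : _ - _ = (j2 * p - j1 * q - 2 * j2 * J) ^+ 2 + (j1 * p + j2 * q) ^+ 2).
      by rewrite addr_ge0// sqr_ge0.
    by rewrite /A /B /S; clear; ring.
  have a6 : (j1 ^+ 2 + j2 ^+ 2) * S <= 10000^-1 * S by rewrite ler_wpM2r.
  have a7 : j2 ^+ 2 * J ^+ 2 <= 10000^-1 * J ^+ 2 by rewrite ler_wpM2r ?sqr_ge0.
  rewrite [(_ + X2 / 4) * D]mulrDl (_ : 2^-1 * (1 - f) * D * D = 2^-1 * (1 - f) * D ^+ 2); last by clear; ring.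
  move: D0 JX XX X0 S0 a1 a2 a3 a4 a5 a6 a7; rewrite -/X2 -/S; clear; clearbody X2 S A B => *.
  lra.
have K2 : t ^+ 2 * (43 / 100 * D ^+ 2 + 7 / 10 * X2 - 24 / 10000 * S) <= t ^+ 2 *
   ((2^-1 * (1 - f) * D + X2 / 4) * D + (1 - f) * (1 - 3 * f) * X2
    - 2 * (f1 * (j2 * (p + 2 * J) - j1 * q) + f2 * (j1 * p + j2 * q))) by rewrite ler_wpM2l.
have b1 : - (8^-1 * (t ^+ 2 * D ^+ 2) + 204 / 100 * w ^+ 2 + 1 / 100 * w ^+ 2) <= t * w * ((1 - f) * D).
  have := y4 (- (t * D)) ((1 - f) * w).
  rewrite sqrrN !exprMn.
  have : (1 - f) ^+ 2 * w ^+ 2 <= (1 + 1 / 40) * w ^+ 2.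
    rewrite ler_wpM2r ?sqr_ge0// (_ : (1 - f) ^+ 2 = 1 - 2 * f + f * f); last by clear; ring.
    have : f * f <= 1 / 100 * (1 / 100) by rewrite (le_trans (ler_norm _))// normrM ler_pM.
    by clear -fl; lra.
  rewrite (_ : 2 * (- (t * D) * ((1 - f) * w)) = - 2 * (t * w * ((1 - f) * D))); last by clear; ring.
  have := sqr_ge0 w; clear; lra.
have b2 : - (4^-1 * (t ^+ 2 * X2 ^+ 2) + 4^-1 * w ^+ 2) <= t * w * (X2 / 2).
  have := young 1 (- (t * X2)) w ltr01; rewrite sqrrN exprMn invr1 !mul1r.
  rewrite (_ : 2 * (- (t * X2) * w) = - 4 * (t * w * (X2 / 2))); last by clear; field.
  clear; lra.
have tXX : t ^+ 2 * X2 ^+ 2 <= t ^+ 2 * (10000^-1 * X2) by rewrite ler_wpM2l.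
have tX0 : 0 <= t ^+ 2 * X2 by rewrite mulr_ge0.
have tD0 : 0 <= t ^+ 2 * D ^+ 2 by rewrite mulr_ge0.
rewrite (_ : 2 * t * w * (2^-1 * (1 - f) * D + X2 / 4) = t * w * ((1 - f) * D) + t * w * (X2 / 2)); last by clear; field.
have w0 := sqr_ge0 w.
have K3 : t ^+ 2 * (43 / 100 * D ^+ 2 + 7 / 10 * X2 - 24 / 10000 * S) =
  43 / 100 * (t ^+ 2 * D ^+ 2) + 7 / 10 * (t ^+ 2 * X2) - 24 / 10000 * (t ^+ 2 * S) by clear; ring.
rewrite K3 in K2.
clear -K2 b1 b2 tXX tX0 tD0 w_le w0.
lra.
Qed.

(** The same for minus the divergence of t^2 (j1 q, - j1 (p + 2 J)), whose main term S + 2 J p is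
    minus det (grad j). The cross term is split so that J^2 falls under its bound by |grad f|^2. *)
Lemma current_inequality {R : realType} (f f1 f2 j1 j2 p q J t t1 t2 : R)
  (X2 := f1 ^+ 2 + f2 ^+ 2) (N2 := t1 ^+ 2 + t2 ^+ 2) (S := p ^+ 2 + q ^+ 2) :
  `|f| <= 1 / 100 -> j1 ^+ 2 + j2 ^+ 2 <= 10000^-1 -> X2 <= 10000^-1 ->
  2 * (1 - f) * J = f2 * j1 - f1 * j2 ->
    3 / 8 * (t ^+ 2 * S) <=
  t ^+ 2 * (S + 2 * J * p) - 2 * t * j1 * (t1 * q - t2 * (p + 2 * J))
  + 1 / 1000 * (t ^+ 2 * X2) + 4 * (N2 * j1 ^+ 2).
Proof.
move=> f_le j_le X_le J_eq.
have JX : J ^+ 2 <= 10000^-1 * X2 by exact: (sqr_J_le f f1 f2 j1 j2 J).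
have T0 : 0 <= t ^+ 2 by exact: sqr_ge0.
have a1 : - (8^-1 * p ^+ 2 + 8 * J ^+ 2) <= 2 * J * p.
  have := young (1 / 8) (- p) J ltac:(clear; lra); rewrite sqrrN (_ : (1 / 8)^-1 = 8); last by field.
  clear; lra.
have a2 : t ^+ 2 * - (8^-1 * p ^+ 2 + 8 * J ^+ 2) <= t ^+ 2 * (2 * J * p) by rewrite ler_wpM2l.
have a3 : 2 * t * j1 * (t1 * q - t2 * (p + 2 * J)) <=
    4^-1 * (t ^+ 2 * (q ^+ 2 + (p + 2 * J) ^+ 2)) + 4 * (N2 * j1 ^+ 2).
  have := young (1 / 4) (t * q) (t1 * j1) ltac:(clear; lra).
  have := young (1 / 4) (- (t * (p + 2 * J))) (t2 * j1) ltac:(clear; lra).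
  rewrite (_ : (1 / 4)^-1 = 4); last by field.
  by rewrite sqrrN !exprMn /N2; clear; lra.
have a4 : t ^+ 2 * (p + 2 * J) ^+ 2 <= t ^+ 2 * (2 * p ^+ 2 + 8 * J ^+ 2).
  rewrite ler_wpM2l// -subr_ge0 (_ : _ - _ = (p - 2 * J) ^+ 2) ?sqr_ge0//; by ring.
have a5 : t ^+ 2 * J ^+ 2 <= t ^+ 2 * (10000^-1 * X2) by rewrite ler_wpM2l.
have tX0 : 0 <= t ^+ 2 * X2 by rewrite mulr_ge0// addr_ge0// sqr_ge0.
have tq : 0 <= t ^+ 2 * q ^+ 2 by rewrite mulr_ge0// sqr_ge0.
rewrite /S; clear -a2 a3 a4 a5 tX0 tq; lra.
Qed.

(** * Energy estimates *)

Section IntegralHelpers.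
Context {R : realType}.
Implicit Types (F G H : R * R -> R) (r x y : R).

Lemma derive_nondecreasing (g dg : R -> R) (r s : R) : r <= s ->
  (forall t, r <= t <= s -> is_derive t (1 : R) g (dg t)) ->
  (forall t, r <= t <= s -> 0 <= dg t) -> g r <= g s.
Proof.
move=> rs d dg0.
have [||c] := @MVT_segment R g dg r s rs.
- by move=> x; rewrite in_itv/= => /andP[? ?]; apply: d; rewrite !ltW.
- apply: continuous_in_subspaceT => x; rewrite inE/= in_itv/= => xrs.
  by apply: differentiable_continuous; have := d x xrs => ?; exact/derivable1_diffP.
- rewrite in_itv/= => crs E; rewrite -subr_ge0 E mulr_ge0 ?dg0// subr_ge0//.
Qed.

Lemma bd_ge0 r F : 0 < r -> continuous F ->
  (forall x y, outside r x y -> `|x| <= r -> `|y| <= r -> 0 <= F (x, y)) -> 0 <= bd r F.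
Proof.
move=> r0 cF F0; apply: Rintegral_ge0 => s; rewrite /= in_itv/= -ler_norml => sr.
have rr : `|r| = r by rewrite gtr0_norm.
by rewrite !addr_ge0// F0// /outside ?normrN rr ?lexx ?orbT.
Qed.

(** [F] may have any sign inside the small square: the derivative of the integral in the half-side
    sees only the boundaries of the intermediate squares. *)
Lemma int2_outside_mono r s F : 0 < r -> r <= s -> continuous F ->
  (forall x y, outside r x y -> `|x| <= s -> `|y| <= s -> 0 <= F (x, y)) ->
  int2 r r F <= int2 s s F.
Proof.
move=> r0 rs cF F0.
apply: (derive_nondecreasing (fun r => int2 r r F) (fun t => bd t F)) => // t /andP[rt ts].
  by apply: is_derive_int2_diag => //; exact: lt_le_trans rt.
apply: bd_ge0 => //; first exact: lt_le_trans rt.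
move=> x y oxy xt yt; apply: F0; try exact: le_trans ts.
by case/orP: oxy => h; apply/orP; [left|right]; exact: le_trans h.
Qed.

Lemma int2_ge_cst p q F k : 0 <= p -> 0 <= q -> continuous F ->
  (forall x y, `|x| <= p -> `|y| <= q -> k <= F (x, y)) -> k * (4 * p * q) <= int2 p q F.
Proof.
move=> p0 q0 cF kF; rewrite -int2_cst//; apply: int2_le => //; first exact: cont_cst.
by move=> x y; rewrite -!ler_norml; exact: kF.
Qed.

Lemma int2_le_cst p q F k : 0 <= p -> 0 <= q -> continuous F ->
  (forall x y, `|x| <= p -> `|y| <= q -> F (x, y) <= k) -> int2 p q F <= k * (4 * p * q).
Proof.
move=> p0 q0 cF kF; rewrite -int2_cst//; apply: int2_le => //; first exact: cont_cst.
by move=> x y; rewrite -!ler_norml; exact: kF.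
Qed.

Lemma int2_ge0 p q F : 0 <= p -> 0 <= q -> continuous F ->
  (forall x y, `|x| <= p -> `|y| <= q -> 0 <= F (x, y)) -> 0 <= int2 p q F.
Proof. by move=> p0 q0 cF F0; have := int2_ge_cst p q F 0 p0 q0 cF F0; rewrite mul0r. Qed.

(** Serves pointwise inequalities that hold only far out: the central square enters through a crude
    lower bound and costs a constant independent of [s]. *)
Lemma int2_ge_outside r s F k : 0 < r -> r <= s -> continuous F ->
  (forall x y, outside r x y -> `|x| <= s -> `|y| <= s -> 0 <= F (x, y)) ->
  (forall x y, `|x| <= r -> `|y| <= r -> k <= F (x, y)) ->
  k * (4 * r * r) <= int2 s s F.
Proof.
move=> r0 rs cF F0 kF; apply: (@le_trans _ _ (int2 r r F)).
  by apply: int2_ge_cst => //; exact: ltW.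
exact: int2_outside_mono.
Qed.

Lemma int2_divergence r (G1 G2 H1 H2 : R * R -> R) : 0 <= r -> continuous H1 -> continuous H2 ->
  pd1 G1 H1 -> pd2 G2 H2 ->
  (forall y, G1 (r, y) = 0 /\ G1 (- r, y) = 0) -> (forall x, G2 (x, r) = 0 /\ G2 (x, - r) = 0) ->
  int2 r r (fun z => H1 z + H2 z) = 0.
Proof.
move=> r0 c1 c2 d1 d2 G1r G2r.
rewrite int2D// (int2_pd1 r r G1)// (int2_pd2 r r G2)//.
have zero (g : R -> R) : (forall s, g s = 0) -> int1 (- r) r g = 0.
  by move=> g0; rewrite (eq_int1 _ _ _ (fun=> 0)) ?int1_cst ?mul0r//; lra.
rewrite !zero ?addr0//.
- by move=> x; case: (G2r x) => -> ->; rewrite subrr.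
- by move=> y; case: (G1r y) => -> ->; rewrite subrr.
Qed.

Lemma bounded_of_outside r F k : continuous F ->
  (forall x y, outside r x y -> `|F (x, y)| <= k) -> exists M, forall z, `|F z| <= M.
Proof.
move=> cF Fk; have [M FM] := box_bounded r r F cF.
exists (Num.max k M) => -[x y]; rewrite le_max.
have [oxy|noxy] := boolP (outside r x y); first by rewrite Fk.
rewrite /outside negb_or -!ltNge in noxy; have /andP[xr yr] := noxy.
by rewrite FM ?orbT// -ler_norml ltW.
Qed.

Lemma square_bounded r F : continuous F -> exists2 M, 0 <= M &
  forall x y, `|x| <= r -> `|y| <= r -> `|F (x, y)| <= M.
Proof.
move=> cF; have [M FM] := box_bounded r r F cF.
exists `|M|; rewrite ?normr_ge0// => x y xr yr.
by rewrite (le_trans (FM x y _ _)) ?ler_norm// -ler_norml.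
Qed.

End IntegralHelpers.

(** * Test identities for the density and the current *)

Section Energy.
Context {R : realType}.
Variables f f1 f2 f11 f22 j1 j2 p q q1 J : R * R -> R.
Hypothesis cs : current_system f f1 f2 f11 f22 j1 j2 p q q1 J.

Definition density_energy z := (f11 z + f22 z) ^+ 2 + (f1 z ^+ 2 + f2 z ^+ 2).
Definition current_energy z := p z ^+ 2 + q z ^+ 2.

Lemma small_outside : exists2 r0, 1 <= r0 & forall x y (z := (x, y)), outside r0 x y ->
  [/\ `|f z| <= 1 / 100, j1 z ^+ 2 + j2 z ^+ 2 <= 10000^-1, f1 z ^+ 2 + f2 z ^+ 2 <= 10000^-1 &
      2 * (1 - f z) * J z = f2 z * j1 z - f1 z * j2 z].
Proof.
have [r r0 Hr] := cs_small _ _ _ _ _ _ _ _ _ _ _ cs (1 / 100) ltac:(lra).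
exists (Num.max 1 r); first by rewrite le_max lexx.
move=> x y z oxy.
have /Hr : outside r x y.
  by case/orP: oxy => h; apply/orP; [left|right]; move: h; rewrite ge_max => /andP[].
rewrite (_ : (1 / 100) ^+ 2 = 10000^-1); last by field.
by move=> [? ? ?]; split=> //; exact: (cs_J _ _ _ _ _ _ _ _ _ _ _ cs).
Qed.

(* Divergence of t^2 (f (1 - f)^2 - |j|^2) grad f, and of t^2 (j1 q, - j1 (p + 2 J)). *)
Definition density_div1 (t t1 : R * R -> R) z :=
  2 * t z * t1 z * ((f z * (1 - f z) ^+ 2 - (j1 z ^+ 2 + j2 z ^+ 2)) * f1 z) +
  t z ^+ 2 * (((1 - f z) * (1 - 3 * f z) * f1 z - 2 * (j2 z * (p z + 2 * J z) - j1 z * q z)) * f1 z +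
    (f z * (1 - f z) ^+ 2 - (j1 z ^+ 2 + j2 z ^+ 2)) * f11 z).
Definition density_div2 (t t2 : R * R -> R) z :=
  2 * t z * t2 z * ((f z * (1 - f z) ^+ 2 - (j1 z ^+ 2 + j2 z ^+ 2)) * f2 z) +
  t z ^+ 2 * (((1 - f z) * (1 - 3 * f z) * f2 z - 2 * (j1 z * p z + j2 z * q z)) * f2 z +
    (f z * (1 - f z) ^+ 2 - (j1 z ^+ 2 + j2 z ^+ 2)) * f22 z).
Definition current_div1 (t t1 : R * R -> R) z :=
  2 * t z * t1 z * (j1 z * q z) + t z ^+ 2 * (- q z * q z + j1 z * q1 z).
Definition current_div2 (t t2 : R * R -> R) z :=
  - (2 * t z * t2 z * (j1 z * (p z + 2 * J z)) + t z ^+ 2 * (p z * (p z + 2 * J z) + j1 z * q1 z)).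

Lemma int2_density_div r t t1 t2 : 0 <= r -> continuous t -> continuous t1 -> continuous t2 ->
  pd1 t t1 -> pd2 t t2 ->
  (forall y, t (r, y) = 0 /\ t (- r, y) = 0) -> (forall x, t (x, r) = 0 /\ t (x, - r) = 0) ->
  int2 r r (fun z => density_div1 t t1 z + density_div2 t t2 z) = 0.
Proof.
move=> r0 ct ct1 ct2 dt1 dt2 tr1 tr2.
case: cs => [[? ? ? ? ?] [? ? ? ? _] ? [? ?] [? ?] [dj1 ?] [dj2 ?] _ _ _ _].
pose nq z := - q z; pose pJ z := p z + 2 * J z.
have djq : pd1 j1 nq := dj1; have djp : pd1 j2 pJ := dj2.
apply: (@int2_divergence _ r (fun z => t z ^+ 2 * ((f z * (1 - f z) ^+ 2 - (j1 z ^+ 2 + j2 z ^+ 2)) * f1 z))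
  (fun z => t z ^+ 2 * ((f z * (1 - f z) ^+ 2 - (j1 z ^+ 2 + j2 z ^+ 2)) * f2 z))) => //.
- by rewrite /density_div1; cont_rules.
- by rewrite /density_div2; cont_rules.
- by move=> x y; rewrite /density_div1; derive_rules; rewrite /nq /pJ; ring.
- by move=> x y; rewrite /density_div2; derive_rules; ring.
- by move=> y; case: (tr1 y) => -> ->; rewrite !expr0n !mul0r.
- by move=> x; case: (tr2 x) => -> ->; rewrite !expr0n !mul0r.
Qed.

Lemma int2_current_div r t t1 t2 : 0 <= r -> continuous t -> continuous t1 -> continuous t2 ->
  pd1 t t1 -> pd2 t t2 ->
  (forall y, t (r, y) = 0 /\ t (- r, y) = 0) -> (forall x, t (x, r) = 0 /\ t (x, - r) = 0) ->
  int2 r r (fun z => current_div1 t t1 z + current_div2 t t2 z) = 0.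
Proof.
move=> r0 ct ct1 ct2 dt1 dt2 tr1 tr2.
case: cs => [[? ? ? ? ?] [? ? ? ? ?] ? [? ?] [? ?] [dj1 ?] [dj2 ?] [? dq2] _ _ _].
pose nq z := - q z; pose pJ z := p z + 2 * J z.
have djq : pd1 j1 nq := dj1; have dqJ : pd2 pJ q1 := dq2.
apply: (@int2_divergence _ r (fun z => t z ^+ 2 * (j1 z * q z))
  (fun z => - (t z ^+ 2 * (j1 z * pJ z)))) => //.
- by rewrite /current_div1; cont_rules.
- by rewrite /current_div2; cont_rules.
- by move=> x y; rewrite /current_div1; derive_rules; rewrite /nq; ring.
- by move=> x y; rewrite /current_div2; derive_rules; rewrite /pJ; ring.
- by move=> y; case: (tr1 y) => -> ->; rewrite !expr0n !mul0r.
- by move=> x; case: (tr2 x) => -> ->; rewrite !expr0n !mul0r oppr0.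
Qed.

End Energy.

(** Continuously differentiable and zero on the lines through the sides of the square, so that the
    divergence of a field with factor t^2 integrates to 0. *)
Definition test_function {R : realType} r (t t1 t2 : R * R -> R) :=
  [/\ continuous t, continuous t1, continuous t2, pd1 t t1 & pd2 t t2] /\
  ((forall y, t (r, y) = 0 /\ t (- r, y) = 0) /\ (forall x, t (x, r) = 0 /\ t (x, - r) = 0)).

(** Imposed only on a central square, where the pointwise inequalities may fail: the error terms of
    the estimates depend on the test function there through [A] alone. *)
Definition bounded_test {R : realType} r A (t t1 t2 : R * R -> R) :=
  forall x y (z := (x, y)), `|x| <= r -> `|y| <= r ->
    [/\ `|t z| <= A, `|t1 z| <= A & `|t2 z| <= A].

Lemma quadratic_lower_bound {R : realType} (A M U V1 V2 t t1 t2 : R) :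
  `|t| <= A -> `|t1| <= A -> `|t2| <= A -> `|U| <= M -> `|V1| <= M -> `|V2| <= M ->
  - (5 * M * A ^+ 2) <= t ^+ 2 * U + 2 * t * t1 * V1 + 2 * t * t2 * V2.
Proof.
move=> tA t1A t2A UM V1M V2M.
have b (s1 s2 W : R) : `|s1| <= A -> `|s2| <= A -> `|W| <= M -> `|s1 * s2 * W| <= M * A ^+ 2.
  move=> h1 h2 h3; rewrite !normrM mulrC ler_pM// ?mulr_ge0//.
  by rewrite expr2 ler_pM.
have := b t t U tA tA UM; have := b t t1 V1 tA t1A V1M; have := b t t2 V2 tA t2A V2M.
rewrite !ler_norml -expr2; clear; lra.
Qed.

(** * Cut-off estimates for both energies *)

Section Energy.
Context {R : realType}.
Variables f f1 f2 f11 f22 j1 j2 p q q1 J : R * R -> R.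
Hypothesis cs : current_system f f1 f2 f11 f22 j1 j2 p q q1 J.
Variable r0 : R.
Hypothesis r0_ge1 : 1 <= r0.
Hypothesis small : forall x y (z := (x, y)), outside r0 x y ->
  [/\ `|f z| <= 1 / 100, j1 z ^+ 2 + j2 z ^+ 2 <= 10000^-1, f1 z ^+ 2 + f2 z ^+ 2 <= 10000^-1 &
      2 * (1 - f z) * J z = f2 z * j1 z - f1 z * j2 z].
Let X2 z := f1 z ^+ 2 + f2 z ^+ 2.
Let E := density_energy f1 f2 f11 f22.
Let S := current_energy p q.

(** The divergence integrates to 0, so the pointwise inequality integrates to a bound on [E];
    192/10000 and 32 are 8 times 24/10000 and 4. *)
Lemma density_estimate : exists2 C, 0 <= C & forall r A t t1 t2, r0 <= r ->
  test_function r t t1 t2 -> bounded_test r0 A t t1 t2 ->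
  int2 r r (fun z => t z ^+ 2 * E z) <= 192 / 10000 * int2 r r (fun z => t z ^+ 2 * S z) +
    32 * int2 r r (fun z => (t1 z ^+ 2 + t2 z ^+ 2) * X2 z) + C * A ^+ 2.
Proof.
case: (cs) => [[cf cf1 cf2 cf11 cf22] [cj1 cj2 cp cq _] cJ _ _ _ _ _ H_eq _ _].
pose H z := f z * (1 - f z) ^+ 2 - (j1 z ^+ 2 + j2 z ^+ 2).
pose U1 z := ((1 - f z) * (1 - 3 * f z) * f1 z - 2 * (j2 z * (p z + 2 * J z) - j1 z * q z)) * f1 z + H z * f11 z.
pose U2 z := ((1 - f z) * (1 - 3 * f z) * f2 z - 2 * (j1 z * p z + j2 z * q z)) * f2 z + H z * f22 z.
(* The coefficient of [t ^+ 2] when the inequality is read as a quadratic form in t and its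
   derivatives. On the central square only the boundedness of such coefficients is used. *)
pose U z := U1 z + U2 z - 8^-1 * E z.
have cH : continuous H by rewrite /H; cont_rules.
have cE : continuous E by rewrite /E /density_energy; cont_rules.
have cS : continuous S by rewrite /S /current_energy; cont_rules.
have cU : continuous U by rewrite /U /U1 /U2; cont_rules.
have cX : continuous X2 by rewrite /X2; cont_rules.
have cV1 : continuous (fun z => H z * f1 z) by cont_rules.
have cV2 : continuous (fun z => H z * f2 z) by cont_rules.
have r00 : 0 < r0 by exact: lt_le_trans r0_ge1.
have [M1 M10 HM1] := square_bounded r0 U cU.
have [M2 M20 HM2] := square_bounded r0 _ cV1.
have [M3 M30 HM3] := square_bounded r0 _ cV2.
pose M := M1 + M2 + M3.
have M0 : 0 <= M by rewrite !addr_ge0.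
exists (8 * (5 * M * (4 * r0 * r0))); first by rewrite !mulr_ge0// ?(ltW r00).
move=> r A t t1 t2 r0r [[ct ct1 ct2 dt1 dt2] [tr1 tr2]] tA.
have rr0 : 0 <= r by exact/ltW/(lt_le_trans r00).
pose dv z := density_div1 f f1 f11 j1 j2 p q J t t1 z + density_div2 f f2 f22 j1 j2 p q t t2 z.
have cdv : continuous dv by rewrite /dv /density_div1 /density_div2; cont_rules.
have dv0 : int2 r r dv = 0 by exact: (int2_density_div _ _ _ _ _ _ _ _ _ _ _ cs).
pose Phi z := dv z + (24 / 10000 * (t z ^+ 2 * S z) +
  (4 * ((t1 z ^+ 2 + t2 z ^+ 2) * X2 z) + - 8^-1 * (t z ^+ 2 * E z))).
have cPhi : continuous Phi by rewrite /Phi; cont_rules.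
have X0 z : 0 <= X2 z by rewrite addr_ge0// sqr_ge0.
have S0 z : 0 <= S z by rewrite addr_ge0// sqr_ge0.
have cst4 : 0 <= 4 :> R := ler0n R 4.
have cst0 : 0 <= 24 / 10000 :> R := divr_ge0 (ler0n R _) (ler0n R _).
have : - (5 * M * A ^+ 2) * (4 * r0 * r0) <= int2 r r Phi.
  apply: int2_ge_outside => //.
  - move=> x y oxy _ _; have [s1 s2 s3 s4] := small x y oxy.
    have := density_inequality _ _ _ (f11 (x, y) + f22 (x, y)) _ _ (p (x, y)) (q (x, y)) _
      (t (x, y)) (t1 (x, y)) (t2 (x, y)) s1 s2 s3 s4.
    rewrite -H_eq -subr_ge0; congr (0 <= _).
    rewrite /Phi /dv /density_div1 /density_div2 /E /S /density_energy /current_energy /X2.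
    by move: (8^-1) => c; ring.
  - move=> x y xr yr; have [t_A t1_A t2_A] := tA x y xr yr.
    have le1 := HM1 x y xr yr; have le2 := HM2 x y xr yr; have le3 := HM3 x y xr yr.
    have := quadratic_lower_bound A M _ _ _ _ _ _ t_A t1_A t2_A
      (le_trans le1 _) (le_trans le2 _) (le_trans le3 _).
    rewrite /M => /(_ _ _ _) h; apply: (le_trans (h _ _ _)).
    + by rewrite -addrA lerDl addr_ge0.
    + by rewrite addrAC lerDr addr_ge0.
    + by rewrite lerDr addr_ge0.
    rewrite -subr_ge0 (_ : _ - _ = 24 / 10000 * (t (x, y) ^+ 2 * S (x, y)) +
       4 * ((t1 (x, y) ^+ 2 + t2 (x, y) ^+ 2) * X2 (x, y))).
      exact: (addr_ge0 (mulr_ge0 cst0 (mulr_ge0 (sqr_ge0 _) (S0 _)))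
        (mulr_ge0 cst4 (mulr_ge0 (addr_ge0 (sqr_ge0 _) (sqr_ge0 _)) (X0 _)))).
    rewrite /Phi /dv /density_div1 /density_div2 /U /U1 /U2 /H.
    by move: (8^-1) => c; ring.
rewrite /Phi; clear Phi cPhi; clearbody dv.
rewrite int2D//; try by cont_rules.
rewrite int2D//; try by cont_rules.
rewrite int2D//; try by cont_rules.
rewrite !int2Zl//; try by cont_rules.
rewrite dv0.
move: (int2 _ _ _) (int2 _ _ _) (int2 _ _ _) => u v w; lra.
Qed.

Lemma current_estimate : exists2 C, 0 <= C & forall r A t t1 t2, r0 <= r ->
  test_function r t t1 t2 -> bounded_test r0 A t t1 t2 ->
  3 / 8 * int2 r r (fun z => t z ^+ 2 * S z) <= 1 / 1000 * int2 r r (fun z => t z ^+ 2 * X2 z) +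
    4 * int2 r r (fun z => (t1 z ^+ 2 + t2 z ^+ 2) * j1 z ^+ 2) + C * A ^+ 2.
Proof.
case: (cs) => [[cf cf1 cf2 cf11 cf22] [cj1 cj2 cp cq cq1] cJ _ _ _ _ _ _ _ _].
pose U z := S z + 2 * J z * p z - 3 / 8 * S z.
pose V1 z := - (j1 z * q z).
pose V2 z := j1 z * (p z + 2 * J z).
have cS : continuous S by rewrite /S /current_energy; cont_rules.
have cU : continuous U by rewrite /U; cont_rules.
have cX : continuous X2 by rewrite /X2; cont_rules.
have cV1 : continuous V1 by rewrite /V1; cont_rules.
have cV2 : continuous V2 by rewrite /V2; cont_rules.
have r00 : 0 < r0 by exact: lt_le_trans r0_ge1.
have [M1 M10 HM1] := square_bounded r0 U cU.
have [M2 M20 HM2] := square_bounded r0 _ cV1.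
have [M3 M30 HM3] := square_bounded r0 _ cV2.
pose M := M1 + M2 + M3.
have M0 : 0 <= M by rewrite !addr_ge0.
exists (5 * M * (4 * r0 * r0)); first by rewrite !mulr_ge0// ?(ltW r00).
move=> r A t t1 t2 r0r [[ct ct1 ct2 dt1 dt2] [tr1 tr2]] tA.
have rr0 : 0 <= r by exact/ltW/(lt_le_trans r00).
pose dv z := current_div1 j1 q q1 t t1 z + current_div2 j1 p q1 J t t2 z.
have cdv : continuous dv by rewrite /dv /current_div1 /current_div2; cont_rules.
have dv0 : int2 r r dv = 0 by exact: (int2_current_div _ _ _ _ _ _ _ _ _ _ _ cs).
pose Phi z := -1 * dv z + (1 / 1000 * (t z ^+ 2 * X2 z) +
  (4 * ((t1 z ^+ 2 + t2 z ^+ 2) * j1 z ^+ 2) + - (3 / 8) * (t z ^+ 2 * S z))).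
have cPhi : continuous Phi by rewrite /Phi; cont_rules.
have X0 z : 0 <= X2 z by rewrite addr_ge0// sqr_ge0.
have S0 z : 0 <= S z by rewrite addr_ge0// sqr_ge0.
have cst4 : 0 <= 4 :> R := ler0n R 4.
have cst0 : 0 <= 1 / 1000 :> R := divr_ge0 ler01 (ler0n R _).
have : - (5 * M * A ^+ 2) * (4 * r0 * r0) <= int2 r r Phi.
  apply: int2_ge_outside => //.
  - move=> x y oxy _ _; have [s1 s2 s3 s4] := small x y oxy.
    have := current_inequality _ _ _ _ _ (p (x, y)) (q (x, y)) _
      (t (x, y)) (t1 (x, y)) (t2 (x, y)) s1 s2 s3 s4.
    rewrite -subr_ge0; congr (0 <= _).
    rewrite /Phi /dv /current_div1 /current_div2 /S /current_energy /X2.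
    by ring.
  - move=> x y xr yr; have [t_A t1_A t2_A] := tA x y xr yr.
    have le1 := HM1 x y xr yr; have le2 := HM2 x y xr yr; have le3 := HM3 x y xr yr.
    have := quadratic_lower_bound A M _ _ _ _ _ _ t_A t1_A t2_A
      (le_trans le1 _) (le_trans le2 _) (le_trans le3 _).
    rewrite /M => /(_ _ _ _) h; apply: (le_trans (h _ _ _)).
    + by rewrite -addrA lerDl addr_ge0.
    + by rewrite addrAC lerDr addr_ge0.
    + by rewrite lerDr addr_ge0.
    rewrite -subr_ge0 (_ : _ - _ = 1 / 1000 * (t (x, y) ^+ 2 * X2 (x, y)) +
       4 * ((t1 (x, y) ^+ 2 + t2 (x, y) ^+ 2) * j1 (x, y) ^+ 2)).
      exact: (addr_ge0 (mulr_ge0 cst0 (mulr_ge0 (sqr_ge0 _) (X0 _)))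
        (mulr_ge0 cst4 (mulr_ge0 (addr_ge0 (sqr_ge0 _) (sqr_ge0 _)) (sqr_ge0 _)))).
    rewrite /Phi /dv /current_div1 /current_div2 /U /V1 /V2 /S /current_energy.
    by ring.
rewrite /Phi; clear Phi cPhi; clearbody dv.
rewrite int2D//; try by cont_rules.
rewrite int2D//; try by cont_rules.
rewrite int2D//; try by cont_rules.
rewrite !int2Zl//; try by cont_rules.
rewrite dv0.
move: (int2 _ _ _) (int2 _ _ _) (int2 _ _ _) => u v w; lra.
Qed.

End Energy.

(** * Product cut-offs *)

Section ProductTest.
Context {R : realType}.

Lemma continuous_comp_fst (g : R -> R) : continuous g -> continuous (fun z : R * R => g z.1).
Proof. by move=> cg z; exact: (continuous_comp (cont_fst z) (cg z.1)). Qed.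

Lemma continuous_comp_snd (g : R -> R) : continuous g -> continuous (fun z : R * R => g z.2).
Proof. by move=> cg z; exact: (continuous_comp (cont_snd z) (cg z.2)). Qed.

Lemma product_test r (g g1 h h1 : R -> R) : continuous g1 -> continuous h1 ->
  (forall s : R, is_derive s (1 : R) g (g1 s)) -> (forall s : R, is_derive s (1 : R) h (h1 s)) ->
  g r = 0 /\ g (- r) = 0 -> h r = 0 /\ h (- r) = 0 ->
  test_function r (fun z => g z.1 * h z.2) (fun z => g1 z.1 * h z.2) (fun z => g z.1 * h1 z.2).
Proof.
move=> cg1 ch1 dg dh [gr grN] [hr hrN].
have cg := is_derive_continuous _ _ dg; have ch := is_derive_continuous _ _ dh.
have ? := continuous_comp_fst g cg; have ? := continuous_comp_snd h ch.
have ? := continuous_comp_fst g1 cg1; have ? := continuous_comp_snd h1 ch1.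
split; first split; try by cont_rules.
- by move=> x y /=; apply: der_eq (der_mul _ _ _ _ _ (dg x) (der_cst _ _)) _; ring.
- by move=> x y /=; apply: der_eq (der_mul _ _ _ _ _ (der_cst _ _) (dh y)) _; ring.
- by split=> s /=; rewrite ?gr ?grN ?hr ?hrN ?mul0r ?mulr0.
Qed.

(** A polynomial is enough: tests have to vanish on the sides of the square, not in a neighbourhood
    of them. *)
Definition chi (r s : R) := 1 - s ^+ 2 * (r ^+ 2)^-1.
Definition chi1 (r s : R) := s * - 2 * (r ^+ 2)^-1.

Lemma is_derive_chi r s : is_derive s (1 : R) (chi r) (chi1 r s).
Proof. by rewrite /chi /chi1; derive_rules; ring. Qed.

Lemma continuous_chi r : continuous (chi r).
Proof. exact: (is_derive_continuous _ _ (is_derive_chi r)). Qed.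

Lemma continuous_chi1 r : continuous (chi1 r).
Proof. by rewrite /chi1; cont_rules. Qed.

Lemma chi_boundary r : 0 < r -> chi r r = 0 /\ chi r (- r) = 0.
Proof.
move=> r0; rewrite /chi sqrrN divff ?subrr//.
by rewrite expf_neq0// gt_eqF.
Qed.

Lemma chi_bounds r s : 0 < r -> `|s| <= r -> 0 <= chi r s <= 1.
Proof.
move=> r0 sr; have r20 : 0 < r ^+ 2 by rewrite exprn_gt0.
have s2 : s ^+ 2 <= r ^+ 2 by rewrite -(real_normK (num_real s)) lerXn2r ?nnegrE// ltW.
rewrite /chi subr_ge0 ler_pdivrMr// mul1r s2/= lerBlDr lerDl divr_ge0 ?sqr_ge0// ltW//.
Qed.

Lemma chi_half r s : 0 < r -> `|s| <= r / 2 -> 3 / 4 <= chi r s.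
Proof.
move=> r0 sr; have r20 : 0 < r ^+ 2 by rewrite exprn_gt0.
have s2 : s ^+ 2 <= r ^+ 2 / 4.
  rewrite (_ : r ^+ 2 / 4 = (r / 2) ^+ 2); last by field.
  by rewrite -(real_normK (num_real s)) lerXn2r ?nnegrE// divr_ge0// ltW.
have : s ^+ 2 * (r ^+ 2)^-1 <= 1 / 4 by rewrite ler_pdivrMr//; lra.
rewrite /chi; lra.
Qed.

Lemma chi1_bound r s : 0 < r -> `|s| <= r -> `|chi1 r s| <= 2 / r.
Proof.
move=> r0 sr; rewrite /chi1 !normrM normrN normr_nat normfV normrX (gtr0_norm r0).
rewrite ler_pdivrMr ?exprn_gt0// (_ : 2 / r * r ^+ 2 = r * 2); last by field; rewrite gt_eqF.
by rewrite ler_pM2r.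
Qed.

End ProductTest.

Lemma quarter_le_sqr {R : realType} : 1 / 4 <= (9 / 16) ^+ 2 :> R.
Proof. by rewrite expr2; lra. Qed.

(* Eliminates the two mutually coupled energies [e] and [a]. *)
Lemma energy_absorption {R : realType} (e a x n m C1 C2 K1 K2 u v w : R) :
  0 <= C1 -> 0 <= C2 -> 0 <= a -> 0 <= e -> x <= e -> n <= 32 * K1 -> m <= 32 * K2 ->
  e <= 192 / 10000 * a + 32 * n + C1 * 4 ->
  3 / 8 * a <= 1 / 1000 * x + 4 * m + C2 * 4 ->
  u <= v -> 1 / 4 * v <= w -> w <= e + a ->
  u <= 4 * (2 * (32 * (32 * K1) + C1 * 4) + 4 * (4 * (32 * K2) + C2 * 4)).
Proof. lra. Qed.

(** * Finite unweighted energy *)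

Section Stage1.
Context {R : realType}.
Variables f f1 f2 f11 f22 j1 j2 p q q1 J : R * R -> R.
Hypothesis cs : current_system f f1 f2 f11 f22 j1 j2 p q q1 J.
Let E := density_energy f1 f2 f11 f22.
Let S := current_energy p q.

(** The cut-off has squared gradient at most 8 / s^2 on a square of area 4 s^2, hence costs a
    constant once grad f and j are bounded. The two estimates feed into each other with small
    factors, so both energies can be absorbed. *)
Lemma finite_energy : exists C, forall r, 0 < r -> int2 r r (fun z => E z + S z) <= C.
Proof.
have [r0 r01 small] := small_outside _ _ _ _ _ _ _ _ _ _ _ cs.
have [C1 C10 HC1] := density_estimate _ _ _ _ _ _ _ _ _ _ _ cs r0 r01 small.
have [C2 C20 HC2] := current_estimate _ _ _ _ _ _ _ _ _ _ _ cs r0 r01 small.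
case: (cs) => [[cf cf1 cf2 cf11 cf22] [cj1 cj2 cp cq cq1] cJ _ _ _ _ _ _ _ _].
pose X2 z := f1 z ^+ 2 + f2 z ^+ 2.
have cX : continuous X2 by rewrite /X2; cont_rules.
have cE : continuous E by rewrite /E /density_energy; cont_rules.
have cS : continuous S by rewrite /S /current_energy; cont_rules.
have r00 : 0 < r0 by exact: lt_le_trans r01.
have [K1 HK1] : exists M, forall z, `|X2 z| <= M.
  apply: (bounded_of_outside r0 X2 10000^-1) => // x y /small[_ _ s _].
  by rewrite ger0_norm// addr_ge0// sqr_ge0.
have [K2 HK2] : exists M, forall z, `|j1 z ^+ 2| <= M.
  apply: (bounded_of_outside r0 (fun z => j1 z ^+ 2) 10000^-1); first by cont_rules.
  move=> x y /small[_ s _ _]; rewrite ger0_norm ?sqr_ge0//.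
  by apply: le_trans s; rewrite lerDl sqr_ge0.
have E0 z : 0 <= E z by rewrite /E /density_energy !addr_ge0// sqr_ge0.
have S0 z : 0 <= S z by rewrite /S /current_energy addr_ge0// sqr_ge0.
exists (4 * (2 * (32 * (32 * K1) + C1 * 4) + 4 * (4 * (32 * K2) + C2 * 4))) => r rpos.
(* Doubling puts the square of half-side [r] in the middle half of the cut-off, where t >= 9/16; the
   maximum with [r0] makes the estimates applicable. *)
pose s := 2 * Num.max r r0.
have rm : r <= Num.max r r0 by rewrite le_max lexx.
have r0m : r0 <= Num.max r r0 by rewrite le_max lexx orbT.
have s0 : 0 < s by rewrite mulr_gt0// lt_max rpos.
have s2 : s / 2 = Num.max r r0 by rewrite /s mulrC mulKf// pnatr_eq0.
have r0s : r0 <= s by rewrite /s (le_trans r0m)// ler_peMl ?ler1n// le_max ltW.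
have s1 : 1 <= s by exact: le_trans r0s.
pose t (z : R * R) := chi s z.1 * chi s z.2.
pose t1 (z : R * R) := chi1 s z.1 * chi s z.2.
pose t2 (z : R * R) := chi s z.1 * chi1 s z.2.
have tt : test_function s t t1 t2.
  exact: (product_test s _ _ _ _ (continuous_chi1 s) (continuous_chi1 s)
    (is_derive_chi s) (is_derive_chi s) (chi_boundary s s0) (chi_boundary s s0)).
have [[ct ct1 ct2 _ _] _] := tt.
have t_le x y : `|x| <= s -> `|y| <= s ->
    [/\ `|t (x, y)| <= 1, `|t1 (x, y)| <= 2 / s & `|t2 (x, y)| <= 2 / s].
  move=> xs ys.
  have /andP[? ?] := chi_bounds s x s0 xs; have /andP[? ?] := chi_bounds s y s0 ys.
  have n1 := chi1_bound s x s0 xs; have n2 := chi1_bound s y s0 ys.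
  have a1 : `|chi s x| <= 1 by rewrite ger0_norm.
  have a2 : `|chi s y| <= 1 by rewrite ger0_norm.
  split; rewrite /t /t1 /t2 /= normrM.
  - by rewrite -[leRHS]mulr1 ler_pM.
  - by rewrite -[leRHS]mulr1 ler_pM.
  - by rewrite -[leRHS]mul1r ler_pM.
have s2le : 2 / s <= 2 by rewrite ler_pdivrMr// ler_peMr.
have bt : bounded_test r0 2 t t1 t2.
  move=> x y z xr yr; have [h1 h2 h3] := t_le x y (le_trans xr r0s) (le_trans yr r0s).
  by split; [rewrite (le_trans h1)// ler1n|exact: le_trans s2le|exact: le_trans s2le].
have N_le x y : `|x| <= s -> `|y| <= s -> t1 (x, y) ^+ 2 + t2 (x, y) ^+ 2 <= 8 / s ^+ 2.
  move=> xs ys; have [_ h2 h3] := t_le x y xs ys.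
  have sq (a : R) : `|a| <= 2 / s -> a ^+ 2 <= 4 / s ^+ 2.
    move=> h; rewrite (_ : 4 / s ^+ 2 = (2 / s) ^+ 2); last by field; rewrite gt_eqF.
    by rewrite -(real_normK (num_real a)) lerXn2r ?nnegrE// divr_ge0// ltW.
  rewrite (_ : 8 / s ^+ 2 = 4 / s ^+ 2 + 4 / s ^+ 2); last by field; rewrite gt_eqF.
  by rewrite lerD// sq.
have N_int (F : R * R -> R) K : continuous F -> (forall z, 0 <= F z) -> (forall z, `|F z| <= K) ->
    int2 s s (fun z => (t1 z ^+ 2 + t2 z ^+ 2) * F z) <= 32 * K.
  move=> cF F0 FK.
  have -> : 32 * K = 8 / s ^+ 2 * K * (4 * s * s) by field; rewrite gt_eqF.
  apply: int2_le_cst; rewrite ?ltW//; first by cont_rules.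
  move=> x y xs ys; apply: ler_pM => //; first by rewrite addr_ge0// sqr_ge0.
    exact: N_le.
  by rewrite (le_trans (ler_norm _)).
have i1 := HC1 s 2 t t1 t2 r0s tt bt.
have i2 := HC2 s 2 t t1 t2 r0s tt bt.
have n1 := N_int X2 K1 cX (fun z => addr_ge0 (sqr_ge0 _) (sqr_ge0 _)) HK1.
have n2 : int2 s s (fun z => (t1 z ^+ 2 + t2 z ^+ 2) * j1 z ^+ 2) <= 32 * K2.
  by apply: N_int => //; [cont_rules|move=> z; exact: sqr_ge0].
have m1 : int2 s s (fun z => t z ^+ 2 * X2 z) <= int2 s s (fun z => t z ^+ 2 * E z).
  apply: int2_le; rewrite ?ltW//; try by cont_rules.
  by move=> x y _ _; rewrite ler_wpM2l ?sqr_ge0// /E /density_energy /X2 lerDr sqr_ge0.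
have a0 : 0 <= int2 s s (fun z => t z ^+ 2 * S z).
  by apply: int2_ge0; rewrite ?ltW//; [cont_rules|move=> *; rewrite mulr_ge0// sqr_ge0].
have e0 : 0 <= int2 s s (fun z => t z ^+ 2 * E z).
  by apply: int2_ge0; rewrite ?ltW//; [cont_rules|move=> *; rewrite mulr_ge0// sqr_ge0].
have sge0 : 0 <= s := ltW s0.
have cTE : continuous (fun z => t z ^+ 2 * E z) by cont_rules.
have cTS : continuous (fun z => t z ^+ 2 * S z) by cont_rules.
have cES : continuous (fun z => E z + S z) by cont_rules.
have cTES : continuous (fun z => t z ^+ 2 * (E z + S z)) by cont_rules.
have ES : int2 s s (fun z => t z ^+ 2 * (E z + S z)) =
    int2 s s (fun z => t z ^+ 2 * E z) + int2 s s (fun z => t z ^+ 2 * S z).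
  rewrite -(int2D s s _ _ sge0 cTE cTS).
  by apply: eq_int1 => x _; apply: eq_int1 => y _; rewrite mulrDr.
have F0 z : 0 <= E z + S z by rewrite addr_ge0.
have h1 : int2 r r (fun z => E z + S z) <= int2 (s / 2) (s / 2) (fun z => E z + S z).
  by apply: int2_outside_mono => //; rewrite s2.
have h2 : 1 / 4 * int2 (s / 2) (s / 2) (fun z => E z + S z) <=
    int2 (s / 2) (s / 2) (fun z => t z ^+ 2 * (E z + S z)).
  have sh : 0 <= s / 2 by rewrite divr_ge0// ltW.
  rewrite -(int2Zl (s / 2) (s / 2) (1 / 4) _ sh cES).
  apply: (int2_le _ _ _ _ sh) => //; first by cont_rules.
  move=> x y; rewrite -!ler_norml => xs ys; rewrite ler_wpM2r//.
  have c1 := chi_half s x s0 xs; have c2 := chi_half s y s0 ys.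
  have t_ge : 9 / 16 <= t (x, y).
    rewrite /t /= (_ : 9 / 16 = 3 / 4 * (3 / 4)); last by field.
    by rewrite ler_pM// divr_ge0.
  apply: (le_trans quarter_le_sqr).
  by rewrite lerXn2r ?nnegrE ?divr_ge0//; apply: le_trans t_ge; rewrite divr_ge0.
have h3 : int2 (s / 2) (s / 2) (fun z => t z ^+ 2 * (E z + S z)) <=
    int2 s s (fun z => t z ^+ 2 * (E z + S z)).
  apply: int2_outside_mono; [by rewrite divr_gt0|by rewrite ler_pdivrMr// ler_peMr// ler1n|exact: cTES|].
  by move=> *; rewrite mulr_ge0// sqr_ge0.
rewrite ES in h3.
have sq2 : 2 ^+ 2 = 4 :> R by rewrite expr2 -natrM.
rewrite sq2 in i1 i2.
exact: (energy_absorption _ _ _ _ _ _ _ _ _ _ _ _ C10 C20 a0 e0 m1 n1 n2 i1 i2 h1 h2 h3).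
Qed.

End Stage1.

(** * The loop bound *)

Section Loop.
Context {R : realType}.

(** Monotonicity of [g] minus a primitive of [h] replaces the integration of [dg], whose continuity
    would otherwise have to be checked. *)
Lemma int1_le_primitive (a b : R) (h g dg : R -> R) : a <= b -> continuous h ->
  (forall s, a <= s <= b -> is_derive s (1 : R) g (dg s)) ->
  (forall s, a <= s <= b -> h s <= dg s) -> int1 a b h <= g b - g a.
Proof.
move=> ab ch dg_g hdg; pose H s := int1 (a - 1) s h.
have dH s : a <= s <= b -> is_derive s (1 : R) H (h s).
  by move=> /andP[sa _]; apply: is_derive_int1 => //; rewrite (lt_le_trans _ sa)// ltrBlDr ltrDl.
have -> : int1 a b h = H b - H a by apply: int1_FTC => //; exact: continuous_itvcc.
have d s : a <= s <= b -> is_derive s (1 : R) (fun s => g s - H s) (dg s - h s).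
  by move=> sab; have := dg_g s sab; have := dH s sab => ? ?; exact: is_deriveB.
have nn t : a <= t <= b -> 0 <= dg t - h t by move=> /hdg; rewrite subr_ge0.
have : g a - H a <= g b - H b.
  exact: (derive_nondecreasing (fun s => g s - H s) (fun s => dg s - h s) a b ab d nn).
lra.
Qed.

(* [s / (r ^+ 2 - s ^+ 2 / 2)] solves a Riccati equation, which gives the Poincare inequality
   [int b ^+ 2 <= r ^+ 2 * int db ^+ 2] for [b] vanishing at both endpoints. *)
Lemma riccati (r s b db : R) (D := 2 * r ^+ 2 - s ^+ 2) : 0 < r -> `|s| <= r ->
  b ^+ 2 / r ^+ 2 <= db ^+ 2 + (2 * (2 * r ^+ 2 + s ^+ 2) / D ^+ 2 * b ^+ 2 + 2 * s / D * (2 * b * db)).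
Proof.
move=> r0 sr; have r20 : 0 < r ^+ 2 by rewrite exprn_gt0.
have s2 : s ^+ 2 <= r ^+ 2 by rewrite -(real_normK (num_real s)) lerXn2r ?nnegrE// ltW.
have D0 : 0 < D by rewrite /D; lra.
have Dle : D <= 2 * r ^+ 2 by rewrite /D; have := sqr_ge0 s; lra.
apply: (@le_trans _ _ (2 / D * b ^+ 2)).
  rewrite mulrC ler_wpM2r ?sqr_ge0// -(ler_pM2l D0) mulrCA divff ?gt_eqF// mulr1.
  by rewrite ler_pdivrMr.
rewrite -subr_ge0 (_ : _ - _ = (db + 2 * s / D * b) ^+ 2) ?sqr_ge0//.
by rewrite /D; field; rewrite gt_eqF.
Qed.

(** Each component is its chord plus a remainder vanishing at the ends. Young's inequality spends r
    on each of [db1 ^+ 2] (through the Riccati bound) and [db2 ^+ 2] for the product of [b1] and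
    [db2], and 2/3 r on each for the products with [s]: in all 5/3 r. What remains has an explicit
    primitive. *)
Lemma side_pointwise (r s v1 dv2 m1 k1 k2 b1 db1 db2 P : R) : 0 < r ->
  v1 = m1 + k1 * s + b1 -> dv2 = k2 + db2 -> b1 ^+ 2 / r ^+ 2 <= db1 ^+ 2 + P ->
  2 * (v1 * dv2) - 5 / 3 * r * ((k1 + db1) ^+ 2 + dv2 ^+ 2) <=
  2 * m1 * k2 + 2 * k1 * k2 * s + 2 * (m1 + k1 * s) * db2
  + 2 * k2 * (b1 + s * db1) - 2 * k1 * (s * db2) + r * P
  + 3 / (2 * r) * s ^+ 2 * (k1 ^+ 2 + k2 ^+ 2)
  - 5 / 3 * r * (k1 ^+ 2 + k2 ^+ 2 + 2 * k1 * db1 + 2 * k2 * db2).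
Proof.
move=> r0 -> -> HP.
have rn0 : r != 0 by rewrite gt_eqF.
have HP' : b1 ^+ 2 / r <= r * db1 ^+ 2 + r * P.
  have := ler_wpM2l (ltW r0) HP; rewrite mulrDr.
  by rewrite (_ : r * (b1 ^+ 2 / r ^+ 2) = b1 ^+ 2 / r)//; field.
have h1 : 2 * (b1 * db2) <= b1 ^+ 2 / r + r * db2 ^+ 2.
  rewrite -subr_ge0 (_ : _ - _ = r^-1 * (b1 - r * db2) ^+ 2).
    by rewrite mulr_ge0 ?invr_ge0 ?sqr_ge0// ltW.
  by field.
have h2 : 2 * (- (s * k2) * db1) <= 3 / (2 * r) * (s * k2) ^+ 2 + 2 / 3 * r * db1 ^+ 2.
  rewrite -subr_ge0 (_ : _ - _ = 3 / (2 * r) * (- (s * k2) - 2 / 3 * r * db1) ^+ 2).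
    by rewrite mulr_ge0 ?sqr_ge0// divr_ge0// mulr_ge0// ltW.
  by field.
have h3 : 2 * (s * k1 * db2) <= 3 / (2 * r) * (s * k1) ^+ 2 + 2 / 3 * r * db2 ^+ 2.
  rewrite -subr_ge0 (_ : _ - _ = 3 / (2 * r) * (s * k1 - 2 / 3 * r * db2) ^+ 2).
    by rewrite mulr_ge0 ?sqr_ge0// divr_ge0// mulr_ge0// ltW.
  by field.
have h4 := lerD (lerD HP' h1) (lerD h2 h3).
rewrite -subr_ge0; rewrite -subr_ge0 in h4.
rewrite (_ : _ - _ = r * db1 ^+ 2 + r * P + (b1 ^+ 2 / r + r * db2 ^+ 2) +
       (3 / (2 * r) * (s * k2) ^+ 2 + 2 / 3 * r * db1 ^+ 2 +
        (3 / (2 * r) * (s * k1) ^+ 2 + 2 / 3 * r * db2 ^+ 2)) -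
       (b1 ^+ 2 / r + 2 * (b1 * db2) + (2 * (- (s * k2) * db1) + 2 * (s * k1 * db2))))//.
by field.
Qed.

(** Only end values are kept on the right, so that the contributions of the four sides can be
    compared at the corners. *)
Lemma side_inequality (r : R) (v1 v2 dv1 dv2 : R -> R) : 0 < r ->
  continuous dv1 -> continuous dv2 ->
  (forall s : R, is_derive s (1 : R) v1 (dv1 s)) -> (forall s : R, is_derive s (1 : R) v2 (dv2 s)) ->
  int1 (- r) r (fun s => 2 * (v1 s * dv2 s) - 5 / 3 * r * (dv1 s ^+ 2 + dv2 s ^+ 2)) <=
  (v1 r + v1 (- r)) * (v2 r - v2 (- r)) - 2^-1 * ((v1 r - v1 (- r)) ^+ 2 + (v2 r - v2 (- r)) ^+ 2).
Proof.
move=> r0 c1 c2 d1 d2.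
have rn0 : r != 0 by rewrite gt_eqF.
have cv1 := is_derive_continuous _ _ d1.
pose m1 := (v1 r + v1 (- r)) / 2; pose k1 := (v1 r - v1 (- r)) / (2 * r).
pose m2 := (v2 r + v2 (- r)) / 2; pose k2 := (v2 r - v2 (- r)) / (2 * r).
pose b1 s := v1 s - m1 - s * k1; pose b2 s := v2 s - m2 - s * k2.
pose db1 s := dv1 s - k1; pose db2 s := dv2 s - k2.
have b1r : b1 r = 0 by rewrite /b1 /m1 /k1; field.
have b1N : b1 (- r) = 0 by rewrite /b1 /m1 /k1; field.
have b2r : b2 r = 0 by rewrite /b2 /m2 /k2; field.
have b2N : b2 (- r) = 0 by rewrite /b2 /m2 /k2; field.
pose D s := 2 * r ^+ 2 - s ^+ 2.
pose c s := s * 2 * (D s)^-1.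
pose P s := 2 * (2 * r ^+ 2 + s ^+ 2) / D s ^+ 2 * b1 s ^+ 2 + 2 * s / D s * (2 * b1 s * db1 s).
(* A primitive of the pointwise bound. All terms with [b1] or [b2] vanish at the ends, so only the
   chord data survive. *)
pose g s := s * (2 * m1 * k2) + s ^+ 2 * (k1 * k2) + 2 * (m1 + s * k1) * b2 s
  + 2 * k2 * (s * b1 s) - 2 * k1 * (s * b2 s) + r * (c s * b1 s ^+ 2)
  + (2 * r)^-1 * (s * s ^+ 2) * (k1 ^+ 2 + k2 ^+ 2)
  - 5 / 3 * r * (s * (k1 ^+ 2 + k2 ^+ 2) + b1 s * (2 * k1) + b2 s * (2 * k2)).
pose dg s := 2 * m1 * k2 + 2 * k1 * k2 * s + 2 * (m1 + k1 * s) * db2 s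
  + 2 * k2 * (b1 s + s * db1 s) - 2 * k1 * (s * db2 s) + r * P s
  + 3 / (2 * r) * s ^+ 2 * (k1 ^+ 2 + k2 ^+ 2)
  - 5 / 3 * r * (k1 ^+ 2 + k2 ^+ 2 + 2 * k1 * db1 s + 2 * k2 * db2 s).
have -> : (v1 r + v1 (- r)) * (v2 r - v2 (- r)) = 2 * r * (2 * m1 * k2) by rewrite /m1 /k2; field.
(* 7/3 = 10/3 - 1, from the chord part of the 5/3 term and from the integral of 3 / (2 r) s^2; a
   coefficient 2 is enough for the claim. *)
have : 2 * r * (2 * m1 * k2) - 7 / 3 * r ^+ 2 * (k1 ^+ 2 + k2 ^+ 2) = g r - g (- r).
  by rewrite /g b1r b1N b2r b2N; field.
have -> : (v1 r - v1 (- r)) ^+ 2 + (v2 r - v2 (- r)) ^+ 2 = 4 * r ^+ 2 * (k1 ^+ 2 + k2 ^+ 2).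
  by rewrite /k1 /k2; field.
move=> gE; apply: (@le_trans _ _ (g r - g (- r))); last first.
  rewrite -gE lerD2l lerN2 mulrA; apply: ler_wpM2r; first by rewrite addr_ge0// sqr_ge0.
  rewrite mulrA; apply: ler_wpM2r; first exact: sqr_ge0.
  lra.
have D0 s : - r <= s <= r -> 0 < D s.
  move=> sr; rewrite /D.
  have s2 : s ^+ 2 <= r ^+ 2.
    by rewrite -(real_normK (num_real s)) lerXn2r ?nnegrE// ?ler_norml// ltW.
  have : 0 < r ^+ 2 by rewrite exprn_gt0.
  lra.
apply: (int1_le_primitive _ _ _ _ dg).
- by rewrite (le_trans _ (ltW r0))// oppr_le0 ltW.
- by cont_rules.
- move=> s /D0 Ds.
  have db1s : is_derive s (1 : R) b1 (db1 s).
    have := d1 s => ?; rewrite /b1 /db1; derive_rules; ring.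
  have db2s : is_derive s (1 : R) b2 (db2 s).
    have := d2 s => ?; rewrite /b2 /db2; derive_rules; ring.
  have dDs : is_derive s (1 : R) (fun s => (D s)^-1) (2 * s / D s ^+ 2).
    have dD : is_derive s (1 : R) D (- 2 * s) by rewrite /D; derive_rules; ring.
    have DN : D s != 0 by rewrite gt_eqF.
    by apply: der_eq (is_deriveV DN dD) _; rewrite /GRing.scale/=; field; exact: DN.
  have dcs : is_derive s (1 : R) c (2 * (2 * r ^+ 2 + s ^+ 2) / D s ^+ 2).
    apply: der_eq (der_mul (fun s => s * 2) _ _ _ _ (der_mul _ _ _ _ _ (der_id s) (der_cst 2 s)) dDs) _.
    by rewrite /D; field; rewrite gt_eqF// -/(D s).
  have DN : D s != 0 by rewrite gt_eqF.
  rewrite /g; clearbody b1 b2 db1 db2; derive_rules.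
  rewrite /dg /P /c; clearbody D; field.
  by rewrite DN rn0.
- move=> s srange.
  have sr : `|s| <= r by rewrite ler_norml.
  have := side_pointwise r s (v1 s) (dv2 s) m1 k1 k2 (b1 s) (db1 s) (db2 s) (P s) r0 _ _ (riccati r s _ _ r0 sr).
  rewrite (_ : k1 + db1 s = dv1 s); last by rewrite /db1; ring.
  by apply; rewrite /b1 /db2; ring.
Qed.

(* The four sides of the quadrilateral with corners A, B, D, C: by the parallelogram identity,
   half the sum of the squared sides dominates twice the oriented area. *)
Lemma corner_inequality (A1 A2 B1 B2 C1 C2 D1 D2 : R) :
  ((A1 + B1) * (A2 - B2) - 2^-1 * ((A1 - B1) ^+ 2 + (A2 - B2) ^+ 2)) +
  ((- C1 + - D1) * (C2 - D2) - 2^-1 * ((- C1 - - D1) ^+ 2 + (C2 - D2) ^+ 2)) +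
  (((- A1 + - C1) * (A2 - C2) - 2^-1 * ((- A1 - - C1) ^+ 2 + (A2 - C2) ^+ 2)) +
  ((B1 + D1) * (B2 - D2) - 2^-1 * ((B1 - D1) ^+ 2 + (B2 - D2) ^+ 2))) <= 0.
Proof.
rewrite -oppr_ge0 [leRHS](_ : _ = 2^-1 * (((A1 - D1) - (C2 - B2)) ^+ 2 + ((A2 - D2) + (C1 - B1)) ^+ 2
  + (A1 + D1 - B1 - C1) ^+ 2 + (A2 + D2 - B2 - C2) ^+ 2)); last by field.
by rewrite mulr_ge0 ?invr_ge0// !addr_ge0// sqr_ge0.
Qed.

End Loop.

(** * The boundary term of det (grad j) *)

Section CurrentLoop.
Context {R : realType}.
Variables f f1 f2 f11 f22 j1 j2 p q q1 J : R * R -> R.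
Hypothesis cs : current_system f f1 f2 f11 f22 j1 j2 p q q1 J.
Let S := current_energy p q.

(** The determinant of grad (j1, j2), written out with d_1 j1 = - q and d_1 j2 = p + 2 J. *)
Definition current_det z := - (current_energy p q z + 2 * J z * p z).
(* Bounds the squared tangential derivative of (j1, j2) on every side of a square. *)
Definition tangential z := 45 / 44 * current_energy p q z + 180 * J z ^+ 2.

(** For horizontal sides: (p + 2 J)^2 <= (1 + 1/44) p^2 + (1 + 44) (2 J)^2. *)
Lemma sum_sqr_tangential z : q z ^+ 2 + (p z + 2 * J z) ^+ 2 <= tangential z.
Proof.
rewrite -subr_ge0 (_ : _ - _ = 44^-1 * (p z - 88 * J z) ^+ 2 + 44^-1 * q z ^+ 2); last first.
  by rewrite /tangential /current_energy; field.
by rewrite addr_ge0// mulr_ge0 ?invr_ge0// sqr_ge0.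
Qed.

Lemma sqr_tangential z : p z ^+ 2 + q z ^+ 2 <= tangential z.
Proof.
rewrite -subr_ge0 (_ : _ - _ = 44^-1 * (p z ^+ 2 + q z ^+ 2) + 180 * J z ^+ 2); last first.
  by rewrite /tangential /current_energy; field.
have p44 : 0 <= 44^-1 :> R by rewrite invr_ge0 ler0n.
exact: (addr_ge0 (mulr_ge0 p44 (addr_ge0 (sqr_ge0 _) (sqr_ge0 _))) (mulr_ge0 (ler0n R 180) (sqr_ge0 _))).
Qed.

(** The determinant is the divergence of (j1 q, - j1 (p + 2 J)): second derivatives cancel, as [q1]
    is both d_1 q and d_2 (p + 2 J). *)
Lemma int2_current_det r : 0 < r -> int2 r r current_det = int1 (- r) r (fun s =>
  (j1 (r, s) * q (r, s) - j1 (- r, s) * q (- r, s)) +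
  (- (j1 (s, r) * (p (s, r) + 2 * J (s, r))) - - (j1 (s, - r) * (p (s, - r) + 2 * J (s, - r))))).
Proof.
move=> r0; case: cs => [_ [cj1 _ cp cq cq1] cJ _ _ [dj11 dj12] _ [dq1 dq2] _ _ _].
pose nq z := - q z; pose pJ z := p z + 2 * J z.
have ? : pd1 j1 nq := dj11; have ? : pd2 pJ q1 := dq2.
pose H1 z := - q z * q z + j1 z * q1 z; pose H2 z := - (p z * pJ z + j1 z * q1 z).
have cH1 : continuous H1 by rewrite /H1; cont_rules.
have cH2 : continuous H2 by rewrite /H2 /pJ; cont_rules.
have d1 : pd1 (fun z => j1 z * q z) H1 by move=> x y; rewrite /H1; derive_rules; rewrite /nq; ring.
have d2 : pd2 (fun z => - (j1 z * pJ z)) H2 by move=> x y; rewrite /H2; derive_rules; ring.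
have r0' := ltW r0.
have -> : int2 r r current_det = int2 r r (fun z => H1 z + H2 z).
  apply: eq_int1 => x _; apply: eq_int1 => y _.
  by rewrite /current_det /current_energy /H1 /H2 /pJ; ring.
rewrite (int2D r r _ _ r0' cH1 cH2) (int2_pd1 r r _ _ r0' r0' cH1 d1) (int2_pd2 r r _ _ r0' r0' cH2 d2).
rewrite -int1D//.
- have ? := continuous_slice1 j1 r cj1; have ? := continuous_slice1 q r cq.
  have ? := continuous_slice1 j1 (- r) cj1; have ? := continuous_slice1 q (- r) cq.
  by cont_rules.
- have ? := continuous_slice2 j1 r cj1; have ? := continuous_slice2 p r cp; have ? := continuous_slice2 J r cJ.
  have ? := continuous_slice2 j1 (- r) cj1; have ? := continuous_slice2 p (- r) cp.
  have ? := continuous_slice2 J (- r) cJ.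
  by rewrite /pJ; cont_rules.
Qed.

(** The boundary term is the integral of j1 dj2 around the square, the signed area enclosed by the
    image loop; [c] covers both orientations. Summing the side inequality leaves corner terms of
    total at most 0. Wirtinger's inequality on the loop of length 8 r would give 4 / pi in place of
    5/3, which is reached by elementary means and suffices. *)
Lemma loop_bound r c : 0 < r -> c ^+ 2 = 1 ->
  2 * c * int2 r r current_det <= 5 / 3 * r * bd r tangential.
Proof.
move=> r0 c2; rewrite int2_current_det//.
case: cs => [_ [cj1 cj2 cp cq cq1] cJ _ _ [dj11 dj12] [dj21 dj22] _ _ _ _].
pose nq z := - q z; pose pJ z := p z + 2 * J z.
have ? : pd1 j1 nq := dj11; have ? : pd1 j2 pJ := dj21.
have cpJ : continuous pJ by rewrite /pJ; cont_rules.
have ct : continuous tangential by rewrite /tangential /current_energy; cont_rules.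
have s1 (F : R * R -> R) x (cF : continuous F) := continuous_slice1 F x cF.
have s2 (F : R * R -> R) x (cF : continuous F) := continuous_slice2 F x cF.
have ? := s1 _ r cj1; have ? := s1 _ (- r) cj1; have ? := s2 _ r cj1; have ? := s2 _ (- r) cj1.
have ? := s1 _ r cq; have ? := s1 _ (- r) cq; have ? := s2 _ r cq; have ? := s2 _ (- r) cq.
have ? := s1 _ r cp; have ? := s1 _ (- r) cp.
have ? := s2 _ r cpJ; have ? := s2 _ (- r) cpJ.
have ? := s1 _ r ct; have ? := s1 _ (- r) ct; have ? := s2 _ r ct; have ? := s2 _ (- r) ct.
pose K (w dv1 dv2 : R -> R) s := 2 * (w s * dv2 s) - 5 / 3 * r * (dv1 s ^+ 2 + dv2 s ^+ 2).
(* The sign in front of [c * j1] records the direction in which a side is traversed as [s]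
   increases. *)
pose KR := K (fun s => c * j1 (r, s)) (fun s => c * p (r, s)) (fun s => q (r, s)).
pose KL := K (fun s => - (c * j1 (- r, s))) (fun s => - (c * p (- r, s))) (fun s => q (- r, s)).
pose KT := K (fun s => - (c * j1 (s, r))) (fun s => c * q (s, r)) (fun s => pJ (s, r)).
pose KB := K (fun s => c * j1 (s, - r)) (fun s => - (c * q (s, - r))) (fun s => pJ (s, - r)).
have cKR : continuous KR by rewrite /KR /K; cont_rules.
have cKL : continuous KL by rewrite /KL /K; cont_rules.
have cKT : continuous KT by rewrite /KT /K; cont_rules.
have cKB : continuous KB by rewrite /KB /K; cont_rules.
have dR1 s : is_derive s (1 : R) (fun s => c * j1 (r, s)) (c * p (r, s)) by derive_rules; ring.
have dR2 s : is_derive s (1 : R) (fun s => j2 (r, s)) (q (r, s)) by derive_rules.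
have cR1 : continuous (fun s => c * p (r, s)) by cont_rules.
have cR2 : continuous (fun s => q (r, s)) by cont_rules.
have hR := side_inequality r _ _ _ _ r0 cR1 cR2 dR1 dR2.
have dL1 s : is_derive s (1 : R) (fun s => - (c * j1 (- r, s))) (- (c * p (- r, s))) by derive_rules; ring.
have dL2 s : is_derive s (1 : R) (fun s => j2 (- r, s)) (q (- r, s)) by derive_rules.
have cL1 : continuous (fun s => - (c * p (- r, s))) by cont_rules.
have cL2 : continuous (fun s => q (- r, s)) by cont_rules.
have hL := side_inequality r _ _ _ _ r0 cL1 cL2 dL1 dL2.
have dT1 s : is_derive s (1 : R) (fun s => - (c * j1 (s, r))) (c * q (s, r)) by derive_rules; rewrite /nq; ring.
have dT2 s : is_derive s (1 : R) (fun s => j2 (s, r)) (pJ (s, r)) by derive_rules.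
have cT1 : continuous (fun s => c * q (s, r)) by cont_rules.
have cT2 : continuous (fun s => pJ (s, r)) by cont_rules.
have hT := side_inequality r _ _ _ _ r0 cT1 cT2 dT1 dT2.
have dB1 s : is_derive s (1 : R) (fun s => c * j1 (s, - r)) (- (c * q (s, - r))) by derive_rules; rewrite /nq; ring.
have dB2 s : is_derive s (1 : R) (fun s => j2 (s, - r)) (pJ (s, - r)) by derive_rules.
have cB1 : continuous (fun s => - (c * q (s, - r))) by cont_rules.
have cB2 : continuous (fun s => pJ (s, - r)) by cont_rules.
have hB := side_inequality r _ _ _ _ r0 cB1 cB2 dB1 dB2.
have cRL : continuous (fun s => KR s + KL s) by cont_rules.
have cTB : continuous (fun s => KT s + KB s) by cont_rules.
have tot : int1 (- r) r (fun s => (KR s + KL s) + (KT s + KB s)) <= 0.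
  rewrite (int1D _ _ _ _ cRL cTB) (int1D _ _ _ _ cKR cKL) (int1D _ _ _ _ cKT cKB).
  exact: (le_trans (lerD (lerD hR hL) (lerD hT hB)) (corner_inequality _ _ _ _ _ _ _ _)).
pose A s := (j1 (r, s) * q (r, s) - j1 (- r, s) * q (- r, s)) +
  (- (j1 (s, r) * pJ (s, r)) - - (j1 (s, - r) * pJ (s, - r))).
pose B s := (tangential (r, s) + tangential (- r, s)) + (tangential (s, r) + tangential (s, - r)).
have cA : continuous A by rewrite /A; cont_rules.
have cB : continuous B by rewrite /B; cont_rules.
have cA' : continuous (fun s => 2 * c * A s) by cont_rules.
have cB' : continuous (fun s => 5 / 3 * r * B s) by cont_rules.
rewrite -[X in _ * X <= _]/(int1 (- r) r A) -[bd _ _]/(int1 (- r) r B).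
rewrite -subr_le0 -(int1Zl (- r) r (2 * c) A cA) -(int1Zl (- r) r (5 / 3 * r) B cB).
rewrite -(int1B (- r) r _ _ cA' cB').
have cAB : continuous (fun s => 2 * c * A s - 5 / 3 * r * B s) by cont_rules.
have cK4 : continuous (fun s => (KR s + KL s) + (KT s + KB s)) by cont_rules.
apply: le_trans tot; apply: (int1_le _ _ _ _ cAB cK4).
move=> s _.
have t1 := sqr_tangential (r, s); have t2 := sqr_tangential (- r, s).
have t3 := sum_sqr_tangential (s, r); have t4 := sum_sqr_tangential (s, - r).
have r53 : 0 <= 5 / 3 * r by rewrite mulr_ge0 ?divr_ge0// ltW.
have := ler_wpM2l r53 (lerD (lerD t1 t2) (lerD t3 t4)).
rewrite /A /B /KR /KL /KT /KB /K /pJ !sqrrN !exprMn c2 !mul1r.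
move=> h; rewrite -subr_ge0; move: h; rewrite -subr_ge0; congr (0 <= _).
ring.
Qed.

End CurrentLoop.

(** * Weighted estimates *)

(** [l] is the root of the weight. The quadratic growth of its square and the bounded derivative
    keep the gradients of weighted cut-offs bounded; 11/20 in [wt_growth] is what the loop bound
    tolerates; boundedness makes the weighted integrals finite before absorption, and its bound
    enters no final constant. *)
Record weight {R : realType} (l l1 : R -> R) : Prop := Weight {
  wt_der : forall t : R, is_derive t (1 : R) l (l1 t);
  wt_cont : continuous l1;
  wt_ge1 : forall t, 1 <= l t;
  wt_le : forall t, l t ^+ 2 <= 1 + t ^+ 2;
  wt_der_le : forall t, l1 t ^+ 2 <= 1;
  wt_mono : forall x y, `|x| <= `|y| -> l x <= l y;
  wt_growth : forall t, 0 <= t -> 0 <= l1 t /\ t * l1 t <= 11 / 20 * l t;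
  wt_bounded : exists K, forall t, l t ^+ 2 <= K }.

(** * The truncated power weight *)

Section PowerWeight.
Context {R : realType}.
Variable eps : R.
Hypothesis eps01 : 0 < eps <= 1.

Definition wbase (t : R) := (1 + t ^+ 2) * (1 + eps * t ^+ 2)^-1.
(* The squared weight behaves like |t| ^ (11 / 10) up to |t| ~ eps ^ (- 1 / 2): its inverse is integrable
   on lines because 11 / 10 > 1, and the loop bound tolerates its growth because 5 / 3 * (11 / 20) < 1. *)
Definition wpow (t : R) := wbase t `^ (11 / 40).
(** The logarithmic derivative of [wbase]. *)
Definition wlog (t : R) := 2 * t * (1 - eps) / ((1 + eps * t ^+ 2) * (1 + t ^+ 2)).
Definition wpow1 (t : R) := 11 / 40 * wpow t * wlog t.

Let eps0 : 0 < eps. Proof. by case/andP: eps01. Qed.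
Let eps1 : eps <= 1. Proof. by case/andP: eps01. Qed.
Let num_gt0 (t : R) : 0 < 1 + t ^+ 2. Proof. by rewrite ltr_wpDr ?sqr_ge0. Qed.
Let den_gt0 (t : R) : 0 < 1 + eps * t ^+ 2.
Proof. by rewrite ltr_wpDr// mulr_ge0 ?sqr_ge0// ltW. Qed.

Lemma wbase_ge1 t : 1 <= wbase t.
Proof. by rewrite /wbase ler_pdivlMr// mul1r lerD2l ler_piMl// sqr_ge0. Qed.

Lemma wbase_le t : wbase t <= 1 + t ^+ 2.
Proof.
rewrite /wbase ler_pdivrMr//; apply: ler_peMr; first exact: ltW.
by rewrite lerDl mulr_ge0 ?sqr_ge0// ltW.
Qed.

Lemma wbase_le_inv t : wbase t <= eps^-1.
Proof.
rewrite /wbase ler_pdivrMr// mulrDr mulr1 mulrA mulVf ?gt_eqF// mul1r lerD2r.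
by rewrite invf_ge1.
Qed.

Lemma wbase_mono x y : `|x| <= `|y| -> wbase x <= wbase y.
Proof.
move=> xy; have x2 : x ^+ 2 <= y ^+ 2.
  by rewrite -(real_normK (num_real x)) -(real_normK (num_real y)) lerXn2r ?nnegrE.
rewrite /wbase ler_pdivrMr// mulrAC ler_pdivlMr//.
rewrite -subr_ge0 (_ : _ - _ = (1 - eps) * (y ^+ 2 - x ^+ 2)); last by ring.
by rewrite mulr_ge0// subr_ge0.
Qed.

Lemma is_derive_wbase t : is_derive t (1 : R) wbase (wbase t * wlog t).
Proof.
have dN : is_derive t (1 : R) (fun t => 1 + eps * t ^+ 2) (2 * eps * t) by derive_rules; ring.
have n0 : 1 + eps * t ^+ 2 != 0 by rewrite gt_eqF.
have dV := @is_deriveV R (fun t => 1 + eps * t ^+ 2) t _ 1 n0 dN.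
have dM : is_derive t (1 : R) (fun t => 1 + t ^+ 2) (2 * t) by derive_rules; ring.
apply: der_eq (der_mul _ _ _ _ _ dM dV) _.
rewrite /wbase /wlog /GRing.scale/=; field.
by rewrite n0 gt_eqF.
Qed.

Lemma wbase_gt0 t : 0 < wbase t. Proof. exact: lt_le_trans (wbase_ge1 t). Qed.

Lemma is_derive_wpow t : is_derive t (1 : R) wpow (wpow1 t).
Proof.
have d1 := is_derive1_powR (11 / 40) (wbase_gt0 t).
have d2 := is_derive_wbase t.
apply: der_eq (@is_derive1_comp R (fun x => x `^ (11 / 40)) wbase t _ _ d1 d2) _.
rewrite /wpow1 /wpow.
have := mulr_powRB1 (ltW (wbase_gt0 t)) (ltac:(lra) : 0 < 11 / 40 :> R).
by move=> <-; ring.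
Qed.

Lemma wpow_gt0 t : 0 < wpow t. Proof. by rewrite powR_gt0// wbase_gt0. Qed.

Lemma sqr_wpow t : wpow t ^+ 2 = wbase t `^ (11 / 20).
Proof.
by rewrite /wpow -powR_mulrn ?powR_ge0// -powRrM; congr (_ `^ _); field.
Qed.

Lemma sqr_wpow_le t : wpow t ^+ 2 <= wbase t.
Proof.
rewrite sqr_wpow -[leRHS]powRr1 ?(ltW (wbase_gt0 t))//.
by rewrite ler_powR ?wbase_ge1//; lra.
Qed.

Lemma wlog_bounds t : 0 <= t -> 0 <= wlog t /\ t * wlog t <= 2.
Proof.
move=> t0; have den : 0 < (1 + eps * t ^+ 2) * (1 + t ^+ 2) by rewrite mulr_gt0.
split; first by rewrite divr_ge0 ?(ltW den)// !mulr_ge0// subr_ge0.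
rewrite /wlog mulrA ler_pdivrMr// -subr_ge0.
rewrite (_ : _ - _ = 2 + 4 * eps * t ^+ 2 + 2 * eps * (t ^+ 2 * t ^+ 2)); last by ring.
by rewrite !addr_ge0// !mulr_ge0 ?sqr_ge0// ltW.
Qed.

Lemma sqr_wlog_le t : (1 + t ^+ 2) * wlog t ^+ 2 <= 4.
Proof.
have den : 0 < (1 + eps * t ^+ 2) ^+ 2 * (1 + t ^+ 2) by rewrite mulr_gt0// exprn_gt0.
rewrite (_ : _ * _ = 4 * ((1 - eps) ^+ 2 * t ^+ 2) / ((1 + eps * t ^+ 2) ^+ 2 * (1 + t ^+ 2))); last first.
  by rewrite /wlog; field; rewrite !gt_eqF.
rewrite ler_pdivrMr// ler_pM2l//; apply: ler_pM; rewrite ?sqr_ge0//; last by rewrite lerDr.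
have h : 1 - eps <= 1 + eps * t ^+ 2.
  rewrite lerD2l; apply: (@le_trans _ _ 0); first by rewrite oppr_le0 ltW.
  by rewrite mulr_ge0 ?sqr_ge0// ltW.
by rewrite lerXn2r ?nnegrE ?subr_ge0 ?(ltW (den_gt0 t)).
Qed.

Lemma weight_wpow : weight wpow wpow1.
Proof.
split.
- exact: is_derive_wpow.
- have c1 := is_derive_continuous _ _ is_derive_wpow.
  have c2 : continuous wlog.
    move=> t; rewrite /wlog; apply: cvgM.
      by apply: cvgM; [apply: cvgM; [exact: cvg_cst|exact: cvg_id]|exact: cvg_cst].
    apply: cvgV; first by rewrite mulf_neq0// gt_eqF.
    have c : continuous (fun t : R => (1 + eps * t ^+ 2) * (1 + t ^+ 2)) by cont_rules.
    exact: c.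
  by rewrite /wpow1; cont_rules.
- by move=> t; rewrite -(powRr0 (wbase t)) ler_powR ?wbase_ge1// divr_ge0.
- by move=> t; exact: le_trans (sqr_wpow_le t) (wbase_le t).
- move=> t; rewrite /wpow1 (_ : _ ^+ 2 = 121 / 1600 * (wpow t ^+ 2 * wlog t ^+ 2)); last by field.
  have : wpow t ^+ 2 * wlog t ^+ 2 <= 4.
    apply: le_trans (sqr_wlog_le t); rewrite ler_wpM2r ?sqr_ge0//.
    exact: le_trans (sqr_wpow_le t) (wbase_le t).
  lra.
- move=> x y xy; by rewrite /wpow ge0_ler_powR ?nnegrE ?(ltW (wbase_gt0 _))// ?wbase_mono// divr_ge0.
- move=> t t0; have [g0 g1] := wlog_bounds t t0.
  have p0 := wpow_gt0 t; split; first by rewrite /wpow1 mulr_ge0// mulr_ge0 ?(ltW p0)// divr_ge0.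
  rewrite /wpow1 (_ : t * _ = 11 / 40 * wpow t * (t * wlog t)); last by ring.
  rewrite (_ : 11 / 20 * wpow t = 11 / 40 * wpow t * 2); last by field.
  by rewrite ler_wpM2l// mulr_ge0 ?(ltW p0)// divr_ge0.
- by exists eps^-1 => t; exact: le_trans (sqr_wpow_le t) (wbase_le_inv t).
Qed.

(** Where eps t^2 <= 1 the denominator of [wbase] is at most 2, and 2^(-11/20) >= 1/2: up to a
    factor 2 the truncation is not felt inside the radius eps^(-1/2). *)
Lemma sqr_wpow_ge r t : eps * r ^+ 2 <= 1 -> `|t| <= r ->
  2^-1 * (1 + t ^+ 2) `^ (11 / 20) <= wpow t ^+ 2.
Proof.
move=> er tr; have r0 : 0 <= r := le_trans (normr_ge0 t) tr.
have t2 : t ^+ 2 <= r ^+ 2 by rewrite -(real_normK (num_real t)) lerXn2r ?nnegrE.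
have et : eps * t ^+ 2 <= 1 by apply: le_trans er; rewrite ler_pM2l.
rewrite sqr_wpow; have b : 2^-1 * (1 + t ^+ 2) <= wbase t.
  by rewrite /wbase mulrC ler_wpM2l ?(ltW (num_gt0 t))// lef_pV2 ?posrE// lerD2l.
have h : (2^-1 * (1 + t ^+ 2)) `^ (11 / 20) <= wbase t `^ (11 / 20).
  apply: ge0_ler_powR => //.
    by rewrite nnegrE mulr_ge0 ?invr_ge0// ltW.
  by rewrite nnegrE (ltW (wbase_gt0 t)).
apply: le_trans h; rewrite powRM ?invr_ge0 ?(ltW (num_gt0 t))// ler_wpM2r ?powR_ge0//.
rewrite -[X in X <= _]powRr1 ?invr_ge0// ger_powR//; last lra.
by rewrite invr_gt0 ltr0n /= invf_le1 ?ler1n.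
Qed.

End PowerWeight.

(* [`|z|] is the max norm on the plane. *)
Definition plane_weight {R : realType} (l : R -> R) (z : R * R) := l `|z| ^+ 2.

(** * Weights and cut-offs on squares *)

Section Weighted.
Context {R : realType}.
Variables (l l1 : R -> R).
Hypothesis wt : weight l l1.

Lemma continuous_weight : continuous l.
Proof. exact: (is_derive_continuous _ _ (wt_der _ _ wt)). Qed.

Lemma continuous_plane_weight : continuous (plane_weight l).
Proof.
have cl := continuous_weight.
have c : continuous (fun z : R * R => l `|z|).
  by move=> z; apply: (continuous_comp (@norm_continuous _ _ z)); exact: cl.
by rewrite /plane_weight; cont_rules.
Qed.

Lemma weight_ge0 s : 0 <= l s.
Proof. by rewrite (le_trans _ (wt_ge1 _ _ wt s))// ler01. Qed.

Lemma plane_weight_ge0 z : 0 <= plane_weight l z.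
Proof. exact: sqr_ge0. Qed.

Lemma weight_sqr_le s t : `|s| <= `|t| -> l s ^+ 2 <= l t ^+ 2.
Proof. by move=> st; rewrite lerXn2r ?nnegrE ?weight_ge0// (wt_mono _ _ wt). Qed.

Lemma weight_le_plane x y : l x ^+ 2 <= plane_weight l (x, y) /\ l y ^+ 2 <= plane_weight l (x, y).
Proof.
rewrite /plane_weight; split; apply: weight_sqr_le; rewrite normr_id prod_normE le_max lexx ?orbT//.
Qed.

Lemma plane_weight_le_sum x y : plane_weight l (x, y) <= l x ^+ 2 + l y ^+ 2.
Proof.
rewrite /plane_weight prod_normE /=; have [xy|yx] := leP `|x| `|y|.
  apply: (@le_trans _ _ (l y ^+ 2)); first by apply: weight_sqr_le; rewrite normr_id.
  by rewrite lerDr sqr_ge0.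
apply: (@le_trans _ _ (l x ^+ 2)); first by apply: weight_sqr_le; rewrite normr_id.
by rewrite lerDl sqr_ge0.
Qed.

Lemma plane_weight_le (r x y : R) : `|x| <= r -> `|y| <= r -> plane_weight l (x, y) <= 1 + r ^+ 2.
Proof.
move=> xr yr; have r0 : 0 <= r := le_trans (normr_ge0 x) xr.
apply: (le_trans _ (wt_le _ _ wt r)); rewrite /plane_weight.
by apply: weight_sqr_le; rewrite normr_id (ger0_norm r0) prod_normE ge_max/= xr.
Qed.

Definition wchi (r s : R) := l s * chi r s.
Definition wchi1 (r s : R) := l1 s * chi r s + l s * chi1 r s.

Lemma is_derive_wchi (r s : R) : is_derive s (1 : R) (wchi r) (wchi1 r s).
Proof. exact: (der_mul _ _ _ _ _ (wt_der _ _ wt s) (is_derive_chi r s)). Qed.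

Lemma continuous_wchi1 (r : R) : continuous (wchi1 r).
Proof.
have c1 := continuous_weight; have c2 := wt_cont _ _ wt.
have c3 := @continuous_chi R r; have c4 := @continuous_chi1 R r.
by rewrite /wchi1; cont_rules.
Qed.

Lemma wchi_boundary (r : R) : 0 < r -> wchi r r = 0 /\ wchi r (- r) = 0.
Proof. by move=> r0; rewrite /wchi; case: (chi_boundary r r0) => -> ->; rewrite !mulr0. Qed.

Lemma sqr_chi_le (r s : R) : 0 < r -> `|s| <= r -> chi r s ^+ 2 <= 1.
Proof. by move=> r0 sr; have /andP[? ?] := chi_bounds r s r0 sr; rewrite exprn_ile1. Qed.

Lemma sqr_wchi_le (r s : R) : 0 < r -> `|s| <= r -> wchi r s ^+ 2 <= l s ^+ 2.
Proof. by move=> r0 sr; rewrite exprMn ler_piMr ?sqr_ge0// sqr_chi_le. Qed.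

Lemma sqr_chi1_le (r s : R) : 0 < r -> `|s| <= r -> chi1 r s ^+ 2 <= 4 / r ^+ 2.
Proof.
move=> r0 sr; rewrite (_ : 4 / r ^+ 2 = (2 / r) ^+ 2); last by field; rewrite gt_eqF.
by rewrite -(real_normK (num_real (chi1 r s))) lerXn2r ?nnegrE ?chi1_bound// divr_ge0// ltW.
Qed.

Lemma sqr_weight_le_rad (r s : R) : 1 <= r -> `|s| <= r -> l s ^+ 2 <= 2 * r ^+ 2.
Proof.
move=> r1 sr; have r0 : 0 <= r by rewrite (le_trans ler01).
apply: (le_trans (wt_le _ _ wt s)).
have : s ^+ 2 <= r ^+ 2 by rewrite -(real_normK (num_real s)) lerXn2r ?nnegrE.
have : 1 <= r ^+ 2 by rewrite exprn_ege1.
lra.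
Qed.

Lemma sqr_weight_chi1_le (r s s' : R) : 1 <= r -> `|s| <= r -> `|s'| <= r -> l s ^+ 2 * chi1 r s' ^+ 2 <= 8.
Proof.
move=> r1 sr sr'; have r0 : 0 < r by exact: lt_le_trans r1.
rewrite (_ : 8 = 2 * r ^+ 2 * (4 / r ^+ 2)); last by field; rewrite gt_eqF.
apply: ler_pM; rewrite ?sqr_ge0//; [exact: sqr_weight_le_rad|exact: sqr_chi1_le].
Qed.

Lemma sqr_wchi1_le (r s : R) : 1 <= r -> `|s| <= r -> wchi1 r s ^+ 2 <= 18.
Proof.
move=> r1 sr; have r0 : 0 < r by exact: lt_le_trans r1.
have h1 : (l1 s * chi r s) ^+ 2 <= 1.
  rewrite exprMn -[leRHS]mulr1; apply: ler_pM; rewrite ?sqr_ge0//; first exact: (wt_der_le _ _ wt).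
  exact: sqr_chi_le.
have h2 : (l s * chi1 r s) ^+ 2 <= 8 by rewrite exprMn sqr_weight_chi1_le.
have := sqr_ge0 (l1 s * chi r s - l s * chi1 r s); rewrite sqrrB /wchi1 sqrrD; lra.
Qed.

(** The derivative of [chi] is of order 1 / r and [l] at most of order r, so their product stays
    bounded uniformly in r; 26 = 18 + 8. *)
Lemma wchi_gradient_le (r x y : R) : 1 <= r -> `|x| <= r -> `|y| <= r ->
  (wchi1 r x * chi r y) ^+ 2 + (wchi r x * chi1 r y) ^+ 2 <= 26.
Proof.
move=> r1 xr yr; have r0 : 0 < r by exact: lt_le_trans r1.
have h1 : (wchi1 r x * chi r y) ^+ 2 <= 18.
  rewrite exprMn -[leRHS]mulr1; apply: ler_pM; rewrite ?sqr_ge0//; first exact: sqr_wchi1_le.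
  exact: sqr_chi_le.
have h2 : (wchi r x * chi1 r y) ^+ 2 <= 8.
  rewrite exprMn; apply: le_trans (sqr_weight_chi1_le r x y r1 xr yr).
  by rewrite ler_wpM2r ?sqr_ge0// sqr_wchi_le.
lra.
Qed.

Lemma wchi_half (r x y : R) : 0 < r -> `|x| <= r / 2 -> `|y| <= r / 2 ->
  l x ^+ 2 <= 4 * (wchi r x * chi r y) ^+ 2.
Proof.
move=> r0 xr yr; rewrite !exprMn.
have hs s : `|s| <= r / 2 -> 1 / 2 <= chi r s ^+ 2.
  move=> sr; have := chi_half r s r0 sr; move: (chi r s) => u u34.
  have : (3 / 4) * (3 / 4) <= u * u by rewrite ler_pM// divr_ge0.
  rewrite expr2; lra.
have h : 1 / 2 * (1 / 2) <= chi r x ^+ 2 * chi r y ^+ 2 by rewrite ler_pM ?divr_ge0// hs.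
have := ler_wpM2l (sqr_ge0 (l x)) h.
rewrite (_ : 4 * _ = 4 * (l x ^+ 2 * (chi r x ^+ 2 * chi r y ^+ 2))); last by ring.
lra.
Qed.

End Weighted.

Lemma sqr_ge26 {R : realType} (A : R) : 6 <= A -> 26 <= A ^+ 2.
Proof.
move=> a6; have : 0 <= (A - 6) * (A - 6) by rewrite -expr2 sqr_ge0.
rewrite expr2; lra.
Qed.

(** * Weighted bound for the density *)

Section WeightedEstimates.
Context {R : realType}.
Variables f f1 f2 f11 f22 j1 j2 p q q1 J : R * R -> R.
Hypothesis cs : current_system f f1 f2 f11 f22 j1 j2 p q q1 J.
Let X2 z := f1 z ^+ 2 + f2 z ^+ 2.
Let E := density_energy f1 f2 f11 f22.
Let S := current_energy p q.

Let cX2 : continuous X2.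
Proof. by case: cs => [[_ ? ? _ _] _ _ _ _ _ _ _ _ _ _]; rewrite /X2; cont_rules. Qed.
Let cE : continuous E.
Proof. by case: cs => [[_ ? ? ? ?] _ _ _ _ _ _ _ _ _ _]; rewrite /E /density_energy; cont_rules. Qed.
Let cS : continuous S.
Proof. by case: cs => [_ [_ _ ? ? _] _ _ _ _ _ _ _ _ _]; rewrite /S /current_energy; cont_rules. Qed.
Let X0 z : 0 <= X2 z. Proof. by rewrite addr_ge0// sqr_ge0. Qed.
Let S0 z : 0 <= S z. Proof. by rewrite addr_ge0// sqr_ge0. Qed.
Let XE z : X2 z <= E z. Proof. by rewrite /E /density_energy lerDr sqr_ge0. Qed.

Lemma finite_X2 : exists2 C, 0 <= C & forall r, 0 < r -> int2 r r X2 <= C.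
Proof.
have [C HC] := finite_energy _ _ _ _ _ _ _ _ _ _ _ cs.
have cES : continuous (fun z => E z + S z) by cont_rules.
have le r : 0 < r -> int2 r r X2 <= C.
  move=> r0'; apply: le_trans (HC r r0'); apply: (int2_le _ _ _ _ (ltW r0') cX2 cES).
  by move=> x y _ _; rewrite (le_trans (XE _))// lerDl.
exists C => //; apply: le_trans (le 1 ltr01).
by apply: int2_ge0 => //.
Qed.

Lemma finite_S : exists2 C, 0 <= C & forall r, 0 < r -> int2 r r S <= C.
Proof.
have [C HC] := finite_energy _ _ _ _ _ _ _ _ _ _ _ cs.
have cES : continuous (fun z => E z + S z) by cont_rules.
have le r : 0 < r -> int2 r r S <= C.
  move=> r0'; apply: le_trans (HC r r0'); apply: (int2_le _ _ _ _ (ltW r0') cS cES).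
  by move=> x y _ _; rewrite lerDr (le_trans _ (XE _)).
exists C => //; apply: le_trans (le 1 ltr01).
by apply: int2_ge0 => //.
Qed.

Variable r0 : R.
Hypothesis r0_ge1 : 1 <= r0.
Hypothesis small : forall x y (z := (x, y)), outside r0 x y ->
  [/\ `|f z| <= 1 / 100, j1 z ^+ 2 + j2 z ^+ 2 <= 10000^-1, f1 z ^+ 2 + f2 z ^+ 2 <= 10000^-1 &
      2 * (1 - f z) * J z = f2 z * j1 z - f1 z * j2 z].
Let r00 : 0 < r0. Proof. exact: lt_le_trans r0_ge1. Qed.

(** The max norm is not differentiable on the diagonals, so each test carries the weight of one
    coordinate; the plane weight is at most the sum of the two. Each direction loses a factor 4 to
    the cut-off: 1536 = 2 * 4 * 192. The gradients of the tests are paid for by the unweighted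
    integral of |grad f|^2. *)
Lemma weighted_density : exists2 C, 0 <= C & forall l l1 M, weight l l1 ->
  (forall r, 0 < r -> int2 r r (fun z => plane_weight l z * S z) <= M) ->
  forall r, 0 < r -> int2 r r (fun z => plane_weight l z * X2 z) <= 1536 / 10000 * M + C.
Proof.
have [C1 C10 HC1] := density_estimate _ _ _ _ _ _ _ _ _ _ _ cs r0 r0_ge1 small.
have [C2 C20 HC2] := finite_X2.
(* Bounds the tests and their derivatives at once on the central square: [A ^+ 2] exceeds both 1 +
   r0^2 and 26. *)
pose A := 6 + r0 ^+ 2.
exists (8 * (32 * (26 * C2) + C1 * A ^+ 2)).
  exact: (mulr_ge0 (ler0n R 8) (addr_ge0 (mulr_ge0 (ler0n R 32) (mulr_ge0 (ler0n R 26) C20))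
    (mulr_ge0 C10 (sqr_ge0 A)))).
move=> l l1 M wt HM r rpos.
have cW := continuous_plane_weight _ _ wt.
have cl := continuous_weight _ _ wt.
pose s := 2 * Num.max r r0.
have rm : r <= Num.max r r0 by rewrite le_max lexx.
have r0m : r0 <= Num.max r r0 by rewrite le_max lexx orbT.
have s0 : 0 < s by rewrite mulr_gt0// lt_max rpos.
have sge0 : 0 <= s := ltW s0.
have s2 : s / 2 = Num.max r r0 by rewrite /s mulrC mulKf// pnatr_eq0.
have sh : 0 < s / 2 by rewrite divr_gt0.
have shs : s / 2 <= s by rewrite ler_pdivrMr// ler_peMr// ler1n.
have r0s : r0 <= s by rewrite (le_trans r0m)// -s2.
have s1 : 1 <= s by exact: le_trans r0s.
(* [v (x, y)] will be [l x ^+ 2] and [l y ^+ 2]. *)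
have direction (t t1 t2 v : R * R -> R) : test_function s t t1 t2 -> continuous v ->
    (forall x y, `|x| <= s -> `|y| <= s -> t (x, y) ^+ 2 <= plane_weight l (x, y)) ->
    (forall x y, `|x| <= s -> `|y| <= s -> t1 (x, y) ^+ 2 + t2 (x, y) ^+ 2 <= 26) ->
    (forall x y, `|x| <= s / 2 -> `|y| <= s / 2 -> v (x, y) <= 4 * t (x, y) ^+ 2) ->
    (forall z, 0 <= v z) ->
    int2 r r (fun z => v z * X2 z) <= 4 * (192 / 10000 * M + 32 * (26 * C2) + C1 * A ^+ 2).
  move=> tt cv tW N26 vt v0.
  have [[ct ct1 ct2 _ _] _] := tt.
  have cvX : continuous (fun z => v z * X2 z) by cont_rules.
  have ctX : continuous (fun z => t z ^+ 2 * X2 z) by cont_rules.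
  have ctE : continuous (fun z => t z ^+ 2 * E z) by cont_rules.
  have ctS : continuous (fun z => t z ^+ 2 * S z) by cont_rules.
  have cWS : continuous (fun z => plane_weight l z * S z) by cont_rules.
  have cNX : continuous (fun z => (t1 z ^+ 2 + t2 z ^+ 2) * X2 z) by cont_rules.
  have c26X : continuous (fun z => 26 * X2 z) by cont_rules.
  have c4tX : continuous (fun z => 4 * (t z ^+ 2 * X2 z)) by cont_rules.
  have bt : bounded_test r0 A t t1 t2.
    move=> x y z xr yr.
    have xs := le_trans xr r0s; have ys := le_trans yr r0s.
    have A0 : 0 <= A by exact: (addr_ge0 (ler0n R 6) (sqr_ge0 r0)).
    have a6 : 6 <= A by rewrite lerDl sqr_ge0.
    have A26 : 26 <= A ^+ 2 by exact: sqr_ge26.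
    have sq (a b : R) : a ^+ 2 + b ^+ 2 <= 26 -> `|a| <= A.
      move=> h; rewrite -(@ler_pXn2r _ 2)// ?nnegrE// real_normK ?num_real//.
      by rewrite (le_trans _ A26)// (le_trans _ h)// lerDl sqr_ge0.
    have N := N26 x y xs ys.
    split; [|exact: sq N|by apply: (sq _ (t1 z)); rewrite addrC].
    rewrite -(@ler_pXn2r _ 2)// ?nnegrE// real_normK ?num_real//.
    apply: (le_trans (tW x y xs ys)); apply: (le_trans (plane_weight_le _ _ wt r0 x y xr yr)).
    apply: (@le_trans _ _ A); first by rewrite lerD2r ler1n.
    have A1 : 1 <= A by apply: le_trans a6; rewrite ler1n.
    by rewrite expr2 ler_peMr.
  have i1 := HC1 s A t t1 t2 r0s tt bt.
  have i2 : int2 s s (fun z => t z ^+ 2 * S z) <= M.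
    apply: le_trans (HM s s0); apply: (int2_le _ _ _ _ sge0 ctS cWS) => x y.
    by rewrite -!ler_norml => xs ys; rewrite ler_wpM2r// tW.
  have i3 : int2 s s (fun z => (t1 z ^+ 2 + t2 z ^+ 2) * X2 z) <= 26 * C2.
    apply: (@le_trans _ _ (26 * int2 s s X2)); last by rewrite ler_wpM2l// HC2.
    rewrite -(int2Zl _ _ _ _ sge0 cX2); apply: (int2_le _ _ _ _ sge0 cNX c26X) => x y.
    by rewrite -!ler_norml => xs ys; rewrite ler_wpM2r// N26.
  have i4 : int2 s s (fun z => t z ^+ 2 * X2 z) <= int2 s s (fun z => t z ^+ 2 * E z).
    by apply: (int2_le _ _ _ _ sge0 ctX ctE) => x y _ _; rewrite ler_wpM2l ?sqr_ge0.
  have i5 : int2 r r (fun z => v z * X2 z) <= int2 (s / 2) (s / 2) (fun z => v z * X2 z).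
    apply: (int2_outside_mono _ _ _ rpos _ cvX); first by rewrite s2.
    by move=> *; rewrite mulr_ge0.
  have i6 : int2 (s / 2) (s / 2) (fun z => v z * X2 z) <= 4 * int2 (s / 2) (s / 2) (fun z => t z ^+ 2 * X2 z).
    rewrite -(int2Zl _ _ _ _ (ltW sh) ctX); apply: (int2_le _ _ _ _ (ltW sh) cvX c4tX) => x y.
    by rewrite -!ler_norml => xs ys; rewrite mulrA ler_wpM2r// vt.
  have i7 : int2 (s / 2) (s / 2) (fun z => t z ^+ 2 * X2 z) <= int2 s s (fun z => t z ^+ 2 * X2 z).
    apply: (int2_outside_mono _ _ _ sh shs ctX).
    by move=> *; rewrite mulr_ge0// sqr_ge0.
  apply: (le_trans i5); apply: (le_trans i6); rewrite ler_pM2l//.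
  apply: (le_trans i7); apply: (le_trans i4); apply: (le_trans i1).
  exact: (lerD (lerD (ler_wpM2l (divr_ge0 (ler0n R _) (ler0n R _)) i2) (ler_wpM2l (ler0n R 32) i3)) (lexx _)).
have c1x := continuous_comp_fst _ cl; have c2y := continuous_comp_snd _ cl.
have dx := direction _ _ _ (fun z => l z.1 ^+ 2) (product_test s _ _ _ _
   (continuous_wchi1 _ _ wt s) (continuous_chi1 s) (is_derive_wchi _ _ wt s) (is_derive_chi s)
   (wchi_boundary _ s s0) (chi_boundary s s0)).
have dy := direction _ _ _ (fun z => l z.2 ^+ 2) (product_test s _ _ _ _
   (continuous_chi1 s) (continuous_wchi1 _ _ wt s) (is_derive_chi s) (is_derive_wchi _ _ wt s)
   (chi_boundary s s0) (wchi_boundary _ s s0)).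
have tbound x y : `|x| <= s -> `|y| <= s -> (wchi l s x * chi s y) ^+ 2 <= l x ^+ 2.
  move=> xs ys; rewrite exprMn; apply: (le_trans (_ : _ <= wchi l s x ^+ 2)).
    by rewrite ler_piMr ?sqr_ge0// sqr_chi_le.
  by rewrite sqr_wchi_le.
have clx : continuous (fun z : R * R => l z.1 ^+ 2) by cont_rules.
have cly : continuous (fun z : R * R => l z.2 ^+ 2) by cont_rules.
have {}dx : int2 r r (fun z => l z.1 ^+ 2 * X2 z) <= 4 * (192 / 10000 * M + 32 * (26 * C2) + C1 * A ^+ 2).
  apply: dx => //=.
  - by move=> x y xs ys; rewrite (le_trans (tbound x y xs ys))//; case: (weight_le_plane _ _ wt x y).
  - by move=> x y; exact: (wchi_gradient_le _ _ wt).
  - by move=> x y; exact: wchi_half.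
  - by move=> z; exact: sqr_ge0.
have {}dy : int2 r r (fun z => l z.2 ^+ 2 * X2 z) <= 4 * (192 / 10000 * M + 32 * (26 * C2) + C1 * A ^+ 2).
  apply: dy => //=.
  - by move=> x y xs ys; rewrite mulrC (le_trans (tbound y x ys xs))//; case: (weight_le_plane _ _ wt x y).
  - by move=> x y xs ys; rewrite addrC [_ * wchi1 _ _ _ _]mulrC [_ * wchi _ _ _]mulrC; exact: (wchi_gradient_le _ _ wt).
  - by move=> x y xs ys; rewrite [_ * wchi _ _ _]mulrC; exact: wchi_half.
  - by move=> z; exact: sqr_ge0.
have cWX : continuous (fun z => plane_weight l z * X2 z) by cont_rules.
have cx : continuous (fun z : R * R => l z.1 ^+ 2 * X2 z) by cont_rules.
have cy : continuous (fun z : R * R => l z.2 ^+ 2 * X2 z) by cont_rules.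
have cxy : continuous (fun z : R * R => l z.1 ^+ 2 * X2 z + l z.2 ^+ 2 * X2 z) by cont_rules.
apply: (@le_trans _ _ (int2 r r (fun z => l z.1 ^+ 2 * X2 z + l z.2 ^+ 2 * X2 z))).
  apply: (int2_le _ _ _ _ (ltW rpos) cWX cxy) => x y _ _.
  by rewrite -mulrDl ler_wpM2r// (plane_weight_le_sum _ _ wt).
rewrite (int2D _ _ _ _ (ltW rpos) cx cy); apply: (le_trans (lerD dx dy)).
by rewrite le_eqVlt; apply/orP; left; apply/eqP; field.
Qed.

End WeightedEstimates.

(** * Integrals over the boundary of a square *)

Section BoundaryIntegral.
Context {R : realType}.
Implicit Types (F G : R * R -> R) (r : R).

Lemma bd_continuous r F : continuous F ->
  continuous (fun s => (F (r, s) + F (- r, s)) + (F (s, r) + F (s, - r))).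
Proof.
move=> cF.
have ? := continuous_slice1 F r cF; have ? := continuous_slice1 F (- r) cF.
have ? := continuous_slice2 F r cF; have ? := continuous_slice2 F (- r) cF.
by cont_rules.
Qed.

Lemma bdD r F G : continuous F -> continuous G -> bd r (fun z => F z + G z) = bd r F + bd r G.
Proof.
move=> cF cG; rewrite /bd -(int1D _ _ _ _ (bd_continuous r F cF) (bd_continuous r G cG)).
by apply: eq_int1 => s _; ring.
Qed.

Lemma bdZl r k F : continuous F -> bd r (fun z => k * F z) = k * bd r F.
Proof.
move=> cF; rewrite /bd -(int1Zl _ _ _ _ (bd_continuous r F cF)).
by apply: eq_int1 => s _; ring.
Qed.

Lemma bd_le r F G : continuous F -> continuous G -> (forall z, F z <= G z) -> bd r F <= bd r G.
Proof.
move=> cF cG FG; apply: (int1_le _ _ _ _ (bd_continuous r F cF) (bd_continuous r G cG)) => s _.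
by rewrite !lerD.
Qed.

(** The max norm is chosen for this: the weight is constant on the boundary of a square and factors
    out. *)
Lemma bd_plane_weight (l : R -> R) r F : 0 < r -> continuous F ->
  bd r (fun z => plane_weight l z * F z) = l r ^+ 2 * bd r F.
Proof.
move=> r0 cF; rewrite /bd -(int1Zl _ _ _ _ (bd_continuous r F cF)).
apply: eq_int1 => s; rewrite -ler_norml => sr.
have W1 : plane_weight l (r, s) = l r ^+ 2.
  by rewrite /plane_weight prod_normE/= (gtr0_norm r0) max_l.
have W2 : plane_weight l (- r, s) = l r ^+ 2.
  by rewrite /plane_weight prod_normE/= normrN (gtr0_norm r0) max_l.
have W3 : plane_weight l (s, r) = l r ^+ 2.
  by rewrite /plane_weight prod_normE/= (gtr0_norm r0) max_r.
have W4 : plane_weight l (s, - r) = l r ^+ 2.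
  by rewrite /plane_weight prod_normE/= normrN (gtr0_norm r0) max_r.
by rewrite W1 W2 W3 W4; ring.
Qed.

Lemma weight_cst : weight (fun _ : R => 1) (fun=> 0).
Proof.
split=> //.
- by move=> t; exact: der_cst.
- exact: cont_cst.
- by move=> t; rewrite expr1n lerDl sqr_ge0.
- by move=> t; rewrite expr0n ler01.
- by move=> t _; rewrite mulr0 mulr1; split; rewrite ?lexx//; exact: (divr_ge0 (ler0n R _) (ler0n R _)).
- by exists 1 => t; rewrite expr1n.
Qed.

Lemma plane_weight_cst (z : R * R) : plane_weight (fun _ : R => 1) z = 1.
Proof. by rewrite /plane_weight expr1n. Qed.

End BoundaryIntegral.

(** * Smallness of the boundary term *)

Section Stage2.
Context {R : realType}.
Variables f f1 f2 f11 f22 j1 j2 p q q1 J : R * R -> R.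
Hypothesis cs : current_system f f1 f2 f11 f22 j1 j2 p q q1 J.
Let X2 z := f1 z ^+ 2 + f2 z ^+ 2.
Let S := current_energy p q.
Let T := tangential p q J.
Let B r := int2 r r (current_det p q J).

Let cX2 : continuous X2.
Proof. by case: cs => [[_ ? ? _ _] _ _ _ _ _ _ _ _ _ _]; rewrite /X2; cont_rules. Qed.
Let cS : continuous S.
Proof. by case: cs => [_ [_ _ ? ? _] _ _ _ _ _ _ _ _ _]; rewrite /S /current_energy; cont_rules. Qed.
Let cJ : continuous J.
Proof. by case: cs. Qed.
Let cp : continuous p.
Proof. by case: cs => [_ [_ _ ? _ _]]. Qed.
Let cJ2 : continuous (fun z => J z ^+ 2).
Proof. by have := cJ => ?; cont_rules. Qed.
Let cT : continuous T.
Proof. by have := cS; have := cJ; rewrite /T /tangential /S => ? ?; cont_rules. Qed.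
Let cdet : continuous (current_det p q J).
Proof. by have := cS; have := cJ; have := cp; rewrite /current_det /S => ? ? ?; cont_rules. Qed.
Let X0 z : 0 <= X2 z. Proof. by rewrite addr_ge0// sqr_ge0. Qed.
Let S0 z : 0 <= S z. Proof. by rewrite addr_ge0// sqr_ge0. Qed.
Let T0 z : 0 <= T z.
Proof.
exact: (addr_ge0 (mulr_ge0 (divr_ge0 (ler0n R 45) (ler0n R 44)) (S0 z))
  (mulr_ge0 (ler0n R 180) (sqr_ge0 _))).
Qed.
Let small4 : 0 <= 10000^-1 :> R. Proof. by rewrite invr_ge0 ler0n. Qed.

Variable r0 : R.
Hypothesis r0_ge1 : 1 <= r0.
Hypothesis small : forall x y (z := (x, y)), outside r0 x y ->
  [/\ `|f z| <= 1 / 100, j1 z ^+ 2 + j2 z ^+ 2 <= 10000^-1, f1 z ^+ 2 + f2 z ^+ 2 <= 10000^-1 &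
      2 * (1 - f z) * J z = f2 z * j1 z - f1 z * j2 z].
Let r00 : 0 < r0. Proof. exact: lt_le_trans r0_ge1. Qed.

Lemma weighted_J : exists2 C, 0 <= C & forall l l1, weight l l1 -> forall r, r0 <= r ->
  int2 r r (fun z => plane_weight l z * J z ^+ 2) <=
  10000^-1 * int2 r r (fun z => plane_weight l z * X2 z) + C.
Proof.
have [M M0 HM] := square_bounded r0 _ cJ2.
pose k := (1 + r0 ^+ 2) * M.
have k0 : 0 <= k by rewrite mulr_ge0// addr_ge0// sqr_ge0.
exists (k * (4 * r0 * r0)).
  exact: (mulr_ge0 k0 (mulr_ge0 (mulr_ge0 (ler0n R 4) (ltW r00)) (ltW r00))).
move=> l l1 wt r r0r.
have rr0 : 0 <= r := ltW (lt_le_trans r00 r0r).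
have cW := continuous_plane_weight _ _ wt.
have W0 := plane_weight_ge0 l.
have cWX : continuous (fun z => plane_weight l z * X2 z) by cont_rules.
have cWJ : continuous (fun z => plane_weight l z * J z ^+ 2) by have := cJ => ?; cont_rules.
have c1 : continuous (fun z => 10000^-1 * (plane_weight l z * X2 z)) by cont_rules.
have c2 : continuous (fun z => -1 * (plane_weight l z * J z ^+ 2)) by have := cJ => ?; cont_rules.
have c3 : continuous (fun z => 10000^-1 * (plane_weight l z * X2 z) + -1 * (plane_weight l z * J z ^+ 2)).
  by have := cJ => ?; cont_rules.
have : - k * (4 * r0 * r0) <= int2 r r (fun z => 10000^-1 * (plane_weight l z * X2 z) + -1 * (plane_weight l z * J z ^+ 2)).
  apply: (int2_ge_outside _ _ _ _ r00 r0r c3) => [x y oxy _ _|x y xr yr].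
  - have [s1 s2 s3 s4] := small x y oxy.
    have h := sqr_J_le _ _ _ _ _ _ s1 s2 s3 s4.
    by rewrite mulN1r subr_ge0 [leRHS]mulrCA ler_wpM2l.
  - rewrite mulN1r; apply: (@le_trans _ _ (- (plane_weight l (x, y) * J (x, y) ^+ 2))).
      rewrite lerN2 /k; apply: ler_pM => //; rewrite ?sqr_ge0//; first exact: (plane_weight_le _ _ wt).
      by rewrite (le_trans (ler_norm _))// HM.
    rewrite lerDr; exact: (mulr_ge0 small4 (mulr_ge0 (W0 _) (X0 _))).
rewrite (int2D _ _ _ _ rr0 c1 c2) (int2Zl _ _ _ _ rr0 cWX) (int2Zl _ _ _ _ rr0 cWJ) mulN1r mulNr.
by rewrite lerBrDr addrC lerBlDr.
Qed.

Lemma finite_T : exists2 C, 0 <= C & forall r, 0 < r -> int2 r r T <= C.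
Proof.
have [CS CS0 HS] := finite_S _ _ _ _ _ _ _ _ _ _ _ cs.
have [CX CX0 HX] := finite_X2 _ _ _ _ _ _ _ _ _ _ _ cs.
have [CJ CJ0 HJ] := weighted_J.
have q0 : 0 <= 45 / 44 :> R := divr_ge0 (ler0n R _) (ler0n R _).
exists (45 / 44 * CS + 180 * (10000^-1 * CX + CJ)).
  exact: (addr_ge0 (mulr_ge0 q0 CS0) (mulr_ge0 (ler0n R 180) (addr_ge0 (mulr_ge0 small4 CX0) CJ0))).
move=> r rpos; pose s := Num.max r r0.
have rs : r <= s by rewrite le_max lexx.
have r0s : r0 <= s by rewrite le_max lexx orbT.
have s0 : 0 < s := lt_le_trans r00 r0s.
have le1 : int2 r r T <= int2 s s T by exact: int2_outside_mono.
have c1 : continuous (fun z => 45 / 44 * S z) by cont_rules.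
have c2 : continuous (fun z => 180 * J z ^+ 2) by have := cJ => ?; cont_rules.
have TE : int2 s s T = 45 / 44 * int2 s s S + 180 * int2 s s (fun z => J z ^+ 2).
  by rewrite -(int2Zl _ _ _ _ (ltW s0) cS) -(int2Zl _ _ _ _ (ltW s0) cJ2) -(int2D _ _ _ _ (ltW s0) c1 c2).
apply: (le_trans le1); rewrite TE; apply: lerD; first exact: (ler_wpM2l q0 (HS s s0)).
apply: (ler_wpM2l (ler0n R 180)).
have one (F : R * R -> R) : int2 s s (fun z => plane_weight (fun=> 1) z * F z) = int2 s s F.
  by apply: eq_int1 => x _; apply: eq_int1 => y _; rewrite plane_weight_cst mul1r.
have := HJ _ _ weight_cst s r0s; rewrite !one => h; apply: (le_trans h).
by rewrite lerD2r; exact: (ler_wpM2l small4 (HX s s0)).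
Qed.

Lemma abs_B_le r : 0 < r -> `|B r| <= 5 / 6 * r * bd r T.
Proof.
move=> r0'.
have h1 := loop_bound _ _ _ _ _ _ _ _ _ _ _ cs r 1 r0' (expr1n _ _).
have h2 := loop_bound _ _ _ _ _ _ _ _ _ _ _ cs r (-1) r0' (sqrr_sign _ 1).
rewrite -/(B r) -/T in h1 h2.
rewrite ler_norml; move: (B r) (bd r T) h1 h2 => b t h1 h2.
have -> : 5 / 6 * r * t = 2^-1 * (5 / 3 * r * t) by field.
by apply/andP; split; lra.
Qed.

(** If |B| stayed above [eps], the loop bound would make the derivative of the integral of [T] at
    least 6/5 eps / r, and this integral would grow like ln r although it is bounded. *)
Lemma B_small eps r1 : 0 < eps -> exists2 r, r1 <= r /\ r0 <= r & `|B r| <= eps.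
Proof.
move=> eps0; apply: contrapT => H.
have [C C0 HC] := finite_T.
pose a := Num.max r1 r0.
have r1a : r1 <= a by rewrite le_max lexx.
have r0a : r0 <= a by rewrite le_max lexx orbT.
have a0 : 0 < a := lt_le_trans r00 r0a.
have big r : a <= r -> eps < `|B r|.
  move=> ar; rewrite ltNge; apply/negP => le; apply: H; exists r => //.
  by split; apply: le_trans ar.
pose k := 6 / 5 * eps.
have k0 : 0 < k by rewrite mulr_gt0// divr_gt0.
have bdT r : a <= r -> 0 <= bd r T - k * r^-1.
  move=> ar; have rpos : 0 < r := lt_le_trans a0 ar.
  have h := le_trans (ltW (big r ar)) (abs_B_le r rpos).
  rewrite subr_ge0 ler_pdivrMr// /k (_ : bd r T * r = 6 / 5 * (5 / 6 * r * bd r T)); last by field.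
  by rewrite ler_wpM2l ?divr_ge0.
(* From [a] to a e^n the logarithm contributes k n = C + k, more than the bound [C]. *)
pose n := C / k + 1.
have n0 : 0 <= n by rewrite addr_ge0// divr_ge0// ltW.
pose b := a * expR n.
have ab : a <= b by rewrite ler_peMr ?(ltW a0)// -expR0 ler_expR.
have b0 : 0 < b := lt_le_trans a0 ab.
have d r : a <= r <= b -> is_derive r (1 : R) (fun r => int2 r r T - k * ln r) (bd r T - k * r^-1).
  move=> /andP[ar _]; have rpos : 0 < r := lt_le_trans a0 ar.
  have d1 := is_derive_int2_diag r T rpos cT; have d2 := is_derive1_ln rpos.
  have d3 := der_add _ _ _ _ _ d1 (der_opp _ _ _ (der_mul _ _ _ _ _ (der_cst k r) d2)).
  by rewrite mul0r add0r in d3.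
have := derive_nondecreasing _ _ a b ab d (fun r h => bdT r (andP h).1).
have lnb : ln b = ln a + n by rewrite lnM ?posrE ?expR_gt0// expRK.
have Ta : 0 <= int2 a a T by apply: int2_ge0 => //; exact: ltW.
have Tb := HC b b0.
have kn : k * n = C + k by rewrite /n mulrDr mulr1 mulrCA divff ?mulr1// gt_eqF.
rewrite lnb mulrDr kn.
move: (int2 a a T) (int2 b b T) (k * ln a) Ta Tb => u v w Ta Tb; lra.
Qed.

End Stage2.

Lemma weighted_current_arith {R : realFieldType} (iS iJ lB s0 t0 b k x : R) :
  197 * t0 - 32^-1 * s0 - b <= 197 * iJ - 32^-1 * iS - lB ->
  0 <= t0 -> s0 <= k -> b <= x ->
  iS <= 6304 * iJ + (k + 32 * x) - 32 * lB.
Proof. lra. Qed.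

Lemma absorption_arith {R : realFieldType} (M Cd CJ Cc iS iJ iX b : R) :
  iS <= 6304 * iJ + Cc + 32 * b -> b <= 1 -> iJ <= 10000^-1 * iX + CJ ->
  iX <= 1536 / 10000 * M + Cd ->
  iS <= 1 / 2 * M + (6304 * (10000^-1 * Cd + CJ) + Cc + 32) - (1 / 2 - 6304 * 10000^-1 * (1536 / 10000)) * M.
Proof. lra. Qed.

(** The gain of the whole circuit, from S to |grad f|^2 to J^2 and back to S, is 6304 * 1536 *
    10^-8, about 0.097. *)
Lemma tenth_lt_half {R : realFieldType} : 0 <= 1 / 2 - 6304 * 10000^-1 * (1536 / 10000) :> R.
Proof. lra. Qed.

Lemma half_absorb {R : realFieldType} (M X : R) : M <= 1 / 2 * M + X -> M <= 2 * X.
Proof. lra. Qed.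

(** The squared weight without truncation. *)
Definition bracket {R : realType} (s : R) := (1 + s ^+ 2) `^ (11 / 20).

Lemma bracket_gt0 {R : realType} (s : R) : 0 < bracket s.
Proof. by rewrite powR_gt0// ltr_wpDr ?sqr_ge0. Qed.

Lemma continuous_bracket {R : realType} : continuous (@bracket R).
Proof.
have c1 : continuous (fun s : R => 1 + s ^+ 2) by cont_rules.
move=> s; have s0 : 0 < 1 + s ^+ 2 by rewrite ltr_wpDr ?sqr_ge0.
have [d _] := is_derive1_powR (11 / 20) s0.
have cg : {for (1 + s ^+ 2), continuous (fun u : R => u `^ (11 / 20))}.
  by apply: differentiable_continuous; apply/derivable1_diffP.
exact: (@continuous_comp _ _ _ (fun s : R => 1 + s ^+ 2) _ s (c1 s) cg).
Qed.

(** * Weighted bound for the current *)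

Section WeightedCurrent.
Context {R : realType}.
Variables f f1 f2 f11 f22 j1 j2 p q q1 J : R * R -> R.
Hypothesis cs : current_system f f1 f2 f11 f22 j1 j2 p q q1 J.
Let S := current_energy p q.
Let T := tangential p q J.
Let B r := int2 r r (current_det p q J).

Let cS : continuous S.
Proof. by case: cs => [_ [_ _ ? ? _] _ _ _ _ _ _ _ _ _]; rewrite /S /current_energy; cont_rules. Qed.
Let cJ : continuous J.
Proof. by case: cs. Qed.
Let cp : continuous p.
Proof. by case: cs => [_ [_ _ ? _ _]]. Qed.
Let cJ2 : continuous (fun z => J z ^+ 2).
Proof. by have := cJ => ?; cont_rules. Qed.
Let cT : continuous T.
Proof. by have := cS; have := cJ; rewrite /T /tangential /S => ? ?; cont_rules. Qed.
Let cdet : continuous (current_det p q J).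
Proof. by have := cS; have := cJ; have := cp; rewrite /current_det /S => ? ? ?; cont_rules. Qed.
Let S0 z : 0 <= S z. Proof. by rewrite addr_ge0// sqr_ge0. Qed.
Let T0 z : 0 <= T z.
Proof.
exact: (addr_ge0 (mulr_ge0 (divr_ge0 (ler0n R 45) (ler0n R 44)) (S0 z))
  (mulr_ge0 (ler0n R 180) (sqr_ge0 _))).
Qed.

Variable r0 : R.
Hypothesis r0_ge1 : 1 <= r0.
Hypothesis small : forall x y (z := (x, y)), outside r0 x y ->
  [/\ `|f z| <= 1 / 100, j1 z ^+ 2 + j2 z ^+ 2 <= 10000^-1, f1 z ^+ 2 + f2 z ^+ 2 <= 10000^-1 &
      2 * (1 - f z) * J z = f2 z * j1 z - f1 z * j2 z].
Let r00 : 0 < r0. Proof. exact: lt_le_trans r0_ge1. Qed.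

Let K z := 197 * J z ^+ 2 + - 32^-1 * S z.

Let cK : continuous K.
Proof. by have := cJ2; have := cS; rewrite /K => ? ?; cont_rules. Qed.

(** 11/12 = 5/3 * 11/20 is the cost of differentiating the weight. The factor 45/44 in [tangential]
    is close enough to 1 that 11/12 * 45/44 = 15/16 leaves - S / 16 on the left, half of which
    absorbs the cross term with J; 197 = 165 + 32. *)
Lemma det_tangential_le z : current_det p q J z + 11 / 12 * T z <= K z.
Proof.
rewrite -subr_ge0 (_ : _ - _ = 32^-1 * (p z + 32 * J z) ^+ 2 + 32^-1 * q z ^+ 2); last first.
  by rewrite /K /current_det /T /tangential /S /current_energy; field.
by rewrite addr_ge0// mulr_ge0 ?invr_ge0 ?ler0n// sqr_ge0.
Qed.

(** The weighted integral of [K] minus [l r ^+ 2 * B r] is nondecreasing in [r]: the derivative of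
    the weight is charged, by the loop bound and [wt_growth], to 11/12 of the boundary integral of
    [T], which [K] minus the determinant dominates. No cut-off is involved, hence no integral of
    |j|^2. Comparison of [r0] with [r] and a factor 32 give the claim; 6304 = 32 * 197. *)
Lemma weighted_current : exists2 C, 0 <= C & forall l l1, weight l l1 -> forall r, r0 <= r ->
  int2 r r (fun z => plane_weight l z * S z) <=
  6304 * int2 r r (fun z => plane_weight l z * J z ^+ 2) + C + 32 * (l r ^+ 2 * `|B r|).
Proof.
pose k := 1 + r0 ^+ 2.
have k0 : 0 <= k by rewrite addr_ge0// sqr_ge0.
have iS0 : 0 <= int2 r0 r0 S by apply: int2_ge0 => //; exact: ltW.
exists (k * int2 r0 r0 S + 32 * (k * `|B r0|)).
  exact: (addr_ge0 (mulr_ge0 k0 iS0) (mulr_ge0 (ler0n R 32) (mulr_ge0 k0 (normr_ge0 _)))).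
move=> l l1 wt r r0r.
have cW := continuous_plane_weight _ _ wt.
have W0 := plane_weight_ge0 l.
have rr0 : 0 <= r := ltW (lt_le_trans r00 r0r).
have cWS : continuous (fun z => plane_weight l z * S z) by cont_rules.
have cWJ : continuous (fun z => plane_weight l z * J z ^+ 2) by have := cJ => ?; cont_rules.
have cWK : continuous (fun z => plane_weight l z * K z) by cont_rules.
have c1 : continuous (fun z => 197 * (plane_weight l z * J z ^+ 2)).
  by have := cJ => ?; cont_rules.
have c2 : continuous (fun z => - 32^-1 * (plane_weight l z * S z)) by cont_rules.
have KE s : 0 <= s -> int2 s s (fun z => plane_weight l z * K z) =
    197 * int2 s s (fun z => plane_weight l z * J z ^+ 2) -
    32^-1 * int2 s s (fun z => plane_weight l z * S z).
  move=> s0; rewrite -mulNr -(int2Zl _ _ _ _ s0 cWJ) -(int2Zl _ _ _ _ s0 cWS) -(int2D _ _ _ _ s0 c1 c2).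
  by apply: eq_int1 => x _; apply: eq_int1 => y _; rewrite /K; ring.
pose dg s := l s ^+ 2 * bd s K - (2 * l s * l1 s * B s + l s ^+ 2 * bd s (current_det p q J)).
have d s : r0 <= s <= r ->
    is_derive s (1 : R) (fun s => int2 s s (fun z => plane_weight l z * K z) - l s ^+ 2 * B s) (dg s).
  move=> /andP[rs _]; have s0 : 0 < s := lt_le_trans r00 rs.
  have d1 := is_derive_int2_diag s _ s0 cWK; have d2 := is_derive_int2_diag s _ s0 cdet.
  have d3 := der_exp2 _ _ _ (wt_der _ _ wt s).
  have d4 := der_add _ _ _ _ _ d1 (der_opp _ _ _ (der_mul _ _ _ _ _ d3 d2)).
  by rewrite (bd_plane_weight _ _ _ s0 cK) in d4.
have dg0 s : r0 <= s <= r -> 0 <= dg s.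
  move=> /andP[rs _]; have s0 : 0 < s := lt_le_trans r00 rs.
  have l0 : 0 <= l s := le_trans ler01 (wt_ge1 _ _ wt s).
  have [l10 tl] := wt_growth _ _ wt s (ltW s0).
  have bT : 0 <= bd s T by apply: bd_ge0.
  have cT' : continuous (fun z => 11 / 12 * T z) by cont_rules.
  have cdT : continuous (fun z => current_det p q J z + 11 / 12 * T z).
    by have := cdet; have := cT => ? ?; cont_rules.
  have := bd_le s _ _ cdT cK det_tangential_le.
  rewrite (bdD _ _ _ cdet cT') (bdZl _ _ _ cT) => hK.
  have lb := loop_bound _ _ _ _ _ _ _ _ _ _ _ cs s 1 s0 (expr1n _ _).
  rewrite -/(B s) -/T mulr1 in lb.
  have h1 : 2 * l s * l1 s * B s <= l s * l1 s * (5 / 3 * s * bd s T).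
    rewrite (_ : 2 * _ * _ * _ = l s * l1 s * (2 * B s)); last by ring.
    exact: (ler_wpM2l (mulr_ge0 l0 l10) lb).
  have h2 : l s * l1 s * (5 / 3 * s * bd s T) <= l s ^+ 2 * (11 / 12 * bd s T).
    rewrite (_ : l s * _ * _ = 5 / 3 * bd s T * l s * (s * l1 s)); last by ring.
    rewrite (_ : _ ^+ 2 * _ = 5 / 3 * bd s T * l s * (11 / 20 * l s)); last by field.
    exact: (ler_wpM2l (mulr_ge0 (mulr_ge0 (divr_ge0 (ler0n R 5) (ler0n R 3)) bT) l0) tl).
  have h3 := ler_wpM2l (sqr_ge0 (l s)) hK.
  rewrite mulrDr in h3.
  by rewrite subr_ge0; apply: le_trans h3; rewrite addrC lerD2l (le_trans h1).
have := derive_nondecreasing _ _ r0 r r0r d dg0.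
rewrite (KE _ (ltW r00)) (KE _ rr0).
have lr0 : l r0 ^+ 2 <= k := wt_le _ _ wt r0.
have t0 : 0 <= int2 r0 r0 (fun z => plane_weight l z * J z ^+ 2).
  apply: (int2_ge0 _ _ _ (ltW r00) (ltW r00) cWJ) => x y _ _.
  exact: (mulr_ge0 (W0 _) (sqr_ge0 _)).
have s0 : int2 r0 r0 (fun z => plane_weight l z * S z) <= k * int2 r0 r0 S.
  rewrite -(int2Zl _ _ _ _ (ltW r00) cS).
  have ckS : continuous (fun z => k * S z) by cont_rules.
  apply: (int2_le _ _ _ _ (ltW r00) cWS ckS) => x y; rewrite -!ler_norml => xr yr.
  exact: (ler_wpM2r (S0 _) (plane_weight_le _ _ wt _ _ _ xr yr)).
have b0 : l r0 ^+ 2 * B r0 <= k * `|B r0|.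
  apply: (@le_trans _ _ (l r0 ^+ 2 * `|B r0|)).
    exact: (ler_wpM2l (sqr_ge0 _) (ler_norm _)).
  exact: (ler_wpM2r (normr_ge0 _) lr0).
move=> h; have h' := weighted_current_arith _ _ _ _ _ _ _ _ h t0 s0 b0.
apply: (le_trans h'); rewrite lerD2l -mulrN; apply: (ler_wpM2l (ler0n R 32)).
by rewrite -mulrN; apply: (ler_wpM2l (sqr_ge0 _)); rewrite -normrN ler_norm.
Qed.

(** [C] is chosen before the weight. The supremum [M] over all squares is finite because the weight
    is bounded; that bound only decides how small the boundary term is made, hence disappears from
    [C]. *)
Lemma weighted_S : exists2 C, 0 <= C & forall l l1, weight l l1 -> forall r, 0 < r ->
  int2 r r (fun z => plane_weight l z * S z) <= C.
Proof.
have [Cc Cc0 Hc] := weighted_current.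
have [Cd Cd0 Hd] := weighted_density _ _ _ _ _ _ _ _ _ _ _ cs r0 r0_ge1 small.
have [CJ CJ0 HJ] := weighted_J _ _ _ _ _ _ _ _ _ _ _ cs r0 r0_ge1 small.
have [CS CS0 HS] := finite_S _ _ _ _ _ _ _ _ _ _ _ cs.
pose X := 6304 * (10000^-1 * Cd + CJ) + Cc + 32.
have q2 : 0 <= 10000^-1 :> R by rewrite invr_ge0 ler0n.
have X0 : 0 <= X.
  exact: (addr_ge0 (addr_ge0 (mulr_ge0 (ler0n R 6304) (addr_ge0 (mulr_ge0 q2 Cd0) CJ0)) Cc0)
    (ler0n R 32)).
exists (2 * X); first exact: (mulr_ge0 (ler0n R 2) X0).
move=> l l1 wt.
have cW := continuous_plane_weight _ _ wt.
have W0 := plane_weight_ge0 l.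
have cWS : continuous (fun z => plane_weight l z * S z) by cont_rules.
have WS0 z : 0 <= plane_weight l z * S z := mulr_ge0 (W0 z) (S0 z).
have [k lk] := wt_bounded _ _ wt.
have k0 : 0 < k.
  by apply: lt_le_trans (lk 0); rewrite exprn_gt0// (lt_le_trans ltr01 (wt_ge1 _ _ wt 0)).
pose A := [set v | exists2 r, 0 < r & v = int2 r r (fun z => plane_weight l z * S z)].
have Aub v : A v -> v <= k * CS.
  move=> [r rpos ->]; apply: (@le_trans _ _ (k * int2 r r S)); last exact: (ler_wpM2l (ltW k0) (HS r rpos)).
  rewrite -(int2Zl _ _ _ _ (ltW rpos) cS).
  have ckS : continuous (fun z => k * S z) by cont_rules.
  apply: (int2_le _ _ _ _ (ltW rpos) cWS ckS) => x y _ _.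
  exact: (ler_wpM2r (S0 _) (lk _)).
have An0 : A !=set0 by exists (int2 1 1 (fun z => plane_weight l z * S z)); exists 1.
have Asup : has_sup A by split => //; exists (k * CS).
pose M := sup A.
have HM r : 0 < r -> int2 r r (fun z => plane_weight l z * S z) <= M.
  by move=> rpos; apply: ub_le_sup; [exists (k * CS)|exists r].
have M0 : 0 <= M by apply: le_trans (HM 1 ltr01); apply: int2_ge0.
have kV0 : 0 < k^-1 by rewrite invr_gt0.
have step r : 0 < r -> int2 r r (fun z => plane_weight l z * S z) <= 1 / 2 * M + X.
  (* With |B s| at most 1 / k the weighted boundary term is at most 1. *)
  move=> rpos; have [s [rs r0s] Bs] := B_small _ _ _ _ _ _ _ _ _ _ _ cs r0 r0_ge1 small k^-1 r kV0.
  have s0 : 0 < s := lt_le_trans r00 r0s.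
  have b1 : l s ^+ 2 * `|B s| <= 1.
    apply: (@le_trans _ _ (k * k^-1)); last by rewrite divff// gt_eqF.
    exact: (ler_pM (sqr_ge0 _) (normr_ge0 _) (lk s) Bs).
  have le : int2 r r (fun z => plane_weight l z * S z) <= int2 s s (fun z => plane_weight l z * S z).
    exact: int2_outside_mono.
  have := absorption_arith _ _ _ _ _ _ _ _ (Hc l l1 wt s r0s) b1 (HJ l l1 wt s r0s) (Hd l l1 M wt HM s s0).
  move=> h; apply: (le_trans le); apply: (le_trans h); rewrite -/X lerBlDr lerDl.
  exact: (mulr_ge0 tenth_lt_half M0).
have {}step : M <= 1 / 2 * M + X by apply: ge_sup => // _ [r rpos ->]; exact: step.
move=> r rpos; exact: (le_trans (HM r rpos) (half_absorb _ _ step)).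
Qed.

Lemma weighted_T : exists2 C, 0 <= C & forall l l1, weight l l1 -> forall r, 0 < r ->
  int2 r r (fun z => plane_weight l z * T z) <= C.
Proof.
have [CS CS0 HS] := weighted_S.
have [Cd Cd0 Hd] := weighted_density _ _ _ _ _ _ _ _ _ _ _ cs r0 r0_ge1 small.
have [CJ CJ0 HJ] := weighted_J _ _ _ _ _ _ _ _ _ _ _ cs r0 r0_ge1 small.
have q0 : 0 <= 45 / 44 :> R := divr_ge0 (ler0n R _) (ler0n R _).
have q1' : 0 <= 1536 / 10000 :> R := divr_ge0 (ler0n R _) (ler0n R _).
have q2 : 0 <= 10000^-1 :> R by rewrite invr_ge0 ler0n.
exists (45 / 44 * CS + 180 * (10000^-1 * (1536 / 10000 * CS + Cd) + CJ)).
  exact: (addr_ge0 (mulr_ge0 q0 CS0) (mulr_ge0 (ler0n R 180)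
    (addr_ge0 (mulr_ge0 q2 (addr_ge0 (mulr_ge0 q1' CS0) Cd0)) CJ0))).
move=> l l1 wt r rpos.
have cW := continuous_plane_weight _ _ wt.
have W0 := plane_weight_ge0 l.
pose s := Num.max r r0.
have rs : r <= s by rewrite le_max lexx.
have r0s : r0 <= s by rewrite le_max lexx orbT.
have s0 : 0 < s := lt_le_trans r00 r0s.
have cWS : continuous (fun z => plane_weight l z * S z) by cont_rules.
have cWT : continuous (fun z => plane_weight l z * T z) by cont_rules.
have cWJ : continuous (fun z => plane_weight l z * J z ^+ 2) by have := cJ => ?; cont_rules.
have le1 : int2 r r (fun z => plane_weight l z * T z) <= int2 s s (fun z => plane_weight l z * T z).
  by apply: int2_outside_mono => // x y _ _ _; exact: mulr_ge0.
have c1 : continuous (fun z => 45 / 44 * (plane_weight l z * S z)) by cont_rules.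
have c2 : continuous (fun z => 180 * (plane_weight l z * J z ^+ 2)) by have := cJ => ?; cont_rules.
have TE : int2 s s (fun z => plane_weight l z * T z) =
    45 / 44 * int2 s s (fun z => plane_weight l z * S z) +
    180 * int2 s s (fun z => plane_weight l z * J z ^+ 2).
  rewrite -(int2Zl _ _ _ _ (ltW s0) cWS) -(int2Zl _ _ _ _ (ltW s0) cWJ) -(int2D _ _ _ _ (ltW s0) c1 c2).
  by apply: eq_int1 => x _; apply: eq_int1 => y _; rewrite /T /tangential -/S; ring.
apply: (le_trans le1); rewrite TE; apply: lerD; first exact: (ler_wpM2l q0 (HS l l1 wt s s0)).
apply: (ler_wpM2l (ler0n R 180)); apply: (le_trans (HJ l l1 wt s r0s)); rewrite lerD2r.
exact: (ler_wpM2l q2 (Hd l l1 CS wt (HS l l1 wt) s s0)).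
Qed.

Lemma bracket_T : exists2 C, 0 <= C & forall r, 0 < r ->
  int2 r r (fun z => bracket z.1 * T z) <= C /\ int2 r r (fun z => bracket z.2 * T z) <= C.
Proof.
have [C C0 HC] := weighted_T.
have cpw := @continuous_bracket R.
exists (2 * C); first exact: (mulr_ge0 (ler0n R 2) C0).
(* The truncation moves out with the square, so that eps r^2 <= 1; this is where the uniformity of
   [C] in the weight is used. *)
move=> r rpos; pose eps := (1 + r ^+ 2)^-1.
have e0 : 0 < 1 + r ^+ 2 by rewrite ltr_wpDr ?sqr_ge0.
have eps01 : 0 < eps <= 1 by rewrite invr_gt0 e0 invf_le1// lerDl sqr_ge0.
have er : eps * r ^+ 2 <= 1 by rewrite mulrC ler_pdivrMr// mul1r lerDr.
have wt := weight_wpow eps eps01.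
have cW := continuous_plane_weight _ _ wt.
have cWT : continuous (fun z => plane_weight (wpow eps) z * T z) by cont_rules.
have c2WT : continuous (fun z => 2 * (plane_weight (wpow eps) z * T z)) by cont_rules.
have pww s : `|s| <= r -> bracket s <= 2 * wpow eps s ^+ 2.
  by move=> sr; rewrite -ler_pdivrMl//; exact: sqr_wpow_ge er sr.
have cx := continuous_comp_fst _ cpw; have cy := continuous_comp_snd _ cpw.
have cx' : continuous (fun z => bracket z.1 * T z) by cont_rules.
have cy' : continuous (fun z => bracket z.2 * T z) by cont_rules.
have h : 2 * int2 r r (fun z => plane_weight (wpow eps) z * T z) <= 2 * C.
  exact: (ler_wpM2l (ler0n R 2) (HC _ _ wt r rpos)).
rewrite -(int2Zl _ _ _ _ (ltW rpos) cWT) in h.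
split; apply: le_trans h.
- apply: (int2_le _ _ _ _ (ltW rpos) cx' c2WT) => x y; rewrite -!ler_norml => xr yr /=.
  rewrite mulrA; apply: (ler_wpM2r (T0 _)); apply: (le_trans (pww x xr)).
  exact: (ler_wpM2l (ler0n R 2) (weight_le_plane _ _ wt x y).1).
- apply: (int2_le _ _ _ _ (ltW rpos) cy' c2WT) => x y; rewrite -!ler_norml => xr yr /=.
  rewrite mulrA; apply: (ler_wpM2r (T0 _)); apply: (le_trans (pww y yr)).
  exact: (ler_wpM2l (ler0n R 2) (weight_le_plane _ _ wt x y).2).
Qed.

End WeightedCurrent.

(** * The fourth power of the current *)

Section Bracket.
Context {R : realType}.
Implicit Types (s r : R).

Lemma continuous_bracketV : continuous (fun s : R => (bracket s)^-1).
Proof.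
move=> s; apply: (@continuousV _ _ (@bracket R)); last exact: continuous_bracket.
by rewrite gt_eqF// bracket_gt0.
Qed.

Lemma bracket_ge1 s : 1 <= bracket s.
Proof.
rewrite -(powRr0 (1 + s ^+ 2)) /bracket ler_powR ?lerDl ?sqr_ge0//.
Qed.

Lemma bracketV_le1 s : (bracket s)^-1 <= 1.
Proof. by rewrite invf_le1 ?bracket_gt0// bracket_ge1. Qed.

Lemma bracketV_le s : 0 <= s -> 2 * (bracket s)^-1 <= 4 * (1 + s) `^ (- (11 / 10)).
Proof.
move=> s0; have s1 : 0 < 1 + s by rewrite ltr_wpDr.
have e1 : 0 <= 11 / 20 :> R := divr_ge0 (ler0n R _) (ler0n R _).
have b0 := bracket_gt0 s.
have p0 : 0 < (1 + s) `^ (11 / 10) by rewrite powR_gt0.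
have n0 : 0 <= 1 + s ^+ 2 by rewrite addr_ge0// sqr_ge0.
have h1 : (1 + s) `^ (11 / 10) = ((1 + s) ^+ 2) `^ (11 / 20).
  by rewrite -powR_mulrn ?(ltW s1)// -powRrM; congr (_ `^ _); field.
have h2 : ((1 + s) ^+ 2) `^ (11 / 20) <= (2 * (1 + s ^+ 2)) `^ (11 / 20).
  apply: (ge0_ler_powR e1); rewrite ?nnegrE ?sqr_ge0//; first exact: (mulr_ge0 (ler0n R 2) n0).
  rewrite -subr_ge0 (_ : _ - _ = (1 - s) ^+ 2) ?sqr_ge0//; ring.
have h3 : (2 * (1 + s ^+ 2)) `^ (11 / 20) = 2 `^ (11 / 20) * bracket s.
  by rewrite powRM.
have h4 : 2 `^ (11 / 20) <= 2 :> R.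
  rewrite -[leRHS]powRr1//; apply: ler_powR; first by rewrite ler1n.
  lra.
have h5 : (1 + s) `^ (11 / 10) <= 2 * bracket s.
  by rewrite h1; apply: (le_trans h2); rewrite h3 ler_pM2r.
rewrite powRN (_ : 4 = 2 * 2 :> R); last by rewrite -natrM.
rewrite -mulrA ler_pM2l// -[leLHS]mul1r ler_pdivrMr// mulrAC ler_pdivlMr// mul1r.
exact: h5.
Qed.

(** 42 = 2 + 40: [[-1, 1]] contributes at most 2, and the two tails together are dominated by the
    derivative of - 40 (1 + s)^(-1/10), which stays bounded because the exponent 11/10 exceeds 1. *)
Lemma int1_bracketV r : 1 <= r -> int1 (- r) r (fun s => (bracket s)^-1) <= 42.
Proof.
move=> r1.
pose dg s := 4 * (1 + s) `^ (- (11 / 10)) - ((bracket s)^-1 + (bracket (- s))^-1).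
have d s : 1 <= s <= r -> is_derive s (1 : R)
   (fun s => (- 40) * (1 + s) `^ (- (1 / 10)) - int1 (- s) s (fun s => (bracket s)^-1)) (dg s).
  move=> /andP[s1 _]; have s0 : 0 < s := lt_le_trans ltr01 s1.
  have s10 : 0 < 1 + s by rewrite ltr_wpDr// ltW.
  have d1 := is_derive_int1_sym s _ s0 continuous_bracketV.
  have d2 := is_derive1_powR (- (1 / 10)) s10.
  have d3 : is_derive s (1 : R) (fun s => 1 + s) 1 by derive_rules; ring.
  have d4 := @is_derive1_comp R (fun x => x `^ (- (1 / 10))) (fun s => 1 + s) s _ _ d2 d3.
  have d5 := der_add _ _ _ _ _ (der_mul _ _ _ _ _ (der_cst (- 40) s) d4) (der_opp _ _ _ d1).
  apply: der_eq d5 _; rewrite /dg /GRing.scale/= mul0r add0r.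
  rewrite (_ : - (1 / 10) - 1 = - (11 / 10)); last by field.
  by congr (_ - _); field.
have dg0 s : 1 <= s <= r -> 0 <= dg s.
  move=> /andP[s1 _]; have s0 : 0 <= s := le_trans ler01 s1.
  have := bracketV_le s s0.
  by rewrite /dg (_ : bracket (- s) = bracket s) ?subr_ge0 ?mulr2n ?mulrDl ?mul1r// /bracket sqrrN.
have h := derive_nondecreasing _ _ 1 r r1 d dg0.
have h1 : int1 (- 1) 1 (fun s => (bracket s)^-1) <= 2.
  apply: (@le_trans _ _ (int1 (- 1) 1 (fun=> 1 : R))).
    apply: int1_le; [exact: continuous_bracketV|exact: cont_cst|].
    by move=> s _; exact: bracketV_le1.
  rewrite int1_cst; last by rewrite (le_trans _ ler01)// lerN10.
  by rewrite mul1r opprK.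
have h2 : 0 <= (1 + r) `^ (- (1 / 10)) by rewrite powR_ge0.
have h3 : (1 + 1) `^ (- (1 / 10)) <= 1 :> R.
  rewrite -[leRHS](powRr0 (1 + 1)); apply: ler_powR; first by rewrite lerDl ler01.
  lra.
move: h h1 h2 h3; move: (int1 _ _ _) (int1 _ _ _) (_ `^ _) (_ `^ _) => u v w x; lra.
Qed.

(** Integrate (w g' - k)^2 / w >= 0 and take the optimal constant k; [v] plays the role of the
    inverse of [w], and only a bound on its integral is available. *)
Lemma weighted_cauchy_schwarz (g dg w v : R -> R) (c a b : R) : a <= b -> 0 < c ->
  (forall s, is_derive s (1 : R) g (dg s)) -> continuous dg -> continuous w -> continuous v ->
  (forall s, 0 < v s) -> (forall s, w s * v s = 1) -> int1 a b v <= c ->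
  (g b - g a) ^+ 2 <= c * int1 a b (fun s => w s * dg s ^+ 2).
Proof.
move=> ab c0 d cdg cw cv v0 wv vc.
have cwd : continuous (fun s => w s * dg s ^+ 2) by cont_rules.
have FTC : int1 a b dg = g b - g a.
  exact: (int1_FTC _ _ _ _ ab (continuous_itvcc _ _ _ cdg) (fun s _ => d s)).
pose k := (g b - g a) / c.
have ck : k * c = g b - g a by rewrite /k mulfVK// gt_eqF.
have c1 : continuous (fun s => 2 * k * dg s) by cont_rules.
have c2 : continuous (fun s => k ^+ 2 * v s) by cont_rules.
have c3 : continuous (fun s => w s * dg s ^+ 2 + k ^+ 2 * v s) by cont_rules.
have : int1 a b (fun s => 2 * k * dg s) <= int1 a b (fun s => w s * dg s ^+ 2 + k ^+ 2 * v s).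
  apply: (int1_le _ _ _ _ c1 c3) => s _; rewrite -subr_ge0.
  have w0 : 0 < w s by rewrite -(pmulr_lgt0 _ (v0 s)) wv.
  have -> : v s = (w s)^-1.
    by apply: (mulfI (lt0r_neq0 w0)); rewrite wv divff// gt_eqF.
  rewrite (_ : _ - _ = (w s)^-1 * (w s * dg s - k) ^+ 2); last by field; rewrite gt_eqF.
  by rewrite mulr_ge0 ?sqr_ge0// invr_ge0 ltW.
rewrite (int1D _ _ _ _ cwd c2) (int1Zl _ _ _ _ cdg) (int1Zl _ _ _ _ cv) FTC => h.
have h' := ler_wpM2l (sqr_ge0 k) vc.
have {h h'} h : 2 * k * (g b - g a) - k ^+ 2 * c <= int1 a b (fun s => w s * dg s ^+ 2).
  rewrite lerBlDr; apply: (le_trans h); by rewrite lerD2l.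
have := ler_wpM2l (ltW c0) h.
suff -> : c * (2 * k * (g b - g a) - k ^+ 2 * c) = (g b - g a) ^+ 2 by [].
by rewrite -ck; move: k {ck c1 c2 c3 h} => k; ring.
Qed.

End Bracket.

(** * Pointwise bounds along lines *)

Section LineBound.
Context {R : realType}.
Implicit Types (g h t : R -> R).

Lemma int1_mono_right h (a x b : R) : a < x -> x <= b -> continuous h -> (forall s, 0 <= h s) ->
  int1 a x h <= int1 a b h.
Proof.
move=> ax xb ch h0.
apply: (derive_nondecreasing (fun x => int1 a x h) h x b xb) => // s /andP[xs _].
exact: (is_derive_int1 _ _ _ (lt_le_trans ax xs) ch).
Qed.

Lemma int1_mono_sym h (r s : R) : 0 < r -> r <= s -> continuous h -> (forall x, 0 <= h x) ->
  int1 (- r) r h <= int1 (- s) s h.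
Proof.
move=> r0 rs ch h0.
apply: (derive_nondecreasing (fun x => int1 (- x) x h) (fun x => h x + h (- x)) r s rs) => x /andP[rx _].
  exact: (is_derive_int1_sym _ _ (lt_le_trans r0 rx) ch).
by rewrite addr_ge0.
Qed.

Lemma sqr_sum_arith (u1 u2 v1 v2 e k : R) :
  (u1 - v1) ^+ 2 + (u2 - v2) ^+ 2 <= k -> v1 ^+ 2 + v2 ^+ 2 <= e ->
  u1 ^+ 2 + u2 ^+ 2 <= 2 * e + 2 * k.
Proof.
move=> h1 h2.
have a1 := sqr_ge0 (u1 - 2 * v1); have a2 := sqr_ge0 (u2 - 2 * v2).
have : 2 * ((u1 - v1) ^+ 2 + (u2 - v2) ^+ 2) + 2 * (v1 ^+ 2 + v2 ^+ 2) - (u1 ^+ 2 + u2 ^+ 2) =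
  (u1 - 2 * v1) ^+ 2 + (u2 - 2 * v2) ^+ 2 by ring.
lra.
Qed.

(** The value at [x] is the value at the left end plus an increment, which costs a factor 2, and 84
    = 2 * 42. The resulting bound does not depend on [x]. *)
Lemma line_bound (g1 g2 d1 d2 t : R -> R) (x r e : R) : 1 <= r -> `|x| < r ->
  (forall s, is_derive s (1 : R) g1 (d1 s)) -> (forall s, is_derive s (1 : R) g2 (d2 s)) ->
  continuous d1 -> continuous d2 -> continuous t ->
  (forall s, d1 s ^+ 2 + d2 s ^+ 2 <= t s) ->
  g1 (- r) ^+ 2 + g2 (- r) ^+ 2 <= e ->
  g1 x ^+ 2 + g2 x ^+ 2 <= 2 * e + 84 * int1 (- r) r (fun s => bracket s * t s).
Proof.
move=> r1 xr D1 D2 c1 c2 ct dt ge.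
have /andP[rx xr'] : - r < x < r by rewrite -ltr_norml.
have cb := @continuous_bracket R; have cbV := @continuous_bracketV R.
have bV0 s : 0 < (bracket s)^-1 :> R by rewrite invr_gt0 bracket_gt0.
have bb s : bracket s * (bracket s)^-1 = 1 :> R by rewrite divff// gt_eqF// bracket_gt0.
have vc : int1 (- r) x (fun s => (bracket s)^-1) <= 42.
  apply: le_trans (int1_bracketV r r1).
  exact: (int1_mono_right _ _ _ _ rx (ltW xr') cbV (fun s => ltW (bV0 s))).
have p42 : 0 < 42 :> R by rewrite ltr0n.
have h1 := weighted_cauchy_schwarz g1 d1 _ _ _ _ _ (ltW rx) p42 D1 c1 cb cbV bV0 bb vc.
have h2 := weighted_cauchy_schwarz g2 d2 _ _ _ _ _ (ltW rx) p42 D2 c2 cb cbV bV0 bb vc.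
have t0 s : 0 <= t s by apply: le_trans (dt s); rewrite addr_ge0 ?sqr_ge0.
have cbt : continuous (fun s => bracket s * t s) by cont_rules.
have cb1 : continuous (fun s => bracket s * d1 s ^+ 2) by cont_rules.
have cb2 : continuous (fun s => bracket s * d2 s ^+ 2) by cont_rules.
have cb12 : continuous (fun s => bracket s * d1 s ^+ 2 + bracket s * d2 s ^+ 2) by cont_rules.
have h3 : int1 (- r) x (fun s => bracket s * d1 s ^+ 2) + int1 (- r) x (fun s => bracket s * d2 s ^+ 2) <=
    int1 (- r) x (fun s => bracket s * t s).
  rewrite -(int1D _ _ _ _ cb1 cb2); apply: (int1_le _ _ _ _ cb12 cbt) => s _.
  by rewrite -mulrDr ler_pM2l// bracket_gt0.
have h4 : int1 (- r) x (fun s => bracket s * t s) <= int1 (- r) r (fun s => bracket s * t s).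
  apply: (int1_mono_right _ _ _ _ rx (ltW xr') cbt) => s.
  exact: (mulr_ge0 (ltW (bracket_gt0 s)) (t0 s)).
rewrite (_ : 84 * _ = 2 * (42 * int1 (- r) r (fun s => bracket s * t s))); last by ring.
apply: sqr_sum_arith ge; apply: (le_trans (lerD h1 h2)); rewrite -mulrDr.
exact: (ler_wpM2l (ltW p42) (le_trans h3 h4)).
Qed.

End LineBound.

Section FourthPower.
Context {R : realType}.
Variables f f1 f2 f11 f22 j1 j2 p q q1 J : R * R -> R.
Hypothesis cs : current_system f f1 f2 f11 f22 j1 j2 p q q1 J.
Let T := tangential p q J.

Let cT : continuous T.
Proof.
case: cs => [_ [_ _ ? ? _] ? _ _ _ _ _ _ _ _].
by rewrite /T /tangential /current_energy; cont_rules.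
Qed.
Let T0 z : 0 <= T z.
Proof.
exact: (addr_ge0 (mulr_ge0 (divr_ge0 (ler0n R 45) (ler0n R 44)) (addr_ge0 (sqr_ge0 _) (sqr_ge0 _)))
  (mulr_ge0 (ler0n R 180) (sqr_ge0 _))).
Qed.

Variable r0 : R.
Hypothesis r0_ge1 : 1 <= r0.
Hypothesis small : forall x y (z := (x, y)), outside r0 x y ->
  [/\ `|f z| <= 1 / 100, j1 z ^+ 2 + j2 z ^+ 2 <= 10000^-1, f1 z ^+ 2 + f2 z ^+ 2 <= 10000^-1 &
      2 * (1 - f z) * J z = f2 z * j1 z - f1 z * j2 z].

Lemma current_fourth_power : exists2 C, 0 <= C & forall r, 0 < r ->
  int2 r r (fun z => (j1 z ^+ 2 + j2 z ^+ 2) ^+ 2) <= C.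
Proof.
have [C C0 HC] := bracket_T _ _ _ _ _ _ _ _ _ _ _ cs r0 r0_ge1 small.
exists ((1 + 84 * C) ^+ 2); first exact: sqr_ge0.
move=> r rpos; have rr0 := ltW rpos.
(* The current at the far ends of the lines is made so small, depending on [r], that its
   contribution 4 r e to each one-dimensional integral is at most 1. *)
pose dl := (1 + 4 * r)^-1.
have den : 1 <= 1 + 4 * r by rewrite lerDl; exact: (mulr_ge0 (ler0n R 4) rr0).
have dl0 : 0 < dl by rewrite invr_gt0 (lt_le_trans ltr01).
have dl1 : dl <= 1 by rewrite invf_le1// (lt_le_trans ltr01).
have dlr : 4 * r * dl <= 1.
  by rewrite ler_pdivrMr ?(lt_le_trans ltr01)// mul1r lerDr ler01.
have dle : 4 * r * dl ^+ 2 <= 1.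
  apply: le_trans dlr; apply: (ler_wpM2l (mulr_ge0 (ler0n R 4) rr0)).
  by rewrite expr2 ler_piMr// ltW.
have [r1 r10 H1] := cs_small _ _ _ _ _ _ _ _ _ _ _ cs dl dl0.
(* Lines start at - N, beyond the square of half-side [r] and where |j|^2 <= dl^2 whatever the other
   coordinate is. *)
pose N := Num.max (1 + r) r1.
have rN' : 1 + r <= N by rewrite le_max lexx.
have r1N : r1 <= N by rewrite le_max lexx orbT.
have rN : r < N by apply: lt_le_trans rN'; rewrite ltrDr.
have N1 : 1 <= N by apply: le_trans rN'; rewrite lerDl.
have N0 : 0 < N := lt_le_trans ltr01 N1.
have nN : r1 <= `|- N| by rewrite normrN gtr0_norm.
have [_ [cj1 cj2 cp cq _] cJ _ _ [dj11 dj12] [dj21 dj22] _ _ _ _] := cs.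
have cb := @continuous_bracket R.
have cbx := continuous_comp_fst _ cb; have cby := continuous_comp_snd _ cb.
have cx : continuous (fun z : R * R => bracket z.1 * T z) by cont_rules.
have cy : continuous (fun z : R * R => bracket z.2 * T z) by cont_rules.
pose G y := int1 (- N) N (fun s => bracket s * T (s, y)).
pose K x := int1 (- N) N (fun s => bracket s * T (x, s)).
have cG : continuous G by exact: (continuous_int1_slice2 N _ (ltW N0) cx).
have cK : continuous K by exact: (continuous_int1_slice1 N _ (ltW N0) cy).
have bT0 (s : R) z : 0 <= bracket s * T z := mulr_ge0 (ltW (bracket_gt0 s)) (T0 z).
have G0 y : 0 <= G y by apply: Rintegral_ge0 => s _; exact: bT0.
have K0 x : 0 <= K x by apply: Rintegral_ge0 => s _; exact: bT0.
have iG : int1 (- r) r G <= C.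
  apply: (le_trans (int1_mono_sym G r N rpos (ltW rN) cG G0)).
  by have [h _] := HC N N0; rewrite (int2_swap _ _ _ cx (ltW N0) (ltW N0)) in h.
have iK : int1 (- r) r K <= C.
  apply: (le_trans (int1_mono_sym K r N rpos (ltW rN) cK K0)).
  by have [_ h] := HC N N0.
pose e := dl ^+ 2.
have cpJ : continuous (fun z => p z + 2 * J z) by cont_rules.
have cnq : continuous (fun z => - q z) by cont_rules.
have bx x y : `|x| <= r -> j1 (x, y) ^+ 2 + j2 (x, y) ^+ 2 <= 2 * e + 84 * G y.
  move=> xr; apply: (line_bound (fun s => j1 (s, y)) (fun s => j2 (s, y)) (fun s => - q (s, y))
    (fun s => p (s, y) + 2 * J (s, y)) (fun s => T (s, y)) x N e N1 (le_lt_trans xr rN)).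
  - by move=> s; exact: dj11.
  - by move=> s; exact: dj21.
  - exact: (continuous_slice2 _ y cnq).
  - exact: (continuous_slice2 _ y cpJ).
  - exact: (continuous_slice2 _ y cT).
  - by move=> s; rewrite sqrrN; exact: sum_sqr_tangential.
  - by have [|_ h _] := H1 (- N) y; first by rewrite /outside nN.
have by' x y : `|y| <= r -> j1 (x, y) ^+ 2 + j2 (x, y) ^+ 2 <= 2 * e + 84 * K x.
  move=> yr; apply: (line_bound (fun s => j1 (x, s)) (fun s => j2 (x, s)) (fun s => p (x, s))
    (fun s => q (x, s)) (fun s => T (x, s)) y N e N1 (le_lt_trans yr rN)).
  - by move=> s; exact: dj12.
  - by move=> s; exact: dj22.
  - exact: (continuous_slice1 _ x cp).
  - exact: (continuous_slice1 _ x cq).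
  - exact: (continuous_slice1 _ x cT).
  - by move=> s; exact: sqr_tangential.
  - by have [|_ h _] := H1 x (- N); first by rewrite /outside nN orbT.
pose G' y := 2 * e + 84 * G y; pose K' x := 2 * e + 84 * K x.
have cG' : continuous G' by rewrite /G'; cont_rules.
have cK' : continuous K' by rewrite /K'; cont_rules.
have c4 : continuous (fun z => (j1 z ^+ 2 + j2 z ^+ 2) ^+ 2) by cont_rules.
have cG'z := continuous_comp_snd _ cG'; have cK'z := continuous_comp_fst _ cK'.
have cGK : continuous (fun z : R * R => K' z.1 * G' z.2) by cont_rules.
apply: (@le_trans _ _ (int2 r r (fun z => K' z.1 * G' z.2))).
  apply: (int2_le _ _ _ _ rr0 c4 cGK) => x y; rewrite -!ler_norml => xr yr.
  have s0 : 0 <= j1 (x, y) ^+ 2 + j2 (x, y) ^+ 2 by rewrite addr_ge0 ?sqr_ge0.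
  by rewrite expr2; apply: (ler_pM s0 s0); [exact: by'|exact: bx].
have int' (F : R -> R) : continuous F -> int1 (- r) r F <= C ->
    int1 (- r) r (fun s => 2 * e + 84 * F s) <= 1 + 84 * C.
  move=> cF FC; have c84 : continuous (fun s => 84 * F s) by cont_rules.
  rewrite (int1D _ _ _ _ (cont_cst (2 * e)) c84) (int1Zl _ _ _ _ cF) int1_cst ?ge0_cp//.
  apply: lerD; last exact: (ler_wpM2l (ler0n R 84) FC).
  by rewrite (_ : _ * _ = 4 * r * e)//; ring.
have -> : int2 r r (fun z => K' z.1 * G' z.2) = int1 (- r) r G' * int1 (- r) r K'.
  rewrite -(int1Zl _ _ _ _ cK'); apply: eq_int1 => x _ /=.
  by rewrite (int1Zl _ _ _ _ cG') mulrC.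
have e0 : 0 <= e := sqr_ge0 dl.
have ge0 (F : R -> R) : (forall s, 0 <= F s) -> 0 <= int1 (- r) r (fun s => 2 * e + 84 * F s).
  move=> F0; apply: Rintegral_ge0 => s _.
  exact: (addr_ge0 (mulr_ge0 (ler0n R 2) e0) (mulr_ge0 (ler0n R 84) (F0 s))).
by rewrite expr2; apply: (ler_pM (ge0 G G0) (ge0 K K0) (int' G cG iG) (int' K cK iK)).
Qed.

End FourthPower.

(** * Integrability *)

Lemma sqr_near1 {R : realFieldType} (f : R) : `|f| <= 1 / 100 ->
  98 / 100 <= (1 - f) ^+ 2 <= 103 / 100.
Proof.
rewrite ler_norml => /andP[fl fu].
have h : 0 <= (1 / 100 - f) * (f + 1 / 100) by apply: mulr_ge0; rewrite ?subr_ge0// -(opprK (1 / 100)) subr_ge0.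
have f2 := sqr_ge0 f; rewrite sqrrB expr1n mul1r mulr2n.
rewrite (_ : (1 / 100 - f) * _ = 10000^-1 - f ^+ 2) in h; last by field.
by apply/andP; split; lra.
Qed.

Lemma near1_bounds {R : realFieldType} (u : R) : 98 / 100 <= u <= 103 / 100 ->
  96 / 100 <= u ^+ 2 /\ 4^-1 * u <= 26 / 100.
Proof.
move=> /andP[ul uu]; split; last lra.
have : 0 <= (u - 98 / 100) ^+ 2 := sqr_ge0 _.
rewrite sqrrB mulr2n; lra.
Qed.

(** As (1 - f)^2 is close to 1, f is comparable to the sum of the three remaining terms of the
    identity, and the square of that sum is at most 3 times the sum of squares; X^2 <= X restores
    the power of X. *)
Lemma density_sqr_le {R : realFieldType} (f m D X : R) : `|f| <= 1 / 100 -> 0 <= X -> X <= 10000^-1 ->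
  f * (1 - f) ^+ 2 - m = 2^-1 * (1 - f) * D + X / 4 ->
  f ^+ 2 <= 4 * (D ^+ 2 + X) + 4 * m ^+ 2.
Proof.
move=> f1 X0 X1; have {}X1 : X <= 1 by clear -X1; lra.
have [] := near1_bounds _ (sqr_near1 f f1).
set u := (1 - f) ^+ 2 => u2 u4; set e := 2^-1 * (1 - f) * D => eq.
have XX : X ^+ 2 <= X by rewrite expr2 ler_piMr.
have g : f * u = m + e + X / 4 by rewrite -addrA -eq addrC subrK.
have e2 : e ^+ 2 <= 26 / 100 * D ^+ 2.
  by rewrite (_ : e ^+ 2 = 4^-1 * u * D ^+ 2) ?ler_wpM2r ?sqr_ge0// /e /u; field.
have sq : f ^+ 2 * u ^+ 2 <= 3 * (m ^+ 2 + e ^+ 2 + X ^+ 2 / 16).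
  rewrite -exprMn g.
  have s1 := sqr_ge0 (m - e); have s2 := sqr_ge0 (e - X / 4); have s3 := sqr_ge0 (m - X / 4).
  rewrite -subr_ge0 (_ : _ - _ = (m - e) ^+ 2 + (e - X / 4) ^+ 2 + (m - X / 4) ^+ 2); last by field.
  by rewrite !addr_ge0.
have lo : 96 / 100 * f ^+ 2 <= f ^+ 2 * u ^+ 2 by rewrite mulrC; apply: (ler_wpM2l (sqr_ge0 f) u2).
have m2 := sqr_ge0 m; have D2 := sqr_ge0 D.
move: lo sq e2 XX; move: (f ^+ 2) (f ^+ 2 * u ^+ 2) (e ^+ 2) (X ^+ 2) (D ^+ 2) (m ^+ 2) m2 D2.
move=> a b c d g' h h0 g0; clear -X0 h0 g0; lra.
Qed.

Lemma density_square_integral {R : realType} (f f1 f2 f11 f22 j1 j2 p q q1 J : R * R -> R) :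
  current_system f f1 f2 f11 f22 j1 j2 p q q1 J ->
  exists C, forall r, 0 < r -> int2 r r (fun z => f z ^+ 2) <= C.
Proof.
move=> cs.
have [r0 r01 small] := small_outside _ _ _ _ _ _ _ _ _ _ _ cs.
have [C1 HC1] := finite_energy _ _ _ _ _ _ _ _ _ _ _ cs.
have [C2 C20 HC2] := current_fourth_power _ _ _ _ _ _ _ _ _ _ _ cs r0 r01 small.
have [[cf cf1 cf2 cf11 cf22] [cj1 cj2 cp cq _] _ _ _ _ _ _ H _ _] := cs.
have r00 : 0 < r0 := lt_le_trans ltr01 r01.
pose E := density_energy f1 f2 f11 f22; pose m z := j1 z ^+ 2 + j2 z ^+ 2.
pose S := current_energy p q.
have S0 z : 0 <= S z by rewrite addr_ge0 ?sqr_ge0.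
have E0 z : 0 <= E z by rewrite !addr_ge0 ?sqr_ge0.
have cE : continuous E by rewrite /E /density_energy; cont_rules.
have cS : continuous S by rewrite /S /current_energy; cont_rules.
have cm : continuous (fun z => m z ^+ 2) by rewrite /m; cont_rules.
have cf2' : continuous (fun z => f z ^+ 2) by cont_rules.
have [M M0 HM] := square_bounded r0 _ cf2'.
exists (M * (4 * r0 * r0) + (4 * C1 + 4 * C2)) => r rpos.
pose s := Num.max r r0.
have rs : r <= s by rewrite le_max lexx.
have r0s : r0 <= s by rewrite le_max lexx orbT.
have s0 : 0 < s := lt_le_trans r00 r0s.
have c1 : continuous (fun z => 4 * E z) by cont_rules.
have c2 : continuous (fun z => 4 * m z ^+ 2) by rewrite /m; cont_rules.
have c12 : continuous (fun z => 4 * E z + 4 * m z ^+ 2) by rewrite /m; cont_rules.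
have c3 : continuous (fun z => -1 * f z ^+ 2) by cont_rules.
have c4 : continuous (fun z => (4 * E z + 4 * m z ^+ 2) + -1 * f z ^+ 2) by rewrite /m; cont_rules.
have EC : int2 s s E <= C1.
  have cES : continuous (fun z => E z + S z) by cont_rules.
  apply: le_trans (HC1 s s0); apply: (int2_le _ _ _ _ (ltW s0) cE cES) => x y _ _.
  by rewrite lerDl.
have rhs0 z : 0 <= 4 * E z + 4 * m z ^+ 2.
  exact: (addr_ge0 (mulr_ge0 (ler0n R 4) (E0 z)) (mulr_ge0 (ler0n R 4) (sqr_ge0 _))).
have : - M * (4 * r0 * r0) <= int2 s s (fun z => (4 * E z + 4 * m z ^+ 2) + -1 * f z ^+ 2).
  apply: (int2_ge_outside _ _ _ _ r00 r0s c4) => [x y oxy _ _|x y xr yr].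
  - have [s1 _ s3 _] := small x y oxy.
    rewrite mulN1r subr_ge0; apply: (density_sqr_le _ _ _ _ s1 _ s3 (H (x, y))).
    by rewrite addr_ge0 ?sqr_ge0.
  - rewrite mulN1r -[leLHS]add0r; apply: (lerD (rhs0 _)); rewrite lerN2.
    by rewrite (le_trans (ler_norm _))// HM.
rewrite (int2D _ _ _ _ (ltW s0) c12 c3) (int2D _ _ _ _ (ltW s0) c1 c2).
rewrite (int2Zl _ _ _ _ (ltW s0) cE) (int2Zl _ _ _ _ (ltW s0) cm) (int2Zl _ _ _ _ (ltW s0) cf2').
rewrite mulN1r mulNr lerBrDr addrC lerBlDr => h.
have le : int2 r r (fun z => f z ^+ 2) <= int2 s s (fun z => f z ^+ 2).
  by apply: int2_outside_mono => // *; exact: sqr_ge0.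
apply: (le_trans le); apply: (le_trans h); rewrite addrC; apply: lerD => //.
exact: (lerD (ler_wpM2l (ler0n R 4) EC) (ler_wpM2l (ler0n R 4) (HC2 s s0))).
Qed.

(** Squares of integer half-side exhaust the plane; Tonelli identifies the integral over each with
    [int2], and monotone convergence preserves the common bound. *)
Lemma plane_integral_finite {R : realType} (F : R * R -> R) (C : R) :
  continuous F -> (forall z, 0 <= F z) -> (forall r, 0 < r -> int2 r r F <= C) ->
  (\int[lebesgue_measure \x lebesgue_measure]_z (F z)%:E < +oo)%E.
Proof.
move=> cF F0 FC.
pose Q (n : nat) := box n%:R n%:R : set (measurableTypeR R * measurableTypeR R).
have mF : measurable_fun [set: measurableTypeR R * measurableTypeR R] (EFin \o F).
  by apply/measurable_EFinP; exact: continuous_measurable_plane.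
have Qmono : {homo Q : n m / (n <= m)%N >-> (n <= m)%O}.
  move=> n m nm; apply/subsetPset => -[x y] [/=]; rewrite !in_itv/= -!ler_norml => hx hy.
  have nm' : (n%:R <= m%:R :> R) by rewrite ler_nat.
  by split; rewrite /= in_itv/= -ler_norml (le_trans _ nm').
have QT : \bigcup_n Q n = setT.
  apply/seteqP; split => // -[x y] _.
  have [n Hn] : exists n : nat, Num.max `|x| `|y| <= n%:R.
    by exists (Num.truncn (Num.max `|x| `|y|)).+1; rewrite ltW// truncnS_gt.
  move: Hn; rewrite ge_max => /andP[hx hy].
  by exists n => //; split; rewrite /= in_itv/= -ler_norml.
have FQ n z : Q n z -> (0%R <= (EFin \o F) z)%E by move=> _; rewrite lee_fin.
have cvg := @ge0_nondecreasing_set_cvg_integral _ _ R Q (EFin \o F) (lebesgue_measure \x lebesgue_measure)%E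
  Qmono (fun n => measurable_box _ _) (fun n => measurable_funS measurableT (@subsetT _ _) mF)
  FQ.
rewrite QT in cvg.
apply: (@le_lt_trans _ _ (C%:E)); last exact: ltry.
have -> := esym (cvg_lim (@ereal_hausdorff R) cvg).
apply: lime_le; first by apply/cvg_ex; eexists; exact: cvg.
near=> n.
have n0 : 0 < n%:R :> R by rewrite ltr0n; near: n; exists 1%N.
by rewrite (tonelli_box _ _ _ cF (ltW n0) (ltW n0) F0).1 lee_fin FC.
Unshelve. all: end_near.
Qed.

Theorem theorem1p1 (R : realType) (u : R * R -> Rcomplex R)
  (u_smooth : smooth u)
  (u_eq : forall x, - laplacian u x = u x * (1 - `|u x| ^+ 2)%:C%C)
  (u_lim : forall eps : R, 0 < eps ->
    exists2 M : R, 0 < M &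
      forall x, M < euclidean_norm x -> `| `|u x| - 1 | < eps) :
  (\int[lebesgue_measure \x lebesgue_measure]_x
     ((1 - `|u x| ^+ 2) ^+ 2)%:E < +oo)%E.
Proof.
have [sa sb ea eb] := real_system u u_smooth u_eq.
pose f z := 1 - (cRe \o u) z ^+ 2 - (cIm \o u) z ^+ 2.
have fE z : f z = 1 - `|u z| ^+ 2 by rewrite sqr_norm_Rcomplex opprD addrA.
have flim dl : 0 < dl -> exists2 r, 0 < r & forall x y, outside r x y -> `|f (x, y)| <= dl.
  (* The bound 1 keeps |u| + 1 <= 3, so that |1 - |u|^2| <= 3 * (dl / 3). *)
  move=> dl0; pose eps := Num.min 1 (dl / 3).
  have eps0 : 0 < eps by rewrite lt_min ltr01 divr_gt0.
  have [M M0 HM] := u_lim eps eps0.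
  exists (M + 1); first by rewrite addr_gt0.
  move=> x y oxy; have xyM : M < euclidean_norm (x, y).
    have coord (s t : R) : M + 1 <= `|s| -> M < Num.sqrt (s ^+ 2 + t ^+ 2).
      move=> h; apply: (@lt_le_trans _ _ `|s|); first by apply: lt_le_trans h; rewrite ltrDl.
      by rewrite -sqrtr_sqr ler_wsqrtr// lerDl sqr_ge0.
    by case/orP: oxy => h; rewrite /euclidean_norm/=; [|rewrite addrC]; exact: coord.
  have := HM _ xyM; rewrite fE; move: (`|u (x, y)|) (normr_ge0 (u (x, y))) => n n0 h.
  have h1 : `|n - 1| < 1 by apply: lt_le_trans h _; rewrite ge_min lexx.
  have h2 : `|n - 1| <= dl / 3 by apply/ltW/(lt_le_trans h); rewrite ge_min lexx orbT.
  rewrite (_ : 1 - n ^+ 2 = - ((n - 1) * (n + 1))); last by ring.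
  rewrite normrN normrM (_ : dl = dl / 3 * 3); last by field.
  apply: ler_pM => //; rewrite ger0_norm ?addr_ge0//.
  by move: h1; rewrite ltr_norml => /andP[_]; lra.
have [f1 [f2 [f11 [f22 [j1 [j2 [p [q [q1 [J cs]]]]]]]]]] := current_system_of_smooth _ _ sa sb ea eb flim.
have [C HC] := density_square_integral _ _ _ _ _ _ _ _ _ _ _ cs.
have [[cf _ _ _ _] _ _ _ _ _ _ _ _ _ _] := cs.
have -> : (fun x => ((1 - `|u x| ^+ 2) ^+ 2)%:E) = (fun x => (f x ^+ 2)%:E).
  by apply/funext => x; rewrite fE.
apply: (plane_integral_finite _ C) => //.
- by cont_rules.
- by move=> z; exact: sqr_ge0.
Qed.
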